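(* Let $0<\beta<\infty$, $u\in H(\mathbb{D})$, $\varphi\in S(\mathbb{D})$, and suppose $uC_\varphi:\mathcal{B}\to\mathcal{Z}_\beta$ is bounded. Then $$\|uC_\varphi\|_{e,\mathcal{B}\to\mathcal{Z}_\beta}\asymp\max\Big\{\limsup_{n\to\infty}(n+1)\|(2u'\varphi'+u\varphi'')\varphi^n\|_{\nu_\beta},\ \limsup_{n\to\infty}(n+1)^{2}\|u(\varphi')^2\varphi^n\|_{\nu_\beta},\ \limsup_{n\to\infty}(\log n)\|u''\varphi^n\|_{\nu_\beta}\Big\}.$$
   Context: $\mathbb{D}$ is the open unit disk, $H(\mathbb{D})$ the holomorphic functions on $\mathbb{D}$, $S(\mathbb{D})$ the holomorphic self-maps of $\mathbb{D}$; $uC_\varphi f(z)=u(z)f(\varphi(z))$, and $\varphi^n$ is the $n$-th power of $\varphi$. $\mathcal{B}$ is the Bloch space of $f\in H(\mathbb{D})$ with $\sup_z(1-|z|^2)|f'(z)|<\infty$, normed by $|f(0)|+\sup_z(1-|z|^2)|f'(z)|$. $\mathcal{Z}_\beta$ is the space of $f\in H(\mathbb{D})$ with $\sup_z(1-|z|^2)^\beta|f''(z)|<\infty$, normed by $|f(0)|+|f'(0)|+\sup_z(1-|z|^2)^\beta|f''(z)|$. For $g\in H(\mathbb{D})$, $\|g\|_{\nu_\beta}=\sup_z(1-|z|^2)^\beta|g(z)|$. The essential norm of a bounded operator $T:X\to Y$ is $\inf\{\|T-K\|:K:X\to Y\text{ compact}\}$. $A\asymp B$ means $B/C\le A\le CB$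 for a positive constant $C$ independent of $u,\varphi$. *)

(* Defs.v *)
From HB Require Import structures.
From mathcomp Require Import all_boot all_order all_algebra.
From mathcomp Require Import all_classical all_reals all_analysis.
From mathcomp Require Import complex.
Import Order.TTheory GRing.Theory Num.Theory.
Import numFieldNormedType.Exports.
Local Open Scope classical_set_scope.
Local Open Scope ring_scope.

Set Implicit Arguments.
Unset Strict Implicit.
Unset Printing Implicit Defensive.

Section Defs.
Variable R : realType.
Local Notation C := (R[i]).

Definition cabs (z : C) : R := complex.Re `|z|.

Definition disk : set C := [set z | cabs z < 1].

Definition cder (f : C -> C) : C -> C := derive1 (f : C^o -> C^o).

(* f is holomorphic on the disk (values outside the disk are irrelevant) *)
Definition holo (f : C -> C) : Prop :=
  forall z, disk z -> derivable (f : C^o -> C^o) z 1.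

Definition selfmap (phi : C -> C) : Prop :=
  holo phi /\ forall z, disk z -> disk (phi z).

Definition wgt (beta : R) (z : C) : R := (1 - cabs z ^+ 2) `^ beta.

Definition bloch_semi (f : C -> C) : \bar R :=
  ereal_sup [set ((1 - cabs z ^+ 2) * cabs (cder f z))%:E | z in disk].
Definition bloch_norm (f : C -> C) : \bar R :=
  ((cabs (f 0))%:E + bloch_semi f)%E.
Definition in_bloch (f : C -> C) : Prop := holo f /\ (bloch_semi f < +oo)%E.

Definition zyg_semi (beta : R) (f : C -> C) : \bar R :=
  ereal_sup [set (wgt beta z * cabs (cder (cder f) z))%:E | z in disk].
Definition zyg_norm (beta : R) (f : C -> C) : \bar R :=
  ((cabs (f 0) + cabs (cder f 0))%:E + zyg_semi beta f)%E.
Definition in_zyg (beta : R) (f : C -> C) : Prop :=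
  holo f /\ (zyg_semi beta f < +oo)%E.

Definition nu_norm (beta : R) (g : C -> C) : \bar R :=
  ereal_sup [set (wgt beta z * cabs (g z))%:E | z in disk].

Definition wcomp (u phi : C -> C) (f : C -> C) : C -> C :=
  fun z => u z * f (phi z).

(* operators are maps (C -> C) -> (C -> C); only their action on Bloch
   functions restricted to the disk matters *)
Definition op_welldef (T : (C -> C) -> (C -> C)) : Prop :=
  forall f g, in_bloch f -> in_bloch g ->
    (forall z, disk z -> f z = g z) -> forall z, disk z -> T f z = T g z.

Definition op_linear (T : (C -> C) -> (C -> C)) : Prop :=
  forall f g (a : C), in_bloch f -> in_bloch g ->
    forall z, disk z -> T (fun w => f w + a * g w) z = T f z + a * T g z.

Definition bounded_op (beta : R) (T : (C -> C) -> (C -> C)) : Prop :=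
  [/\ op_welldef T, op_linear T,
      (forall f, in_bloch f -> in_zyg beta (T f)) &
      exists M : R, forall f, in_bloch f ->
        (zyg_norm beta (T f) <= M%:E * bloch_norm f)%E].

Definition compact_op (beta : R) (K : (C -> C) -> (C -> C)) : Prop :=
  [/\ op_welldef K, op_linear K,
      (forall f, in_bloch f -> in_zyg beta (K f)) &
      forall fs : nat -> C -> C,
        (forall n, in_bloch (fs n) /\ (bloch_norm (fs n) <= 1)%E) ->
        exists sigma : nat -> nat, (forall n, (sigma n < sigma n.+1)%N) /\
          exists g, in_zyg beta g /\
            (fun n => zyg_norm beta (fun z => K (fs (sigma n)) z - g z))
              @ \oo --> 0%E].

Definition opnorm (beta : R) (T : (C -> C) -> (C -> C)) : \bar R :=
  ereal_sup [set zyg_norm beta (T f) |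
             f in [set f | in_bloch f /\ (bloch_norm f <= 1)%E]].

Definition essnorm (beta : R) (T : (C -> C) -> (C -> C)) : \bar R :=
  ereal_inf [set opnorm beta (fun f z => T f z - K f z) |
             K in compact_op beta].

End Defs.

(* Main.v *)
Require Import Defs.
From HB Require Import structures.
From mathcomp Require Import all_boot all_order all_algebra.
From mathcomp Require Import all_classical all_reals all_analysis.
From mathcomp Require Import complex ring lra zify.
Import Order.TTheory GRing.Theory Num.Theory.
Import numFieldNormedType.Exports.
Local Open Scope classical_set_scope.
Local Open Scope ring_scope.

Set Implicit Arguments.
Unset Strict Implicit.
Unset Printing Implicit Defensive.

(** Differentiating twice, (u C_phi f)'' = U (f o phi) + V (f' o phi) + W (f'' o phi) with
   U = u'', V = 2 u' phi' + u phi'' and W = u phi'^2.  Since n x^n (1 - x), n^2 x^n (1 - x)^2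
   and (log n) x^n - log (1/(1 - x)) are bounded above on [0, 1), while x^n stays away from 0
   for n of order 1/(1 - x), the three limits superior measure the sizes, for |phi(z)| close
   to 1, of V / (1 - |phi|), W / (1 - |phi|)^2 and U log (1/(1 - |phi|)), weighted by
   (1 - |z|^2)^beta.

   Upper bound: the maps f |-> u C_phi (T_N f_r), with f_r(z) = f(r z) and T_N a Taylor
   polynomial, have finite rank.  For r close to 1, f - f_r and its first two derivatives are
   small on compact sets, while near the circle they obey the growth estimates of Bloch
   functions (Cauchy estimates), which are compensated by the three weights above.

   Lower bound: a compact operator sends suitable functions of a bounded, locally vanishing
   sequence to functions of small norm (gliding hump).  With w = phi(z) and w^n bounded away
   from 0, one tests u C_phi on polynomials vanishing at w to order two, to order one, and on
   a truncated logarithm with growth log (1/(1 - |w|)), which bounds W, then V, then U.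

   The Cauchy formula is obtained from Goursat's argument, with integrals over [0, 1] defined
   as limits of dyadic Riemann sums. *)

(** The obstacle in the lower bound is that a compact operator is known only through convergent
    subsequences: nothing says beforehand that it sends a bounded, locally vanishing sequence to a
    null sequence. Summing humps replaces weak convergence: J of them keep a bounded Bloch seminorm,
    while their images add up to about J times the limit. The order W, V, U is forced by the growth
    estimates: a test function with a simple zero at w may have a second derivative of order 1/(1 -
    |w|)^2 there, and the logarithm also a first derivative of order 1/(1 - |w|); these are harmless
    only once W, and then V, is controlled. In the upper bound, dilation alone would call for a
    normal families argument; the Taylor truncation leaves finitely many bounded functionals. The
    region where |phi(z)| stays away from 1 costs nothing in either direction, because testing on 1,
    z and z^2 bounds the three weighted coefficients. The constants come from the scales and the
    test functions only, so they depend neither on u and phi nor on beta. *)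

(** Multiplying out the difference quotient removes the division and the punctured neighbourhood.
    The general field serves real and complex derivatives alike. *)
Lemma is_derive_littleo (K : numFieldType) (f : K -> K) (x l : K) :
  is_derive (x : K^o) 1 (f : K^o -> K^o) l <->
  forall e : K, 0 < e -> exists2 d : K, 0 < d &
    forall y, `|y - x| < d -> `|f y - f x - l * (y - x)| <= e * `|y - x|.
Proof.
split=> [[df dl] e e0|h].
- move: df; rewrite /derivable => /cvg_ex[/= k kP].
  have kl : k = l by rewrite -dl /derive; apply/esym/cvg_lim.
  subst k; move/cvgrPdist_le : kP => /(_ e e0)[d /= d0 hd].
  exists d => // y yx; have [->|nz] := eqVneq y x.
    by rewrite !subrr mulr0 subrr normr0 mulr0.
  have nz' : y - x != 0 by rewrite subr_eq0.
  have := hd (y - x); rewrite /ball_ /= sub0r normrN => /(_ yx nz').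
  rewrite /GRing.scale /= mulr1 subrK => hh.
  have -> : f y - f x - l * (y - x) = - ((l - (y - x)^-1 * (f y - f x)) * (y - x)) by field.
  by rewrite normrN normrM ler_wpM2r.
- have H : (fun w : K^o => w^-1 *: ((f : K^o -> K^o) (w *: 1 + x) - f x) : K^o) @ 0^' --> (l : K^o).
    apply/cvgrPdist_le => /= e /h[d d0 hd].
    exists d => // w; rewrite /ball_ /= sub0r normrN => wd w0.
    have := hd (w + x); rewrite addrK => /(_ wd) hh.
    rewrite /GRing.scale /= mulr1.
    have -> : l - w^-1 * (f (w + x) - f x) = - (f (w + x) - f x - l * w) / w by field.
    by rewrite normrM normrN normfV ler_pdivrMr// normr_gt0.
split; first by apply/cvg_ex; exists l.
by apply/cvg_lim.
Qed.

(** * Real-valued modulus and epsilon-delta complex differentiability *)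

Section ComplexModulus.
Variable R : realType.
Local Notation C := (R[i]).
Implicit Types (x y z w l : C) (f g : C -> C).

Lemma eq_ler (a b : R) : a = b -> a <= b.
Proof. by move=> ->. Qed.

Lemma ltr0c (k : R) : (0 < k%:C%C) = (0 < k).
Proof. exact: ltcR. Qed.

Lemma cabsE z : cabs z = Normc.normc z.
Proof. by case: z. Qed.

Lemma normE z : `|z| = (cabs z)%:C%C.
Proof. by rewrite cabsE; case: z. Qed.

Lemma cabs_ge0 z : 0 <= cabs z.
Proof. by rewrite -ler0c -normE. Qed.

Lemma cabs0 : cabs (0 : C) = 0.
Proof. by rewrite /cabs normr0. Qed.

Lemma cabs1 : cabs (1 : C) = 1.
Proof. by rewrite /cabs normr1. Qed.

Lemma cabsM x y : cabs (x * y) = cabs x * cabs y.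
Proof. by rewrite !cabsE Normc.normcM. Qed.

Lemma cabsN x : cabs (- x) = cabs x.
Proof. by rewrite /cabs normrN. Qed.

Lemma cabsD x y : cabs (x + y) <= cabs x + cabs y.
Proof. by rewrite -lecR rmorphD /= -!normE ler_normD. Qed.

Lemma cabs_dist x y : cabs (x - y) = cabs (y - x).
Proof. by rewrite /cabs distrC. Qed.

Lemma cabsB x y : cabs (x - y) <= cabs x + cabs y.
Proof. by rewrite -(cabsN y) cabsD. Qed.

Lemma cabsX x n : cabs (x ^+ n) = cabs x ^+ n.
Proof. by elim: n => [|n ih]; rewrite ?expr0 ?cabs1// !exprS cabsM ih. Qed.

Lemma cabsV x : cabs x^-1 = (cabs x)^-1.
Proof. by rewrite !cabsE Normc.normcV. Qed.

Lemma cabs0_eq0 x : cabs x = 0 -> x = 0.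
Proof. by rewrite cabsE => /Normc.eq0_normc. Qed.

Lemma cabs_gt0 x : (0 < cabs x) = (x != 0).
Proof.
rewrite lt_def cabs_ge0 andbT; congr negb; apply/eqP/eqP; first exact: cabs0_eq0.
by move=> ->; rewrite cabs0.
Qed.

Lemma cabsC (a : R) : cabs a%:C%C = `|a|.
Proof. by rewrite /cabs normc_def /= expr0n addr0 sqrtr_sqr. Qed.

Lemma cabs_nat n : cabs (n%:R : C) = n%:R.
Proof. by rewrite -(rmorph_nat (real_complex R)) cabsC normr_nat. Qed.

Lemma ler_Re_cabs z : `|complex.Re z| <= cabs z.
Proof. by rewrite -lecR -normE normc_ge_Re. Qed.

Lemma ler_Im_cabs z : `|complex.Im z| <= cabs z.
Proof.
rewrite /cabs normc_def /= -sqrtr_sqr ler_wsqrtr// lerDr sqr_ge0 //.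
Qed.

Lemma ler_cabs_ReIm z : cabs z <= `|complex.Re z| + `|complex.Im z|.
Proof.
rewrite {1}(complexE z) (le_trans (cabsD _ _))// cabsM !cabsC.
by rewrite /cabs normc_def /= expr0n add0r expr1n sqrtr1 mul1r.
Qed.

Lemma cabs_sum (I : Type) (s : seq I) (P : pred I) (F : I -> C) :
  cabs (\sum_(i <- s | P i) F i) <= \sum_(i <- s | P i) cabs (F i).
Proof.
elim/big_ind2 : _ => [|x1 x2 y1 y2 h1 h2|//]; first by rewrite cabs0.
by rewrite (le_trans (cabsD _ _))// lerD.
Qed.

Lemma cabs_conj z : cabs (z^*)%C = cabs z.
Proof. by rewrite /cabs normcJ. Qed.

Lemma mul_conj z : (z^*)%C * z = (cabs z ^+ 2)%:C%C.
Proof. by rewrite mulrC -sqr_normc normE rmorphXn. Qed.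

Lemma cabs_subr x y : cabs x - cabs y <= cabs (x - y).
Proof.
by rewrite lerBlDr (le_trans _ (cabsD (x - y) y))// subrK.
Qed.

(** The norm of [R[i]] takes values in [R[i]]; with [cabs] the epsilons and the inequalities live in
    the ordered field [R], where [lra] applies. *)
Definition cdiff f z l := forall e : R, 0 < e -> exists2 d : R, 0 < d &
  forall w, cabs (w - z) < d ->
    cabs (f w - f z - l * (w - z)) <= e * cabs (w - z).

Lemma cdiffP f z l :
  is_derive (z : C^o) 1 (f : C^o -> C^o) l <-> cdiff f z l.
Proof.
(* A positive complex number is real, hence equal to its modulus; this carries epsilon and delta
   between [R] and [C]. *)
have cE (e : C) : 0 < e -> e = (cabs e)%:C%C by move=> e0; rewrite -normE gtr0_norm.
apply: (iff_trans (is_derive_littleo _ _ _)); split=> h e e0.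
  have /h[d d0 hd] : 0 < e%:C%C by rewrite ltr0c.
  have dE := cE _ d0; exists (cabs d); first by rewrite -ltr0c -dE.
  by move=> w; rewrite dE in hd; have := hd w; rewrite !normE ltcR -rmorphM lecR.
have eE := cE _ e0; have [|d d0 hd] := h (cabs e); first by rewrite -ltr0c -eE.
exists d%:C%C; first by rewrite ltr0c.
by move=> w; have := hd w; rewrite eE !normE ltcR -rmorphM lecR -eE.
Qed.

Lemma cdiff_derivable f z l : cdiff f z l -> derivable (f : C^o -> C^o) z 1.
Proof. by move=> /cdiffP h; exact: ex_derive. Qed.

Lemma cdiff_cder f z l : cdiff f z l -> cder f z = l.
Proof. by move=> /cdiffP h; rewrite /cder derive1E derive_val. Qed.

Lemma derivable_cdiff f z : derivable (f : C^o -> C^o) z 1 -> cdiff f z (cder f z).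
Proof. by move=> /derivableP; rewrite -derive1E => /cdiffP. Qed.

Lemma cdiff_ext f g z l (r : R) : 0 < r ->
  (forall w, cabs (w - z) < r -> f w = g w) -> cdiff f z l -> cdiff g z l.
Proof.
move=> r0 fg h e /h [d d0 hd]; exists (Num.min r d); first by rewrite lt_min r0.
move=> w; rewrite lt_min => /andP[wr wd].
by rewrite -!fg ?subrr ?cabs0//; exact: hd.
Qed.

Lemma cdiff_eq f z l l' : cdiff f z l -> l = l' -> cdiff f z l'.
Proof. by move=> h <-. Qed.

Lemma cdiff_cst (a : C) z : cdiff (fun=> a) z 0.
Proof. by move=> e e0; exists 1 => // w _; rewrite mul0r !subrr cabs0 mulr_ge0 ?cabs_ge0 ?ltW. Qed.

Lemma cdiff_id z : cdiff id z 1.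
Proof. by move=> e e0; exists 1 => // w _; rewrite mul1r !subrr cabs0 mulr_ge0 ?cabs_ge0 ?ltW. Qed.

Lemma cdiffD f g z l m : cdiff f z l -> cdiff g z m ->
  cdiff (fun w => f w + g w) z (l + m).
Proof.
move=> /cdiffP hf /cdiffP hg.
exact: (iffLR (cdiffP _ _ _) (@is_deriveD _ _ _ (f : C^o -> C^o) g z 1 l m hf hg)).
Qed.

Lemma cdiffM f g z l m : cdiff f z l -> cdiff g z m ->
  cdiff (fun w => f w * g w) z (l * g z + f z * m).
Proof.
move=> /cdiffP hf /cdiffP hg; apply: (iffLR (cdiffP _ _ _)).
have := @is_deriveM _ _ (f : C^o -> C^o) g z 1 l m hf hg.
by rewrite /GRing.scale /= addrC (mulrC l).
Qed.

Lemma cdiffZ f z l (a : C) : cdiff f z l -> cdiff (fun w => a * f w) z (a * l).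
Proof.
move=> h; apply: cdiff_eq (cdiffM (cdiff_cst a z) h) _.
by rewrite mul0r add0r.
Qed.

Lemma cdiffB f g z l m : cdiff f z l -> cdiff g z m ->
  cdiff (fun w => f w - g w) z (l - m).
Proof.
move=> hf /(cdiffZ (-1)) hg; move: (cdiffD hf hg).
rewrite mulN1r => h; apply: (cdiff_ext ltr01) h => w _.
by rewrite mulN1r.
Qed.

Lemma cdiff_sum (n : nat) (F : nat -> C -> C) (l : nat -> C) z :
  (forall i, (i < n)%N -> cdiff (F i) z (l i)) ->
  cdiff (fun w => \sum_(i < n) F i w) z (\sum_(i < n) l i).
Proof.
elim: n => [|n ih] h.
  rewrite big_ord0; apply: (cdiff_ext ltr01) (cdiff_cst 0 z) => w _.
  by rewrite big_ord0.
rewrite big_ord_recr /=.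
apply: (cdiff_ext ltr01) (cdiffD (ih _) (h n _)) => //.
  by move=> w _; rewrite big_ord_recr.
by move=> i ?; apply: h; rewrite ltnS ltnW.
Qed.

Lemma cdiff_lip f z l : cdiff f z l -> exists2 d : R, 0 < d &
  forall w, cabs (w - z) < d -> cabs (f w - f z) <= (cabs l + 1) * cabs (w - z).
Proof.
move=> /(_ 1 ltr01)[d d0 hd]; exists d => // w /hd h.
have -> : f w - f z = (f w - f z - l * (w - z)) + l * (w - z) by ring.
by rewrite (le_trans (cabsD _ _))// cabsM; lra.
Qed.

(** The chain rule for an abstract parameter [t]: [dist] and [del] become a complex increment in
    [cdiff_comp] and a real one in [rdiff_comp]. *)
Lemma littleo_comp (T : Type) (dist : T -> R) (del : T -> C) (g : T -> C) f (b l m : C) :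
  (forall t, cabs (del t) = dist t) ->
  (forall e : R, 0 < e -> exists2 d : R, 0 < d &
     forall t, dist t < d -> cabs (g t - b - m * del t) <= e * dist t) ->
  cdiff f b l ->
  forall e : R, 0 < e -> exists2 d : R, 0 < d &
     forall t, dist t < d -> cabs (f (g t) - f b - l * m * del t) <= e * dist t.
Proof.
move=> dE hg hf e e0.
have M0 := cabs_ge0 m; have L0 := cabs_ge0 l.
have e1 : 0 < e / (2 * (cabs m + 1)) by apply: divr_gt0 => //; lra.
have e2 : 0 < e / (2 * (cabs l + 1)) by apply: divr_gt0 => //; lra.
have [d1 d10 h1] := hg _ ltr01.
have [d2 d20 h2] := hf _ e1.
have [d3 d30 h3] := hg _ e2.
(* The error is that of [f] at distance at most (|m| + 1) [dist t], plus |l| times that of [g]; each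
   takes half of e. The last entry of the minimum brings g t into the range of [h2]. *)
exists (Num.min (Num.min d1 d3) (d2 / (cabs m + 1))).
  by rewrite !lt_min d10 d30 divr_gt0//; lra.
move=> t; rewrite !lt_min => /andP[/andP[/h1 {}h1 /h3 {}h3]].
rewrite ltr_pdivlMr; last lra.
have W0 := cabs_ge0 (del t); rewrite dE in W0; move=> w2.
have gl : cabs (g t - b) <= (cabs m + 1) * dist t.
  have -> : g t - b = (g t - b - m * del t) + m * del t by ring.
  by apply: le_trans (cabsD _ _) _; rewrite cabsM dE; lra.
have /h2 {h2} : cabs (g t - b) < d2 by rewrite (le_lt_trans gl)// mulrC.
move: h3; set A := g t - b - _ => hA; set B := f _ - _ - _ => hB.
have -> : f (g t) - f b - l * m * del t = B + l * A by rewrite /A /B; ring.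
rewrite (le_trans (cabsD _ _))// cabsM.
have : cabs B <= e / 2 * dist t.
  apply: le_trans hB _; apply: le_trans (_ : e / (2 * (cabs m + 1)) * ((cabs m + 1) * dist t) <= _).
    by rewrite ler_pM2l.
  by apply: eq_ler; field; apply/eqP; lra.
have : cabs l * cabs A <= e / 2 * dist t.
  apply: le_trans (_ : (cabs l + 1) * (e / (2 * (cabs l + 1)) * dist t) <= _).
    by apply: ler_pM => //; rewrite ?cabs_ge0//; lra.
  by apply: eq_ler; field; apply/eqP; lra.
by lra.
Qed.

Lemma cdiff_comp f g z l m : cdiff g z m -> cdiff f (g z) l ->
  cdiff (fun w => f (g w)) z (l * m).
Proof. by move=> hg; apply: (littleo_comp (dist := fun w => cabs (w - z)) (del := fun w => w - z)). Qed.

Lemma cdiffX f z l n : cdiff f z l -> cdiff (fun w => f w ^+ n) z (n%:R * f z ^+ n.-1 * l).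
Proof.
move=> h; elim: n => [|n ih].
  apply: (cdiff_ext ltr01) (cdiff_eq (cdiff_cst 1 z) _); last by rewrite !mul0r.
  by move=> w _; rewrite expr0.
apply: (cdiff_ext ltr01) (cdiff_eq (cdiffM h ih) _) => /=.
  by move=> w _; rewrite exprS.
case: n {ih} => [|n] /=; first by ring.
by rewrite exprS; ring.
Qed.

Lemma cdiff_inv z : z != 0 -> cdiff (fun w => w^-1) z (- (z ^+ 2)^-1).
Proof.
move=> z0 e e0; have m0 : 0 < cabs z by rewrite cabs_gt0.
have m3 : 0 < cabs z ^+ 3 by rewrite exprn_gt0.
(* The remainder is (w - z)^2 / (w z^2): the first entry gives |w| >= |z| / 2, and then the second
   gives |w - z| <= e |w| |z|^2. *)
exists (Num.min (cabs z / 2) (e * (cabs z ^+ 3 / 2))).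
  by rewrite lt_min !mulr_gt0.
move=> w; rewrite lt_min => /andP[w1 w2].
have hw : cabs z / 2 <= cabs w.
  by have := cabs_subr z w; rewrite cabs_dist; lra.
have w0 : w != 0 by rewrite -cabs_gt0 (lt_le_trans _ hw)// divr_gt0.
have -> : w^-1 - z^-1 - - (z ^+ 2)^-1 * (w - z) = (w - z) ^+ 2 / (w * z ^+ 2).
  by field; rewrite z0 w0.
rewrite cabsM cabsV cabsX cabsM cabsX ler_pdivrMr; last first.
  by rewrite mulr_gt0 ?exprn_gt0// cabs_gt0.
apply: (@le_trans _ _ (cabs (w - z) * (e * (cabs z ^+ 3 / 2)))).
  by rewrite expr2 ler_wpM2l ?cabs_ge0 ?ltW.
have -> : e * cabs (w - z) * (cabs w * cabs z ^+ 2) =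
  cabs (w - z) * (e * (cabs w * cabs z ^+ 2)) by ring.
rewrite ler_wpM2l ?cabs_ge0// ler_pM2l//.
have -> : cabs z ^+ 3 / 2 = cabs z / 2 * cabs z ^+ 2 by field.
by rewrite ler_wpM2r ?exprn_ge0 ?cabs_ge0.
Qed.

Lemma cdiffV f z l : cdiff f z l -> f z != 0 ->
  cdiff (fun w => (f w)^-1) z (- l / f z ^+ 2).
Proof.
move=> hf nz; apply: cdiff_eq (cdiff_comp hf (cdiff_inv nz)) _.
by rewrite !mulNr mulrC.
Qed.

Definition ccont f (z : C) := forall e : R, 0 < e -> exists2 d : R, 0 < d &
  forall w, cabs (w - z) < d -> cabs (f w - f z) <= e.

Lemma ccont_cdiff f z l : cdiff f z l -> ccont f z.
Proof.
move=> /cdiff_lip[d d0 hd] e e0; have L0 := cabs_ge0 l.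
exists (Num.min d (e / (cabs l + 1))); first by rewrite lt_min d0 divr_gt0//; lra.
move=> w; rewrite lt_min => /andP[/hd h]; rewrite ltr_pdivlMr; last lra.
by move=> hw; rewrite (le_trans h)// mulrC ltW.
Qed.

End ComplexModulus.

(** * Subsequences and sequential compactness *)

Section Sequences.
Variable R : realType.
Local Notation C := (R[i]).
Implicit Types (u v : nat -> C) (l : C) (s : nat -> nat).

Lemma subseq_ge s : (forall n, (s n < s n.+1)%N) -> forall n, (n <= s n)%N.
Proof. by move=> h; elim=> [|n ih]//; exact: leq_ltn_trans ih (h n). Qed.

Lemma subseq_lt s : (forall n, (s n < s n.+1)%N) ->
  forall m n, (m < n)%N -> (s m < s n)%N.
Proof.
move=> h m; elim=> [//|n ih]; rewrite ltnS leq_eqVlt => /orP[/eqP->//|/ih].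
by move=> /ltn_trans; apply.
Qed.

Definition ctends u l := forall e : R, 0 < e -> exists N : nat,
  forall n, (N <= n)%N -> cabs (u n - l) <= e.

Lemma arbitrarily_small (a : R) : (forall e : R, 0 < e -> a <= e) -> a <= 0.
Proof. by move=> h; rewrite leNgt; apply/negP => a0; have := h (a / 2); lra. Qed.

Lemma ctends_uniq u l l' : ctends u l -> ctends u l' -> l = l'.
Proof.
move=> h h'; apply/eqP; rewrite -subr_eq0; apply/eqP/cabs0_eq0/le_anti.
rewrite cabs_ge0 andbT; apply: arbitrarily_small => e e0.
have e2 : 0 < e / 2 by lra.
have [N hN] := h _ e2; have [N' hN'] := h' _ e2.
have := hN (maxn N N') (leq_maxl _ _); have := hN' (maxn N N') (leq_maxr _ _).
move: (u _) => x h1 h2; have -> : l - l' = (x - l') - (x - l) by ring.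
by rewrite (le_trans (cabsB _ _))//; lra.
Qed.

Lemma ctends_bound u l (M : R) : ctends u l -> (forall n, cabs (u n) <= M) ->
  cabs l <= M.
Proof.
move=> h hM; rewrite -subr_le0; apply: arbitrarily_small => e /h[N /(_ N (leqnn _)) hN].
have := hM N; have := cabs_subr l (u N); rewrite cabs_dist; lra.
Qed.

Lemma bw_real (u : nat -> R) (M : R) : (forall n, `|u n| <= M) ->
  exists s, (forall n, (s n < s n.+1)%N) /\ exists l : R, forall e, 0 < e ->
    exists N : nat, forall n, (N <= n)%N -> `|u (s n) - l| <= e.
Proof.
move=> hM; have bu : bounded_fun u.
  exists M; split; first exact: num_real.
  by move=> x Mx n _ /=; exact: le_trans (hM n) (ltW Mx).
have [s si /cvg_ex[/= l /cvgrPdist_le sl]] := bolzano_weierstrass bu.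
exists s; split; first by move=> n; move: (leW_mono si n n.+1); rewrite !ltEnat /= ltnSn.
exists l => e /sl[N _ hN]; exists N => n Nn.
by rewrite distrC; exact: hN.
Qed.

Lemma bw_unit_interval (u : nat -> R) : (forall n, 0 <= u n <= 1) ->
  exists s, (forall n, (s n < s n.+1)%N) /\ exists2 l : R, 0 <= l <= 1 &
    forall e, 0 < e -> exists N : nat, forall n, (N <= n)%N -> `|u (s n) - l| <= e.
Proof.
move=> h; have [n|s [hs [l hl]]] := @bw_real u 1.
  by have /andP[a b] := h n; rewrite ger0_norm.
exists s; split => //; exists l => //.
apply/andP; split; [rewrite -oppr_le0|rewrite -subr_le0]; apply: arbitrarily_small => e /hl[N /(_ _ (leqnn N))];
  have /andP[a b] := h (s N); move=> /ler_normlP[]; lra.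
Qed.

Lemma bw_complex u (M : R) : (forall n, cabs (u n) <= M) ->
  exists s, (forall n, (s n < s n.+1)%N) /\ exists l, ctends (u \o s) l.
Proof.
move=> hM.
have [n|s [hs [a ha]]] := @bw_real (fun n => complex.Re (u n)) M.
  exact: le_trans (ler_Re_cabs _) (hM _).
have [n|s' [hs' [b hb]]] := @bw_real (fun n => complex.Im (u (s n))) M.
  exact: le_trans (ler_Im_cabs _) (hM _).
exists (s \o s'); split; first by move=> n /=; apply: subseq_lt.
exists (Complex a b) => e e0; have e2 : 0 < e / 2 by lra.
have [N hN] := ha _ e2; have [N' hN'] := hb _ e2.
exists (maxn N N') => n; rewrite geq_max => /andP[n1 n2].
have h1 := hN (s' n) (leq_trans n1 (subseq_ge hs' n)); have h2 := hN' n n2.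
rewrite (le_trans (ler_cabs_ReIm _))//= !raddfB/=.
by move: h1 h2; case: (u _) => x y /=; lra.
Qed.

(** A tail is bounded, so a subsequence of it converges, and the Cauchy condition transfers the
    limit to the whole sequence. *)
Lemma ccauchy_cvg u : (forall e : R, 0 < e -> exists N : nat, forall m n,
    (N <= m)%N -> (N <= n)%N -> cabs (u m - u n) <= e) -> exists l, ctends u l.
Proof.
move=> h; have [N hN] := h _ ltr01.
have [n|s [hs [l hl]]] := @bw_complex (fun n => u (N + n)%N) (cabs (u N) + 1).
  have := hN (N + n)%N N (leq_addr _ _) (leqnn _).
  by have := cabs_subr (u (N + n)%N) (u N); lra.
exists l => e e0; have e2 : 0 < e / 2 by lra.
have [N1 h1] := hl _ e2; have [N2 h2] := h _ e2; exists N2 => n n2.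
have m1 := h1 (maxn N1 N2) (leq_maxl _ _).
have m2 := h2 n (N + s (maxn N1 N2))%N n2.
have : (N2 <= N + s (maxn N1 N2))%N.
  by apply: leq_trans (leq_addl _ _); apply: leq_trans (leq_maxr N1 N2) (subseq_ge hs _).
move=> /m2{}m2; move: m1 m2; rewrite /=; move: (u (N + _)%N) => x h3 h4.
have -> : u n - l = (u n - x) + (x - l) by ring.
by rewrite (le_trans (cabsD _ _))//; lra.
Qed.

(** Heine-Cantor for a sequentially compact [K]: pairs at distance 1/(n + 1) with images more than e
    apart would accumulate at one point of [K], against continuity there. *)
Lemma ctends_unif (K : set C) (f : C -> C) :
  (forall u, (forall n, K (u n)) -> exists s, (forall n, (s n < s n.+1)%N) /\
     exists l, K l /\ ctends (u \o s) l) ->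
  (forall z, K z -> ccont f z) ->
  forall e : R, 0 < e -> exists2 d : R, 0 < d & forall z w, K z -> K w ->
     cabs (z - w) <= d -> cabs (f z - f w) <= e.
Proof.
move=> cK cf e e0; apply: contrapT => h.
have H n : exists zw : C * C, [/\ K zw.1, K zw.2, cabs (zw.1 - zw.2) <= n.+1%:R^-1 &
    e < cabs (f zw.1 - f zw.2)].
  apply: contrapT => hn; apply: h; exists n.+1%:R^-1; first by rewrite invr_gt0.
  move=> z w Kz Kw zw; rewrite leNgt; apply/negP => ee; apply: hn.
  by exists (z, w).
have [zw hzw] := choice H.
have [n|s [hs [l [Kl hl]]]] := cK (fun n => (zw n).1); first by case: (hzw n).
have e2 : 0 < e / 2 by lra.
have [d d0 hd] := cf l Kl _ e2.
(* With x within d / 3 of l and y within d / 3 of x, both lie strictly inside the ball of radius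
   d. *)
have d2 : 0 < d / 3 by lra.
have [N hN] := hl _ d2.
have [m hm] : exists m : nat, (d / 3)^-1 < m%:R by exists (Num.bound (d / 3)^-1); apply: archi_boundP; rewrite invr_ge0 ltW.
have := hN (maxn N m) (leq_maxl _ _) => /=.
case: (hzw (s (maxn N m))); set x := (zw _).1; set y := (zw _).2 => _ _ xy fxy hx.
have sm : (d / 3)^-1 < (s (maxn N m)).+1%:R.
  apply: lt_le_trans hm _; rewrite ler_nat; apply: leqW.
  exact: leq_trans (leq_maxr N m) (subseq_ge hs _).
have {}xy : cabs (x - y) <= d / 3.
  by apply: le_trans xy _; rewrite invf_ple ?posrE ?invr_gt0// ltW.
have h1 := hd x; have h2 := hd y.
have : cabs (x - l) < d by lra.
move=> /h1{}h1.
have : cabs (y - l) < d.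
  have -> : y - l = (x - l) - (x - y) by ring.
  by apply: le_lt_trans (cabsB _ _) _; lra.
move=> /h2{}h2; move: fxy.
have -> : f x - f y = (f x - f l) - (f y - f l) by ring.
by have := cabsB (f x - f l) (f y - f l); lra.
Qed.

End Sequences.

(** * Integrals over the unit interval *)

Section DyadicIntegral.
Variable R : realType.
Local Notation C := (R[i]).
Implicit Types (q p : R -> C) (t s : R).

Definition rcont q t := forall e : R, 0 < e -> exists2 d : R, 0 < d &
  forall s, `|s - t| < d -> cabs (q s - q t) <= e.

Definition cont01 q := forall t, 0 <= t <= 1 -> rcont q t.

Definition rdiff q t (l : C) := forall e : R, 0 < e -> exists2 d : R, 0 < d &
  forall s, `|s - t| < d -> cabs (q s - q t - l * (s - t)%:C%C) <= e * `|s - t|.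

Lemma cont01_unif q : cont01 q -> forall e : R, 0 < e -> exists2 d : R, 0 < d &
  forall s t, 0 <= s <= 1 -> 0 <= t <= 1 -> `|s - t| <= d -> cabs (q s - q t) <= e.
Proof.
move=> cq e e0.
(* The interval is embedded in the real axis of [C], so that [ctends_unif] applies. *)
pose K : set C := [set z | (0 <= complex.Re z <= 1) /\ complex.Im z = 0].
have [||d d0 hd] := @ctends_unif R K (fun z => q (complex.Re z)) _ _ e e0.
- move=> u Ku; have [n|s [hs [l l1 hl]]] := @bw_unit_interval R (fun n => complex.Re (u n)).
    by have [] := Ku n.
  exists s; split => //; exists (Complex l 0); split => // e1 /hl[N hN]; exists N => n /hN h1.
  apply: le_trans (ler_cabs_ReIm _) _; rewrite /= !raddfB /=.
  by have [_ ->] := Ku (s n); rewrite subr0 normr0 addr0.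
- move=> z [z1 _] e1 e10; have [d d0 hd] := cq _ z1 _ e10.
  exists d => // w wz; apply: hd; apply: le_lt_trans wz.
  by rewrite -raddfB ler_Re_cabs.
exists d => // s t s1 t1 st.
by apply: (hd (Complex s 0) (Complex t 0)) => //; rewrite !complexr0 -rmorphB cabsC.
Qed.

(** The left Riemann sum over 2^m equal pieces. Defined by halving the interval, it yields its
    properties by induction on [m], with no sum over indices. *)
Fixpoint dyad q (m : nat) : C :=
  if m is m'.+1 then
    (dyad (fun t => q (t / 2)) m' + dyad (fun t => q ((1 + t) / 2)) m') / 2
  else q 0.

(* The junk value is 0 when the dyadic sums diverge. *)
Definition integ q : C := xget 0 [set l | ctends (dyad q) l].

Lemma dyad_ext q p m : (forall t, 0 <= t <= 1 -> q t = p t) -> dyad q m = dyad p m.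
Proof.
elim: m q p => [|m ih] q p h /=; first by rewrite h// lexx ler01.
by congr ((_ + _) / _); apply: ih => t t01; apply: h; lra.
Qed.

Lemma dyadD q p m : dyad (fun t => q t + p t) m = dyad q m + dyad p m.
Proof. by elim: m q p => [//|m ih] q p /=; rewrite !ih; field. Qed.

Lemma dyadZ (a : C) q m : dyad (fun t => a * q t) m = a * dyad q m.
Proof. by elim: m q => [//|m ih] q /=; rewrite !ih; field. Qed.

Lemma dyad_cst (a : C) m : dyad (fun=> a) m = a.
Proof. by elim: m => [//|m /= ->]; field. Qed.

Lemma half_avg_le (a b : C) (e : R) : cabs a <= e -> cabs b <= e -> cabs ((a + b) / 2) <= e.
Proof.
move=> ha hb; rewrite cabsM cabsV (cabs_nat R 2) ler_pdivrMr//.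
by apply: le_trans (cabsD _ _) _; lra.
Qed.

Lemma dyad_bound q m (M : R) : (forall t, 0 <= t <= 1 -> cabs (q t) <= M) ->
  cabs (dyad q m) <= M.
Proof.
elim: m q => [|m ih] q h /=; first by apply: h; rewrite lexx ler01.
by apply: half_avg_le; apply: ih => t t01; apply: h; lra.
Qed.

(** On each piece of length 2^-m the finer sum averages values of q that lie within e of the single
    value used by the coarser sum. *)
Lemma dyad_diff q m j (e : R) :
  (forall s t, 0 <= s <= 1 -> 0 <= t <= 1 -> `|s - t| <= 2^-1 ^+ m ->
     cabs (q s - q t) <= e) ->
  cabs (dyad q (m + j) - dyad q m) <= e.
Proof.
elim: m q => [|m ih] q h.
  rewrite add0n /= -(dyad_cst (q 0) j) -mulN1r -dyadZ -dyadD.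
  apply: dyad_bound => t t01; rewrite mulN1r; apply: h => //.
    by rewrite lexx ler01.
  by rewrite subr0 expr0 ger0_norm; lra.
rewrite addSn /=.
set a := dyad _ (m + j); set b := dyad _ (m + j); set a' := dyad _ m; set b' := dyad _ m.
have -> : (a + b) / 2 - (a' + b') / 2 = ((a - a') + (b - b')) / 2 by field.
apply: half_avg_le; apply: ih => s t s01 t01 st; apply: h; try lra.
  have -> : s / 2 - t / 2 = 2^-1 * (s - t) by field.
  by rewrite normrM exprS gtr0_norm// ler_pM2l.
have -> : (1 + s) / 2 - (1 + t) / 2 = 2^-1 * (s - t) by field.
by rewrite normrM exprS gtr0_norm// ler_pM2l.
Qed.

Lemma expn_small (x e : R) : 0 <= x < 1 -> 0 < e -> exists N : nat, x ^+ N <= e.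
Proof.
move=> /andP[x0 x1] e0; have : `|x| < 1 by rewrite ger0_norm.
move=> /cvg_expr /cvgrPdist_le /(_ e e0)[N _ /(_ N (leqnn N))] /=.
rewrite sub0r normrN ger0_norm ?exprn_ge0// => h; by exists N.
Qed.

Lemma halfX_small (d : R) : 0 < d -> exists m : nat, 2^-1 ^+ m <= d.
Proof. by move=> d0; apply: expn_small => //; lra. Qed.

Lemma dyad_unif q (d e : R) : 0 < d ->
  (forall s t, 0 <= s <= 1 -> 0 <= t <= 1 -> `|s - t| <= d -> cabs (q s - q t) <= e) ->
  forall m, 2^-1 ^+ m <= d -> forall n, (m <= n)%N -> cabs (dyad q n - dyad q m) <= e.
Proof.
move=> d0 h m hm n mn; rewrite -(subnKC mn); apply: dyad_diff => s t s1 t1 st.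
by apply: h => //; exact: le_trans st hm.
Qed.

Lemma integ_cvg q : cont01 q -> ctends (dyad q) (integ q).
Proof.
move=> cq; have [l hl] : exists l, ctends (dyad q) l.
  apply: ccauchy_cvg => e e0; have e2 : 0 < e / 2 by lra.
  have [d d0 hd] := cont01_unif cq e2; have [m hm] := halfX_small d0.
  exists m => n k mn mk.
  have := dyad_unif d0 hd hm mn; have := dyad_unif d0 hd hm mk.
  move: (dyad q m) => x h1 h2.
  have -> : dyad q n - dyad q k = (dyad q n - x) - (dyad q k - x) by ring.
  by apply: le_trans (cabsB _ _) _; lra.
exact: (xgetPex 0 (ex_intro _ l hl)).
Qed.

Lemma integ_eq q l : ctends (dyad q) l -> integ q = l.
Proof.
move=> h; exact: ctends_uniq (xgetPex 0 (ex_intro _ l h)) h.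
Qed.

Lemma integ_ext q p : (forall t, 0 <= t <= 1 -> q t = p t) -> integ q = integ p.
Proof.
move=> h; rewrite /integ; congr (xget _ _); apply/seteqP; split => l /= hl e /hl[N hN];
  exists N => n /hN; by rewrite (dyad_ext _ h).
Qed.

Lemma integ_cst (a : C) : integ (fun=> a) = a.
Proof.
apply: integ_eq => e e0; exists 0%N => n _.
by rewrite dyad_cst subrr cabs0 ltW.
Qed.

Lemma integD q p : cont01 q -> cont01 p -> integ (fun t => q t + p t) = integ q + integ p.
Proof.
move=> /integ_cvg cq /integ_cvg cp; apply: integ_eq => e e0.
have e2 : 0 < e / 2 by lra.
have [N hN] := cq _ e2; have [N' hN'] := cp _ e2.
exists (maxn N N') => n; rewrite geq_max => /andP[/hN h1 /hN' h2]; rewrite dyadD.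
have -> : dyad q n + dyad p n - (integ q + integ p) =
  (dyad q n - integ q) + (dyad p n - integ p) by ring.
by apply: le_trans (cabsD _ _) _; lra.
Qed.

Lemma integZ (a : C) q : cont01 q -> integ (fun t => a * q t) = a * integ q.
Proof.
move=> /integ_cvg cq; apply: integ_eq => e e0; have a0 := cabs_ge0 a.
have e2 : 0 < e / (cabs a + 1) by apply: divr_gt0 => //; lra.
have [N hN] := cq _ e2; exists N => n /hN h; rewrite dyadZ -mulrBr cabsM.
move: h; rewrite ler_pdivlMr; last lra.
by apply: le_trans; rewrite mulrC ler_wpM2l ?cabs_ge0//; lra.
Qed.

Lemma integ_bound q (M : R) : cont01 q -> (forall t, 0 <= t <= 1 -> cabs (q t) <= M) ->
  cabs (integ q) <= M.
Proof.
move=> /integ_cvg cq h; apply: ctends_bound cq _ => n; exact: dyad_bound.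
Qed.

Lemma rcont_comp_affine q (a b t : R) : rcont q (a + b * t) -> rcont (fun s => q (a + b * s)) t.
Proof.
move=> h e /h[d d0 hd]; have b0 : 0 < `|b| + 1 by have := normr_ge0 b; lra.
exists (d / (`|b| + 1)); first by rewrite divr_gt0.
move=> s; rewrite ltr_pdivlMr// => st; apply: hd.
have -> : a + b * s - (a + b * t) = b * (s - t) by ring.
rewrite normrM (le_lt_trans _ st)// mulrC ler_wpM2l//; lra.
Qed.

Lemma cont01_left q : cont01 q -> cont01 (fun t => q (t / 2)).
Proof.
move=> h t t1; have : rcont q (0 + 2^-1 * t) by apply: h; lra.
move=> /rcont_comp_affine; rewrite (_ : (fun s => q (0 + 2^-1 * s)) = fun t => q (t / 2))//.
by apply/funext => x; rewrite add0r mulrC.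
Qed.

Lemma cont01_right q : cont01 q -> cont01 (fun t => q ((1 + t) / 2)).
Proof.
move=> h t t1; have : rcont q (2^-1 + 2^-1 * t) by apply: h; lra.
move=> /rcont_comp_affine; rewrite (_ : (fun s => q (_ + 2^-1 * s)) = fun t => q ((1 + t) / 2))//.
by apply/funext => x; congr q; field.
Qed.

(** By construction the dyadic sum at level n + 1 is the mean of the two half-interval sums at level
    n. *)
Lemma integ_halves q : cont01 q ->
  integ q = (integ (fun t => q (t / 2)) + integ (fun t => q ((1 + t) / 2))) / 2.
Proof.
move=> cq; apply: integ_eq => e e0.
have [N hN] := integ_cvg (cont01_left cq) e0.
have [N' hN'] := integ_cvg (cont01_right cq) e0.
exists (maxn N N').+1 => -[//|n]; rewrite ltnS geq_max => /andP[/hN h1 /hN' h2] /=.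
set a := dyad _ _; set b := dyad _ _; set a' := integ _; set b' := integ _.
have -> : (a + b) / 2 - (a' + b') / 2 = ((a - a') + (b - b')) / 2 by field.
exact: half_avg_le.
Qed.

(** Reversal turns a left Riemann sum into a right one; they differ by the end values, weighted by
    the mesh. *)
Lemma dyad_rev q m : dyad (fun t => q (1 - t)) m = dyad q m + 2^-1 ^+ m * (q 1 - q 0).
Proof.
elim: m q => [|m ih] q /=; first by rewrite subr0; ring.
have := ih (fun s => q ((1 + s) / 2)); have := ih (fun s => q (s / 2)) => /=.
rewrite mul0r addr0 (_ : (1 + 1) / 2 = 1 :> R); last by field.
move=> h1 h2; rewrite (@dyad_ext _ (fun t => q ((1 + (1 - t)) / 2))); last first.
  by move=> t _; congr q; field.
rewrite (@dyad_ext (fun t => q (1 - (1 + t) / 2)) (fun t => q ((1 - t) / 2))); last first.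
  by move=> t _; congr q; field.
by rewrite h1 h2 exprS; field.
Qed.

Lemma integ_rev q : cont01 q -> integ (fun t => q (1 - t)) = integ q.
Proof.
move=> cq; apply: integ_eq => e e0; have e2 : 0 < e / 2 by lra.
have [N hN] := integ_cvg cq e2; have A0 := cabs_ge0 (q 1 - q 0).
have [|m hm] := @halfX_small (e / 2 / (cabs (q 1 - q 0) + 1)).
  by apply: divr_gt0 => //; lra.
exists (maxn N m) => n; rewrite geq_max => /andP[/hN h1 mn]; rewrite dyad_rev.
rewrite addrAC; apply: le_trans (cabsD _ _) _; rewrite cabsM cabsX cabsV (cabs_nat R 2).
have : 2^-1 ^+ n <= e / 2 / (cabs (q 1 - q 0) + 1).
  by apply: le_trans hm; rewrite ler_wiXn2l//; lra.
rewrite ler_pdivlMr; last lra.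
have : 0 <= 2^-1 ^+ n :> R by rewrite exprn_ge0.
by move: (2^-1 ^+ n) => x; nra.
Qed.

(* The fundamental theorem of calculus, with the differentiability hypothesis
   at a fixed scale: that form passes to both halves of the interval. *)
Lemma dyad_ftc q p m (e : R) :
  (forall s t, 0 <= s <= 1 -> 0 <= t <= 1 -> `|t - s| <= 2^-1 ^+ m ->
     cabs (q t - q s - p s * (t - s)%:C%C) <= e * `|t - s|) ->
  cabs (q 1 - q 0 - dyad p m) <= e.
Proof.
elim: m q p e => [|m ih] q p e h.
  have := h 0 1; rewrite subr0 mulr1 normr1 mulr1 expr0; apply => //; lra.
have H2 : forall (x : C), (x / 2) = 2^-1 * x by move=> x; rewrite mulrC.
have [] : cabs (q (1 / 2) - q (0 / 2) - dyad (fun t => 2^-1 * p (t / 2)) m) <= e / 2 /\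
  cabs (q ((1 + 1) / 2) - q ((1 + 0) / 2) - dyad (fun t => 2^-1 * p ((1 + t) / 2)) m) <= e / 2.
  split.
  - apply: (ih (fun t => q (t / 2))) => s t s1 t1 st.
    have E : t / 2 - s / 2 = 2^-1 * (t - s) by field.
    have E1 : `|t / 2 - s / 2| = 2^-1 * `|t - s| by rewrite E normrM gtr0_norm.
    have -> : 2^-1 * p (s / 2) * (t - s)%:C%C = p (s / 2) * (t / 2 - s / 2)%:C%C.
      by rewrite E rmorphM /= fmorphV /= (rmorph_nat (real_complex R) 2); ring.
    have -> : e / 2 * `|t - s| = e * `|t / 2 - s / 2| by rewrite E1; ring.
    by apply: h; rewrite ?E1 ?exprS ?ler_pM2l//; lra.
  - apply: (ih (fun t => q ((1 + t) / 2))) => s t s1 t1 st.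
    have E : (1 + t) / 2 - (1 + s) / 2 = 2^-1 * (t - s) by field.
    have E1 : `|(1 + t) / 2 - (1 + s) / 2| = 2^-1 * `|t - s| by rewrite E normrM gtr0_norm.
    have -> : 2^-1 * p ((1 + s) / 2) * (t - s)%:C%C = p ((1 + s) / 2) * ((1 + t) / 2 - (1 + s) / 2)%:C%C.
      by rewrite E rmorphM /= fmorphV /= (rmorph_nat (real_complex R) 2); ring.
    have -> : e / 2 * `|t - s| = e * `|(1 + t) / 2 - (1 + s) / 2| by rewrite E1; ring.
    by apply: h; rewrite ?E1 ?exprS ?ler_pM2l//; lra.
rewrite !dyadZ /= mul0r addr0 (_ : (1 + 1) / 2 = 1 :> R); last by field.
set a := dyad _ _; set b := dyad _ _ => h1 h2.
have -> : q 1 - q 0 - (a + b) / 2 = (q (1 / 2) - q 0 - 2^-1 * a) + (q 1 - q (1 / 2) - 2^-1 * b).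
  by field.
by apply: le_trans (cabsD _ _) _; lra.
Qed.

End DyadicIntegral.

(** * Paths of a real parameter and the mean value inequality *)

Section RealParameter.
Variable R : realType.
Local Notation C := (R[i]).
Implicit Types (q p : R -> C) (t s : R) (l m : C) (f : C -> C).

Lemma is_derive_mull (c t : R) : is_derive (t : R^o) 1 ((fun s => c * s) : R^o -> R^o) c.
Proof.
apply/is_derive_littleo => e e0; exists 1 => // y _.
by rewrite -mulrBr subrr normr0 mulr_ge0// ltW.
Qed.

Lemma rdiff_eq q t l m : rdiff q t l -> l = m -> rdiff q t m.
Proof. by move=> h <-. Qed.

Lemma rdiff_Complex (a b : R -> R) (a' b' : R) t :
  is_derive (t : R^o) 1 (a : R^o -> R^o) a' -> is_derive (t : R^o) 1 (b : R^o -> R^o) b' ->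
  rdiff (fun s => Complex (a s) (b s)) t (Complex a' b').
Proof.
move=> /is_derive_littleo ha /is_derive_littleo hb e e0.
have e2 : 0 < e / 2 by lra.
have [d d0 hd] := ha _ e2; have [d' d0' hd'] := hb _ e2.
exists (Num.min d d'); first by rewrite lt_min d0.
move=> s; rewrite lt_min => /andP[/hd h1 /hd' h2].
apply: le_trans (ler_cabs_ReIm _) _ => /=; rewrite !mulr0 subr0 add0r.
by rewrite (_ : e * _ = e / 2 * `|s - t| + e / 2 * `|s - t|) ?lerD//; field.
Qed.

Lemma rdiff_Re (c : C) q t l : cabs c <= 1 -> rdiff q t l ->
  is_derive (t : R^o) 1 ((fun s => complex.Re (c * q s)) : R^o -> R^o) (complex.Re (c * l)).
Proof.
move=> c1 h; apply/is_derive_littleo => e /h[d d0 hd]; exists d => // s /hd hs.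
have -> : complex.Re (c * q s) - complex.Re (c * q t) - complex.Re (c * l) * (s - t) =
    complex.Re (c * (q s - q t - l * (s - t)%:C%C)).
  case: c {c1} => c1 c2; case: (q s) => x1 x2; case: (q t) => y1 y2; case: l {h hd hs} => l1 l2 /=.
  by ring.
apply: le_trans (ler_Re_cabs _) _; rewrite cabsM; apply: le_trans hs.
by rewrite ler_piMl// cabs_ge0.
Qed.

(** A mean value theorem fails for complex values. A rotation by a unimodular constant makes the
    increment of q real and reduces the claim to one real function. *)
Lemma mvt_cmp q q' (p p' : R -> R) (a b : R) : a <= b ->
  (forall t, a <= t <= b -> rdiff q t (q' t)) ->
  (forall t, a <= t <= b -> is_derive (t : R^o) 1 (p : R^o -> R^o) (p' t)) ->
  (forall t, a <= t <= b -> cabs (q' t) <= p' t) ->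
  cabs (q b - q a) <= p b - p a.
Proof.
rewrite le_eqVlt => /orP[/eqP->|ab] hq hp hqp; first by rewrite !subrr cabs0.
have [c c1 hc] : exists2 c : C, cabs c <= 1 & complex.Re (c * (q b - q a)) = cabs (q b - q a).
  have [->|nz] := eqVneq (q b - q a) 0; first by exists 0; rewrite ?cabs0 ?mulr0.
  set z := q b - q a in nz *; have z0 : 0 < cabs z by rewrite cabs_gt0.
  exists ((cabs z)^-1%:C%C * (z^*)%C).
    rewrite cabsM cabsC cabs_conj ger0_norm ?invr_ge0 ?cabs_ge0// mulVf; first exact: lexx.
    exact: lt0r_neq0.
  rewrite -mulrA mul_conj -rmorphM /=; field; exact: lt0r_neq0.
(* Its derivative is nonpositive, since Re (c q') <= |q'| <= p'. *)
pose h t := complex.Re (c * q t) - p t.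
have dh t : a <= t <= b -> is_derive (t : R^o) 1 (h : R^o -> R^o) (complex.Re (c * q' t) - p' t).
  move=> t1; have := rdiff_Re c1 (hq _ t1); have := hp _ t1 => d1 d2.
  exact: (@is_deriveB _ _ _ (fun s => complex.Re (c * q s) : R^o) p t 1 _ _ d2 d1).
have [x||x] := @MVT R h (fun t => complex.Re (c * q' t) - p' t) a b ab.
- by rewrite in_itv /= => /andP[x1 x2]; apply: dh; rewrite !ltW.
- apply: (@derivable_within_continuous R R^o h `[a, b]) => x.
  by rewrite in_itv /= => /dh h1; apply: ex_derive.
rewrite in_itv /= => /andP[x1 x2] E.
have xx : a <= x <= b by rewrite !ltW.
have : h b - h a <= 0.
  rewrite E pmulr_lle0 ?subr_gt0// subr_le0; apply: le_trans (hqp _ xx).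
  apply: le_trans (ler_norm _) _; apply: le_trans (ler_Re_cabs _) _.
  by rewrite cabsM ler_piMl// cabs_ge0.
rewrite /h -hc mulrBr raddfB /=; lra.
Qed.

Lemma rdiff_rcont q t l : rdiff q t l -> rcont q t.
Proof.
move=> h e e0; have [d d0 hd] := h 1 ltr01; have l0 := cabs_ge0 l.
exists (Num.min d (e / (cabs l + 1))).
  by rewrite lt_min d0 divr_gt0//; lra.
move=> s; rewrite lt_min => /andP[/hd h1]; rewrite ltr_pdivlMr; last lra.
move=> h2; have -> : q s - q t = (q s - q t - l * (s - t)%:C%C) + l * (s - t)%:C%C by ring.
by apply: le_trans (cabsD _ _) _; rewrite cabsM cabsC; lra.
Qed.

Lemma rdiffD q p t l m : rdiff q t l -> rdiff p t m -> rdiff (fun s => q s + p s) t (l + m).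
Proof.
move=> hq hp e e0; have e2 : 0 < e / 2 by lra.
have [d d0 hd] := hq _ e2; have [d' d0' hd'] := hp _ e2.
exists (Num.min d d'); first by rewrite lt_min d0.
move=> s; rewrite lt_min => /andP[/hd h1 /hd' h2].
have -> : q s + p s - (q t + p t) - (l + m) * (s - t)%:C%C =
  (q s - q t - l * (s - t)%:C%C) + (p s - p t - m * (s - t)%:C%C) by ring.
by apply: le_trans (cabsD _ _) _; lra.
Qed.

Lemma rdiff_affine l m t : rdiff (fun s => l + s%:C%C * m) t m.
Proof.
move=> e e0; exists 1 => // s _.
rewrite (_ : _ - _ - _ = 0) ?cabs0 ?mulr_ge0// ?ltW// rmorphB /=; ring.
Qed.

Lemma rdiff_comp f q t l m : rdiff q t m -> cdiff f (q t) l ->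
  rdiff (fun s => f (q s)) t (l * m).
Proof.
move=> hq; apply: (littleo_comp (dist := fun s => `|s - t|) (del := fun s => (s - t)%:C%C)) => // s.
exact: cabsC.
Qed.

Lemma rcont_comp f q t : rcont q t -> ccont f (q t) -> rcont (fun s => f (q s)) t.
Proof.
move=> hq hf e /hf[d d0 hd]; have d2 : 0 < d / 2 by lra.
have [d' d0' hd'] := hq _ d2; exists d' => // s /hd' h; apply: hd; lra.
Qed.

Lemma rcontZ (a : C) q t : rcont q t -> rcont (fun s => a * q s) t.
Proof.
move=> hq; apply: (rcont_comp (f := fun w => a * w) hq).
exact: ccont_cdiff (cdiffZ a (cdiff_id _)).
Qed.

Lemma integ_ftc q p : (forall t, 0 <= t <= 1 -> rdiff q t (p t)) -> cont01 p ->
  integ p = q 1 - q 0.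
Proof.
move=> hq cp; apply: integ_eq => e e0.
have [d d0 hd] := cont01_unif cp e0; have [m hm] := halfX_small d0.
exists m => n mn; rewrite cabs_dist; apply: dyad_ftc => s t s1 t1 st.
have {}st : `|t - s| <= d.
  by apply: le_trans st _; apply: le_trans hm; rewrite ler_wiXn2l//; lra.
(* This is q x - p s (x - s), in the shape of [rdiff_affine]; its derivative p x - p s is at most e
   in modulus between s and t. *)
pose g x := q x + (p s * s%:C%C + x%:C%C * - p s).
have -> : q t - q s - p s * (t - s)%:C%C = g t - g s by rewrite /g rmorphB /=; ring.
have dg x : 0 <= x <= 1 -> rdiff g x (p x - p s).
  by move=> x1; apply: rdiffD (hq _ x1) _; exact: rdiff_affine.
have de := is_derive_mull e.
have [le_st|lt_ts] := leP s t.
  rewrite ger0_norm ?subr_ge0// mulrBr; apply: (@mvt_cmp g (fun x => p x - p s) _ (fun=> e)) => // x x1.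
  - by apply: dg; lra.
  - apply: hd; first lra; first lra.
    by move: st; rewrite !ger0_norm; lra.
have le_ts := ltW lt_ts.
rewrite cabs_dist distrC ger0_norm ?subr_ge0// mulrBr.
apply: (@mvt_cmp g (fun x => p x - p s) _ (fun=> e)) => // x x1.
- by apply: dg; lra.
- apply: hd; first lra; first lra.
  by move: st => /ler_normlP[st1 st2]; rewrite ler0_norm; lra.
Qed.

(** This is exp (2 pi i t): one turn fills the unit interval on which [integ] is defined, and [tau]
    below is 2 pi i. *)
Definition expi (t : R) : C := Complex (cos (pi *+ 2 * t)) (sin (pi *+ 2 * t)).

Definition tau : C := Complex 0 (pi *+ 2).

Lemma tau_neq0 : tau != 0.
Proof.
apply/eqP => -[] /eqP; rewrite mulrn_eq0 /=; have := @pi_gt0 R.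
by move=> /gt_eqF ->.
Qed.

Lemma cabs_expi t : cabs (expi t) = 1.
Proof. by rewrite /cabs normc_def /= cos2Dsin2 sqrtr1. Qed.

Lemma expi0 : expi 0 = 1.
Proof. by rewrite /expi mulr0 cos0 sin0. Qed.

Lemma expi1 : expi 1 = 1.
Proof. by rewrite /expi mulr1 cos2pi sin2pi. Qed.

Lemma rdiff_expi t : rdiff expi t (tau * expi t).
Proof.
have dl := is_derive_mull (pi *+ 2) t.
have dc : is_derive (t : R^o) 1 ((fun s => cos (pi *+ 2 * s)) : R^o -> R^o) (- sin (pi *+ 2 * t) * (pi *+ 2)).
  apply: (@is_derive1_comp R cos (fun s => pi *+ 2 * s) t).
have ds : is_derive (t : R^o) 1 ((fun s => sin (pi *+ 2 * s)) : R^o -> R^o) (cos (pi *+ 2 * t) * (pi *+ 2)).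
  apply: (@is_derive1_comp R sin (fun s => pi *+ 2 * s) t).
apply: rdiff_eq (rdiff_Complex dc ds) _; rewrite /tau /expi.
by apply/eqP; rewrite eq_complex /=; apply/andP; split; apply/eqP; ring.
Qed.

Lemma rcont_expi t : rcont expi t.
Proof. exact: rdiff_rcont (rdiff_expi t). Qed.

End RealParameter.

(** * Goursat's theorem and the Cauchy formula *)

Section Goursat.
Variable R : realType.
Local Notation C := (R[i]).
Implicit Types (f g F : C -> C) (a b c z w : C) (t : R).

Definition ccont_disk f := forall z, disk z -> ccont f z.

Lemma holo_cdiff f z : holo f -> disk z -> cdiff f z (cder f z).
Proof. by move=> h zD; apply: derivable_cdiff; exact: h. Qed.

Lemma holo_ccont f : holo f -> ccont_disk f.
Proof. by move=> h z zD; exact: ccont_cdiff (holo_cdiff h zD). Qed.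

Lemma seg_le a b t (r : R) : cabs a <= r -> cabs b <= r -> 0 <= t <= 1 ->
  cabs (a + t%:C%C * (b - a)) <= r.
Proof.
move=> ar br /andP[t0 t1].
have -> : a + t%:C%C * (b - a) = (1 - t)%:C%C * a + t%:C%C * b.
  by rewrite rmorphB /= rmorph1; ring.
apply: le_trans (cabsD _ _) _; rewrite !cabsM !cabsC !ger0_norm//; last lra.
by nra.
Qed.

Lemma seg_disk a b t : disk a -> disk b -> 0 <= t <= 1 ->
  disk (a + t%:C%C * (b - a)).
Proof.
rewrite /disk /= => aD bD t1.
apply: le_lt_trans (@seg_le a b t (Num.max (cabs a) (cabs b)) _ _ t1) _.
- by rewrite le_max lexx.
- by rewrite le_max lexx orbT.
- by rewrite gt_max aD.
Qed.

Lemma rcont_affine a b t : rcont (fun s => a + s%:C%C * b) t.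
Proof. exact: rdiff_rcont (@rdiff_affine _ _ _ _). Qed.

Lemma cont01_seg f a b : ccont_disk f -> disk a -> disk b ->
  cont01 (fun t => f (a + t%:C%C * (b - a))).
Proof.
move=> hf aD bD t t1; apply: (rcont_comp (q := fun s => a + s%:C%C * (b - a))).
  exact: rcont_affine.
by apply: hf; exact: seg_disk.
Qed.

Definition Iseg f a b := (b - a) * integ (fun t => f (a + t%:C%C * (b - a))).

Lemma mid_disk a b : disk a -> disk b -> disk ((a + b) / 2).
Proof.
move=> aD bD; have := @seg_disk a b 2^-1 aD bD; rewrite fmorphV /= rmorph_nat.
have -> : a + 2^-1 * (b - a) = (a + b) / 2 by field.
by apply; lra.
Qed.

Lemma Iseg_half f a b : ccont_disk f -> disk a -> disk b ->
  Iseg f a b = Iseg f a ((a + b) / 2) + Iseg f ((a + b) / 2) b.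
Proof.
move=> hf aD bD; rewrite /Iseg (integ_halves (cont01_seg hf aD bD)).
rewrite (@integ_ext _ (fun t => f (a + t%:C%C * ((a + b) / 2 - a)))
  (fun t => f (a + (t / 2)%:C%C * (b - a)))); last first.
  by move=> t _; congr f; rewrite rmorphM /= fmorphV /= rmorph_nat; field.
rewrite (@integ_ext _ (fun t => f ((a + b) / 2 + t%:C%C * (b - (a + b) / 2)))
  (fun t => f (a + ((1 + t) / 2)%:C%C * (b - a)))); last first.
  by move=> t _; congr f; rewrite rmorphM rmorphD /= rmorph1 fmorphV /= rmorph_nat; field.
by field.
Qed.

Lemma Iseg_rev f a b : ccont_disk f -> disk a -> disk b ->
  Iseg f b a = - Iseg f a b.
Proof.
move=> hf aD bD; rewrite /Iseg -(integ_rev (cont01_seg hf aD bD)).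
rewrite (@integ_ext _ (fun t => f (b + t%:C%C * (a - b)))
  (fun t => f (a + (1 - t)%:C%C * (b - a)))); first by ring.
by move=> t _; congr f; rewrite rmorphB /= rmorph1; ring.
Qed.

Lemma Iseg_bound f a b (M : R) : ccont_disk f -> disk a -> disk b ->
  (forall t, 0 <= t <= 1 -> cabs (f (a + t%:C%C * (b - a))) <= M) ->
  cabs (Iseg f a b) <= cabs (b - a) * M.
Proof.
move=> hf aD bD h; rewrite cabsM ler_wpM2l ?cabs_ge0//.
exact: integ_bound (cont01_seg hf aD bD) h.
Qed.

Lemma Iseg_ftc f F a b : (forall z, disk z -> cdiff F z (f z)) -> ccont_disk f ->
  disk a -> disk b -> Iseg f a b = F b - F a.
Proof.
move=> hF hf aD bD; have cf := cont01_seg hf aD bD.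
rewrite /Iseg -integZ//.
rewrite (@integ_ftc _ (fun t => F (a + t%:C%C * (b - a)))).
- by rewrite mul1r rmorph0 mul0r addr0; congr (F _ - _); ring.
- move=> t t1; rewrite mulrC; apply: (rdiff_comp (q := fun s => a + s%:C%C * (b - a))).
    exact: rdiff_affine.
  by apply: hF; exact: seg_disk.
- by move=> t t1; apply: rcontZ; exact: cf.
Qed.

Lemma ccontD f g z : ccont f z -> ccont g z -> ccont (fun w => f w + g w) z.
Proof.
move=> hf hg e e0; have e2 : 0 < e / 2 by lra.
have [d d0 hd] := hf _ e2; have [d' d0' hd'] := hg _ e2.
exists (Num.min d d'); first by rewrite lt_min d0.
move=> s; rewrite lt_min => /andP[/hd h1 /hd' h2].
have -> : f s + g s - (f z + g z) = (f s - f z) + (g s - g z) by ring.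
by apply: le_trans (cabsD _ _) _; lra.
Qed.

Lemma IsegD f g a b : ccont_disk f -> ccont_disk g -> disk a -> disk b ->
  Iseg (fun w => f w + g w) a b = Iseg f a b + Iseg g a b.
Proof.
move=> hf hg aD bD; rewrite /Iseg integD ?mulrDr//; exact: cont01_seg.
Qed.

Definition tri f a b c := Iseg f a b + Iseg f b c + Iseg f c a.

(** The inner sides occur twice with opposite orientations and cancel. *)
Lemma tri_split f a b c : ccont_disk f -> disk a -> disk b -> disk c ->
  tri f a b c = tri f a ((a + b) / 2) ((c + a) / 2) + tri f ((a + b) / 2) b ((b + c) / 2)
    + tri f ((c + a) / 2) ((b + c) / 2) c
    + tri f ((a + b) / 2) ((b + c) / 2) ((c + a) / 2).
Proof.
move=> hf aD bD cD; rewrite /tri (Iseg_half hf aD bD) (Iseg_half hf bD cD) (Iseg_half hf cD aD).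
have m1 := mid_disk aD bD; have m2 := mid_disk bD cD; have m3 := mid_disk cD aD.
move: m1 m2 m3; set x := (a + b) / 2; set y := (b + c) / 2; set z := (c + a) / 2 => xD yD zD.
rewrite (Iseg_rev hf xD zD) (Iseg_rev hf xD yD) (Iseg_rev hf yD zD); ring.
Qed.

Definition perim (T : C * C * C) : R :=
  cabs (T.1.1 - T.1.2) + cabs (T.1.2 - T.2) + cabs (T.2 - T.1.1).

Definition tri3 f (T : C * C * C) := tri f T.1.1 T.1.2 T.2.

(** A closed ball inside the disk, so that the limit of the nested triangles still lies in the
    disk. *)
Definition in_ball (r : R) (T : C * C * C) :=
  [/\ cabs T.1.1 <= r, cabs T.1.2 <= r & cabs T.2 <= r].

Lemma cabs_half z : cabs (z / 2) = cabs z / 2.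
Proof. by rewrite cabsM cabsV (cabs_nat R 2). Qed.

(** One of the four quarter triangles carries at least a quarter of the integral. The bound on the
    displacement of the first vertex makes these vertices a Cauchy sequence under iteration. *)
Lemma goursat_step f (r : R) (T : C * C * C) : r < 1 -> ccont_disk f -> in_ball r T ->
  exists T' : C * C * C, [/\ in_ball r T', perim T' = perim T / 2,
    cabs (T'.1.1 - T.1.1) <= perim T / 2 & cabs (tri3 f T) / 4 <= cabs (tri3 f T')].
Proof.
case: T => -[a b] c r1 hf [] /= ar br cr.
have D z : cabs z <= r -> disk z by move=> zr; rewrite /disk /= (le_lt_trans zr).
have := tri_split hf (D _ ar) (D _ br) (D _ cr).
rewrite /tri3 /perim /=; set t1 := tri _ a ((a + b) / 2) _; set t2 := tri _ ((a + b) / 2) b _.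
set t3 := tri _ ((c + a) / 2) _ c; set t4 := tri _ ((a + b) / 2) _ _ => E.
have M x y : cabs x <= r -> cabs y <= r -> cabs ((x + y) / 2) <= r.
  by move=> xr yr; rewrite cabs_half; have := cabsD x y; lra.
have P1 := cabs_ge0 (a - b); have P2 := cabs_ge0 (b - c); have P3 := cabs_ge0 (c - a).
have hx (x y k : C) : x - y = k / 2 -> cabs (x - y) = cabs k / 2.
  by move=> ->; rewrite cabs_half.
have [h|h1] := leP (cabs (tri f a b c) / 4) (cabs t1).
  exists (a, (a + b) / 2, (c + a) / 2); split => //=; first by split => //; apply: M.
    rewrite (hx a _ (a - b)); last by field.
    rewrite (hx ((a + b) / 2) _ (b - c)); last by field.
    by rewrite (hx ((c + a) / 2) _ (c - a)); [field|field].
  by rewrite subrr cabs0; lra.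
have [h|h2] := leP (cabs (tri f a b c) / 4) (cabs t2).
  exists ((a + b) / 2, b, (b + c) / 2); split => //=; first by split => //; apply: M.
    rewrite (hx _ b (a - b)); last by field.
    rewrite (hx b _ (b - c)); last by field.
    by rewrite (hx ((b + c) / 2) _ (c - a)); [field|field].
  by rewrite cabs_dist (hx a _ (a - b)); [lra|field].
have [h|h3] := leP (cabs (tri f a b c) / 4) (cabs t3).
  exists ((c + a) / 2, (b + c) / 2, c); split => //=; first by split => //; apply: M.
    rewrite (hx _ ((b + c) / 2) (a - b)); last by field.
    rewrite (hx _ c (b - c)); last by field.
    by rewrite (hx c _ (c - a)); [field|field].
  by rewrite (hx _ a (c - a)); [lra|field].
exists ((a + b) / 2, (b + c) / 2, (c + a) / 2); split => //=; first by split; apply: M.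
- rewrite (hx _ ((b + c) / 2) (a - c)); last by field.
  rewrite (hx _ ((c + a) / 2) (b - a)); last by field.
  rewrite (hx _ ((a + b) / 2) (c - b)); last by field.
  by rewrite (cabs_dist a c) (cabs_dist b a) (cabs_dist c b); field.
- by rewrite cabs_dist (hx a _ (a - b)); [lra|field].
(* The other three integrals are each below a quarter of the total, so the middle triangle must
   carry the rest. *)
have := cabsD (t1 + t2 + t3) t4; have := cabsD (t1 + t2) t3; have := cabsD t1 t2.
by rewrite -E; lra.
Qed.

Lemma tri_zero f a b c : holo f -> disk a -> disk b -> disk c -> tri f a b c = 0.
Proof.
move=> hf aD bD cD; have cf := holo_ccont hf.
pose r := Num.max (Num.max (cabs a) (cabs b)) (cabs c).
have r1 : r < 1 by rewrite !gt_max; apply/andP; split => //; apply/andP; split.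
have D z : cabs z <= r -> disk z by move=> zr; rewrite /disk /= (le_lt_trans zr).
have T0 : in_ball r (a, b, c) by split; rewrite /= !le_max lexx ?orbT.
have H T : exists T', in_ball r T -> [/\ in_ball r T', perim T' = perim T / 2,
    cabs (T'.1.1 - T.1.1) <= perim T / 2 & cabs (tri3 f T) / 4 <= cabs (tri3 f T')].
  have [hT|nT] := pselect (in_ball r T); last by exists T.
  by have [T' hT'] := goursat_step r1 cf hT; exists T'.
have [nxt hn] := choice H.
pose Tn n := iter n nxt (a, b, c); pose D0 := perim (a, b, c).
have D0_ge0 : 0 <= D0 by rewrite !addr_ge0 ?cabs_ge0.
have bn n : in_ball r (Tn n) by elim: n => [//|n ih]; have [] := hn _ ih.
have dn n : perim (Tn n) = D0 * 2^-1 ^+ n.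
  elim: n => [|n ih]; first by rewrite expr0 mulr1.
  by have [_ -> _ _] := hn _ (bn n); rewrite -/(Tn n) ih exprS; field.
have tn n : cabs (tri f a b c) <= 4 ^+ n * cabs (tri3 f (Tn n)).
  elim: n => [|n ih]; first by rewrite expr0 mul1r.
  have [_ _ _] := hn _ (bn n); rewrite -/(Tn n.+1) => h.
  apply: le_trans ih _; rewrite exprSr -mulrA ler_pM2l ?exprn_gt0//; lra.
(* Step j moves the first vertex by at most D0 2^-(j + 1); the last factor is the partial geometric
   sum of these moves. *)
have an n k : cabs ((Tn (n + k)%N).1.1 - (Tn n).1.1) <= D0 * 2^-1 ^+ n * (1 - 2^-1 ^+ k).
  elim: k => [|k ih]; first by rewrite addn0 !subrr cabs0 mulr0.
  have [_ _ h _] := hn _ (bn (n + k)%N); move: h; rewrite dn addnS -/(Tn (n + k).+1) => h.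
  have -> : (Tn (n + k).+1).1.1 - (Tn n).1.1 = ((Tn (n + k).+1).1.1 - (Tn (n + k)%N).1.1) +
    ((Tn (n + k)%N).1.1 - (Tn n).1.1) by ring.
  apply: le_trans (cabsD _ _) _; apply: le_trans (lerD h ih) _; apply: eq_ler.
  by rewrite exprD exprS; field.
have an' n m : (n <= m)%N -> cabs ((Tn m).1.1 - (Tn n).1.1) <= D0 * 2^-1 ^+ n.
  move=> nm; rewrite -(subnKC nm); apply: le_trans (an _ _) _.
  have : 0 <= D0 * 2^-1 ^+ n by rewrite mulr_ge0 ?exprn_ge0.
  have : 0 <= 2^-1 ^+ (m - n) :> R by rewrite exprn_ge0.
  by nra.
have small (e : R) : 0 < e -> exists N, D0 * 2^-1 ^+ N <= e.
  move=> e0; have [|m hm] := @halfX_small R (e / (D0 + 1)); first by apply: divr_gt0 => //; lra.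
  exists m; move: hm; rewrite ler_pdivlMr; last lra.
  have : 0 <= 2^-1 ^+ m :> R by rewrite exprn_ge0.
  by lra.
have [|p hp] := @ccauchy_cvg R (fun n => (Tn n).1.1).
  move=> e e0; have [|N hN] := small (e / 2); first lra.
  exists N => m n Nm Nn; have := an' _ _ Nm; have := an' _ _ Nn.
  set x := (Tn m).1.1; set y := (Tn n).1.1; set z := (Tn N).1.1 => h1 h2.
  have -> : x - y = (x - z) - (y - z) by ring.
  by apply: le_trans (cabsB _ _) _; lra.
have pn n : cabs ((Tn n).1.1 - p) <= D0 * 2^-1 ^+ n.
  rewrite -subr_le0; apply: arbitrarily_small => e /hp[N /(_ _ (leq_maxl N n)) /=].
  have := an' n (maxn N n) (leq_maxr _ _).
  set x := (Tn (maxn _ _)).1.1; set y := (Tn n).1.1 => h1 h2.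
  have -> : y - p = (x - p) - (x - y) by ring.
  by have := cabsB (x - p) (x - y); lra.
have pD : disk p by apply/D/(ctends_bound hp) => n; have [] := bn n.
have fp := holo_cdiff hf pD.
apply/cabs0_eq0/le_anti; rewrite cabs_ge0 andbT; apply: arbitrarily_small => e e0.
(* The final bound is 2 D0^2 e': the factor 4^n is cancelled by two factors 2^-n, one from the
   perimeter and one from the distance to p. *)
pose e' : R := e / (2 * (D0 ^+ 2 + 1)).
have D2 : 0 <= D0 ^+ 2 by rewrite exprn_ge0.
have e'0 : 0 < e' by apply: divr_gt0 => //; lra.
have [d d0 hd] := fp _ e'0.
have [|n hN] := small (d / 3); first lra.
apply: le_trans (tn n) _.
have [b1 b2 b3] := bn n; have perimn := dn n; have := pn n.
rewrite /tri3; move: perimn b1 b2 b3; rewrite /perim.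
move: (Tn n) => -[[x y] z] /=; have [del delE] : exists del : R, del = D0 * 2^-1 ^+ n by exists (D0 * 2^-1 ^+ n).
rewrite -!delE in hN * => peri xr yr zr xp.
have x0 := cabs_ge0 (x - y); have y0 := cabs_ge0 (y - z); have z0 := cabs_ge0 (z - x).
(* [A] is the tangent at p, [G] a primitive of it, and [E] the error. Around the triangle the
   increments of [G] cancel, which leaves the integral of [E]. *)
pose l := cder f p.
pose A w := f p + l * (w - p).
pose G w := f p * w + l * ((w - p) ^+ 2 / 2).
pose E w := f w - A w.
have dA w : cdiff A w (0 + l * 1).
  apply: cdiffD; first exact: cdiff_cst.
  apply: cdiffZ; apply: cdiff_eq (cdiffB (cdiff_id w) (cdiff_cst p w)) _.
  by rewrite subr0.
have cA : ccont_disk A by move=> w _; exact: ccont_cdiff (dA w).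
have cE : ccont_disk E.
  by move=> w wD; exact: ccont_cdiff (cdiffB (holo_cdiff hf wD) (dA w)).
have dG w : disk w -> cdiff G w (A w).
  move=> _; have h1 := cdiffZ (f p) (cdiff_id w).
  have h2 := cdiffX 2 (cdiffB (cdiff_id w) (cdiff_cst p w)).
  have h3 := cdiffZ (l / 2) h2.
  apply: cdiff_ext ltr01 _ (cdiff_eq (cdiffD h1 h3) _).
    by move=> v _; rewrite /G; field.
  by rewrite /A /=; field.
have fE u v : disk u -> disk v -> Iseg f u v = (G v - G u) + Iseg E u v.
  move=> uD vD; rewrite -(Iseg_ftc dG cA uD vD) -IsegD//.
  by congr (Iseg _ _ _); apply/funext => w; rewrite /E; ring.
have xD := D _ xr; have yD := D _ yr; have zD := D _ zr.
have -> : tri f x y z = Iseg E x y + Iseg E y z + Iseg E z x.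
  by rewrite /tri !fE//; ring.
have Eb w : cabs (w - x) <= del -> cabs (E w) <= e' * (2 * del).
  move=> wx; have wp : cabs (w - p) <= 2 * del.
    have -> : w - p = (w - x) + (x - p) by ring.
    by apply: le_trans (cabsD _ _) _; lra.
  have : cabs (w - p) < d by lra.
  move=> /hd h; have -> : E w = f w - f p - l * (w - p) by rewrite /E /A; ring.
  by apply: le_trans h _; rewrite ler_pM2l.
have Ib u v : disk u -> disk v -> cabs (u - x) <= del -> cabs (v - x) <= del ->
    cabs (Iseg E u v) <= cabs (v - u) * (e' * (2 * del)).
  move=> uD vD ux vx; apply: Iseg_bound => // t t1; apply: Eb.
  have -> : u + t%:C%C * (v - u) - x = (u - x) + t%:C%C * ((v - x) - (u - x)) by ring.
  exact: seg_le.
have del0 : 0 <= del by rewrite -peri; lra.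
have xx : cabs (x - x) <= del by rewrite subrr cabs0.
have yx : cabs (y - x) <= del by rewrite cabs_dist; lra.
have zx : cabs (z - x) <= del by lra.
have := Ib _ _ xD yD xx yx; have := Ib _ _ yD zD yx zx; have := Ib _ _ zD xD zx xx.
rewrite (cabs_dist x z) (cabs_dist y x) (cabs_dist z y) => i3 i2 i1.
have tot : cabs (Iseg E x y + Iseg E y z + Iseg E z x) <= del * (e' * (2 * del)).
  apply: le_trans (cabsD _ _) _; apply: le_trans (lerD (cabsD _ _) (lexx _)) _.
  by rewrite -[X in X * _]peri; lra.
have : 4 ^+ n * cabs (Iseg E x y + Iseg E y z + Iseg E z x) <= 4 ^+ n * (del * (e' * (2 * del))).
  by rewrite ler_pM2l// exprn_gt0.
move=> /le_trans; apply.
have -> : 4 ^+ n * (del * (e' * (2 * del))) = e' * (2 * D0 ^+ 2).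
  have : 4 ^+ n * (2^-1 ^+ n * 2^-1 ^+ n) = 1 :> R.
    by rewrite -!exprMn (_ : 4 * _ = 1) ?expr1n//; field.
  rewrite delE; move: (4 ^+ n) (2^-1 ^+ n) => u v uv.
  have -> : u * (D0 * v * (e' * (2 * (D0 * v)))) = (u * (v * v)) * (e' * (2 * D0 ^+ 2)) by ring.
  by rewrite uv mul1r.
rewrite /e' mulrAC ler_pdivrMr; last lra.
by rewrite ler_pM2l//; lra.
Qed.

Definition primitive f z := Iseg f 0 z.

Lemma disk0 : disk (0 : C).
Proof. by rewrite /disk /= cabs0. Qed.

Lemma disk_nbhs z : disk z -> exists2 d : R, 0 < d & forall w, cabs (w - z) < d -> disk w.
Proof.
rewrite /disk /= => zD; exists (1 - cabs z); first lra.
by move=> w; have := cabs_subr w z; lra.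
Qed.

(** Goursat on the triangle 0, z, w expresses the increment of the primitive as the integral of f
    from z to w. *)
Lemma primitive_cdiff f z : holo f -> disk z -> cdiff (primitive f) z (f z).
Proof.
move=> hf zD e e0; have cf := holo_ccont hf.
have [d d0 hd] := cf _ zD _ e0; have [d' d0' hd'] := disk_nbhs zD.
exists (Num.min d d'); first by rewrite lt_min d0.
move=> w; rewrite lt_min => /andP[wd /hd' wD].
have := tri_zero hf disk0 zD wD; rewrite /primitive /tri (Iseg_rev cf disk0 wD) => /eqP.
rewrite subr_eq0 => /eqP <-.
have -> : Iseg f 0 z + Iseg f z w - Iseg f 0 z = Iseg f z w by ring.
have cN : ccont_disk (fun v => - f z) by move=> v _; exact: ccont_cdiff (cdiff_cst _ _).
(* The linear term is itself a segment integral, so the error is the integral of f - f z. *)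
have -> : f z * (w - z) = - ((w - z) * integ (fun=> - f z)) by rewrite integ_cst; ring.
rewrite opprK -[(w - z) * _]/(Iseg (fun=> - f z) z w) -IsegD// mulrC.
apply: Iseg_bound => //; first by move=> v vD; apply: ccontD; [exact: cf|exact: cN].
move=> t /andP[t0 t1]; apply: hd; rewrite addrAC subrr add0r cabsM cabsC ger0_norm//.
by apply: le_lt_trans wd; rewrite ler_piMl// cabs_ge0.
Qed.

End Goursat.

(** * Means over circles *)

Section CauchyFormula.
Variable R : realType.
Local Notation C := (R[i]).
Implicit Types (f g h F : C -> C) (z w : C) (t : R).

Lemma cont01_bounded (q : R -> C) : cont01 q ->
  exists2 B : R, 0 <= B & forall t, 0 <= t <= 1 -> cabs (q t) <= B.
Proof.
move=> cq; apply: contrapT => h.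
have H (n : nat) : exists t, (0 <= t <= 1) /\ n%:R < cabs (q t).
  apply: contrapT => hn; apply: h; exists n%:R => // t t1.
  by rewrite leNgt; apply/negP => ht; apply: hn; exists t.
have [T hT] := choice H.
have [n|s [hs [l l1 hl]]] := @bw_unit_interval R T; first by have [] := hT n.
have [d d0 hd] := cq _ l1 _ (ltr01).
have [|N hN] := hl (d / 2); first lra.
pose m := maxn N (Num.bound (cabs (q l) + 1)).
have := hN m (leq_maxl _ _) => h1.
have /hd : `|T (s m) - l| < d by lra.
have [_] := hT (s m); have := subseq_ge hs m => sm.
have : cabs (q l) + 1 < (Num.bound (cabs (q l) + 1))%:R.
  by apply: archi_boundP; have := cabs_ge0 (q l); lra.
have : (Num.bound (cabs (q l) + 1))%:R <= (s m)%:R :> R.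
  by rewrite ler_nat; apply: leq_trans sm; exact: leq_maxr.
have := cabs_subr (q (T (s m))) (q l); lra.
Qed.

Definition circ (r t : R) : C := r%:C%C * expi t.

(** The contour integral of g over the circle, divided by 2 pi i, is the mean of w g(w). This is why
    the Cauchy kernel appears below as w / (w - z). *)
Definition cmean (r : R) h : C := integ (fun t => h (circ r t)).

Definition ccont_circ (r : R) h := forall w, cabs w = r -> ccont h w.

Section Circle.
Variable r : R.
Hypothesis r0 : 0 < r.

Lemma cabs_circ t : cabs (circ r t) = r.
Proof. by rewrite cabsM cabs_expi mulr1 cabsC ger0_norm// ltW. Qed.

Lemma rcont_circ t : rcont (circ r) t.
Proof. exact: rcontZ (rcont_expi t). Qed.

Lemma cont01_circ h : ccont_circ r h -> cont01 (fun t => h (circ r t)).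
Proof. by move=> hh t _; apply: rcont_comp (rcont_circ t) _; apply: hh; exact: cabs_circ. Qed.

Lemma cmean_ext h g : (forall w, cabs w = r -> h w = g w) -> cmean r h = cmean r g.
Proof. by move=> hg; apply: integ_ext => t _; apply: hg; exact: cabs_circ. Qed.

Lemma cmean_cst (a : C) : cmean r (fun=> a) = a.
Proof. exact: integ_cst. Qed.

Lemma cmeanD h g : ccont_circ r h -> ccont_circ r g ->
  cmean r (fun w => h w + g w) = cmean r h + cmean r g.
Proof. by move=> hh hg; apply: integD; exact: cont01_circ. Qed.

Lemma cmeanZ (a : C) h : ccont_circ r h -> cmean r (fun w => a * h w) = a * cmean r h.
Proof. by move=> hh; apply: integZ; exact: cont01_circ. Qed.

Lemma cmean_bound h (M : R) : ccont_circ r h -> (forall w, cabs w = r -> cabs (h w) <= M) ->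
  cabs (cmean r h) <= M.
Proof.
move=> hh hM; apply: integ_bound; first exact: cont01_circ.
by move=> t _; apply: hM; exact: cabs_circ.
Qed.

Lemma circ_bounded h : ccont_circ r h -> exists2 B : R, 0 <= B &
  forall t, 0 <= t <= 1 -> cabs (h (circ r t)) <= B.
Proof. by move=> /cont01_circ /cont01_bounded. Qed.

Lemma ccont_cst (a : C) z : ccont (fun=> a) z.
Proof. exact: ccont_cdiff (cdiff_cst a z). Qed.

Lemma ccont_id z : ccont id z.
Proof. exact: ccont_cdiff (cdiff_id z). Qed.

Lemma ccont_comp f g z : ccont g z -> ccont f (g z) -> ccont (fun w => f (g w)) z.
Proof.
move=> hg hf e /hf[d d0 hd]; have d2 : 0 < d / 2 by lra.
have [d' d0' hd'] := hg _ d2; exists d' => // s /hd' h; apply: hd; lra.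
Qed.

Lemma ccont_ext f g z (d : R) : 0 < d -> (forall w, cabs (w - z) < d -> f w = g w) ->
  ccont f z -> ccont g z.
Proof.
move=> d0 fg h e /h[d' d0' hd]; exists (Num.min d d'); first by rewrite lt_min d0.
move=> s; rewrite lt_min => /andP[sr sd].
by rewrite -!fg ?subrr ?cabs0//; exact: hd.
Qed.

Lemma ccontM f g z : ccont f z -> ccont g z -> ccont (fun w => f w * g w) z.
Proof.
move=> hf hg e e0; have q0 := cabs_ge0 (f z); have p0 := cabs_ge0 (g z).
pose k : R := Num.min 1 (e / (cabs (f z) + cabs (g z) + 1)).
have k0 : 0 < k by rewrite lt_min ltr01 divr_gt0//; lra.
have [d d0 hd] := hf _ k0; have [d' d0' hd'] := hg _ k0.
exists (Num.min d d'); first by rewrite lt_min d0.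
move=> s; rewrite lt_min => /andP[/hd h1 /hd' h2].
have -> : f s * g s - f z * g z = (f s - f z) * (g s - g z) +
  ((f s - f z) * g z + f z * (g s - g z)) by ring.
have k1 : k <= 1 by rewrite ge_min lexx.
have : k <= e / (cabs (f z) + cabs (g z) + 1) by rewrite ge_min lexx orbT.
rewrite ler_pdivlMr; last lra.
move=> k2; apply: le_trans (cabsD _ _) _.
apply: le_trans (lerD (lexx _) (cabsD _ _)) _; rewrite !cabsM.
have := cabs_ge0 (f s - f z); have := cabs_ge0 (g s - g z).
move: h1 h2; move: (cabs (f s - f z)) (cabs (g s - g z)) => x y h1 h2 y0 x0.
have a1 : x * y <= k * 1 by apply: ler_pM => //; lra.
have a2 : x * cabs (g z) <= k * cabs (g z) by rewrite ler_wpM2r.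
have a3 : cabs (f z) * y <= cabs (f z) * k by rewrite ler_wpM2l.
by lra.
Qed.

Lemma ccontX f z n : ccont f z -> ccont (fun w => f w ^+ n) z.
Proof.
move=> h; elim: n => [|n ih].
  by apply: (ccont_ext ltr01) (ccont_cst 1 z) => s _; rewrite expr0.
by apply: (ccont_ext ltr01) (ccontM h ih) => s _; rewrite exprS.
Qed.

Lemma ccontV f z : ccont f z -> f z != 0 -> ccont (fun w => (f w)^-1) z.
Proof. by move=> hf nz; apply: (ccont_comp hf); exact: ccont_cdiff (cdiff_inv nz). Qed.

Lemma ccontB f g z : ccont f z -> ccont g z -> ccont (fun w => f w - g w) z.
Proof.
move=> hf hg; have := ccontD hf (ccontM (ccont_cst (-1) z) hg).
by apply: (ccont_ext ltr01) => w _; rewrite mulN1r.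
Qed.

Lemma ccont_circ_id : ccont_circ r id.
Proof. by move=> w _; exact: ccont_id. Qed.

Lemma ccont_circD h g : ccont_circ r h -> ccont_circ r g -> ccont_circ r (fun w => h w + g w).
Proof. by move=> hh hg w wr; apply: ccontD; auto. Qed.

Lemma ccont_circM h g : ccont_circ r h -> ccont_circ r g -> ccont_circ r (fun w => h w * g w).
Proof. by move=> hh hg w wr; apply: ccontM; auto. Qed.

Lemma ccont_circZ (a : C) h : ccont_circ r h -> ccont_circ r (fun w => a * h w).
Proof. by apply: ccont_circM => w _; exact: ccont_cst. Qed.

(** The fundamental theorem along a closed curve: the derivative of F along [circ] is [tau] times w
    f(w), and the two end points coincide. *)
Lemma cmean_primitive f F : (forall w, cabs w = r -> cdiff F w (f w)) -> ccont_circ r f ->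
  cmean r (fun w => w * f w) = 0.
Proof.
move=> hF hf; apply: (mulfI (tau_neq0 R)); rewrite mulr0.
have hwf := ccont_circM ccont_circ_id hf; rewrite -(cmeanZ _ hwf).
rewrite /cmean (@integ_ftc _ (fun t => F (circ r t))).
- by rewrite /circ expi0 expi1 subrr.
- move=> t _; have h1 : rdiff (circ r) t (0 + r%:C%C * (tau R * expi t)).
    have := rdiff_comp (@rdiff_expi _ t) (cdiffZ r%:C%C (cdiff_id (expi t))).
    by rewrite mulr1 add0r.
  have h2 := rdiff_comp h1 (hF _ (cabs_circ t)).
  by apply: (rdiff_eq h2); rewrite /circ; ring.
- exact: cont01_circ (ccont_circZ (tau R) hwf).
Qed.

Lemma circ_neq0 w : cabs w = r -> w != 0.
Proof. by move=> wr; rewrite -cabs_gt0 wr. Qed.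

Lemma circ_neq w z : cabs z < r -> cabs w = r -> w - z != 0.
Proof.
move=> zr wr; rewrite -cabs_gt0; have := cabs_subr w z; lra.
Qed.

Lemma ccont_circV n : ccont_circ r (fun w => (w ^+ n)^-1).
Proof.
move=> w wr; apply: ccontV; first by apply: ccontX; exact: ccont_id.
by rewrite expf_neq0//; exact: circ_neq0.
Qed.

(** The function w^-(n + 1) is w times the derivative of -w^-(n + 1) / (n + 1). *)
Lemma cmean_negpow n : cmean r (fun w => (w ^+ n.+1)^-1) = 0.
Proof.
rewrite -(@cmean_primitive (fun w => (w ^+ n.+2)^-1) (fun w => (- n.+1%:R)^-1 * (w ^+ n.+1)^-1)).
- apply: cmean_ext => w /circ_neq0 w0; rewrite [in RHS]exprS; field.
  by rewrite w0 expf_neq0.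
- move=> w /circ_neq0 w0.
  have h := cdiffV (cdiffX n.+1 (cdiff_id w)) (expf_neq0 n.+1 w0).
  apply: cdiff_eq (cdiffZ _ h) _ => /=; rewrite !exprS; field.
  by rewrite w0 expf_neq0 //= addrC natr1 pnatr_eq0.
- exact: ccont_circV.
Qed.

(** A finite geometric sum with its exact remainder, so that no infinite series has to be exchanged
    with an integral. *)
Lemma geometric_expansion w z N : w != 0 -> w - z != 0 ->
  w / (w - z) = \sum_(k < N) z ^+ k * (w ^+ k)^-1 + z ^+ N * ((w ^+ N)^-1 * (w / (w - z))).
Proof.
move=> w0 wz; elim: N => [|N ih].
  by rewrite big_ord0 add0r !expr0 invr1 !mul1r.
rewrite big_ord_recr /= -addrA; rewrite [LHS]ih; congr (_ + _).
rewrite !exprS; field.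
by rewrite w0 wz expf_neq0.
Qed.

Lemma ccont_kernel z : cabs z < r -> ccont_circ r (fun w => w / (w - z)).
Proof.
move=> zr; apply: (ccont_circM ccont_circ_id) => w wr; apply: ccontV; last exact: circ_neq.
by apply: ccontB; [exact: ccont_id|exact: ccont_cst].
Qed.

Lemma cmean_sum (F : nat -> C -> C) N : (forall k, ccont_circ r (F k)) ->
  cmean r (fun w => \sum_(k < N) F k w) = \sum_(k < N) cmean r (F k) /\
  ccont_circ r (fun w => \sum_(k < N) F k w).
Proof.
move=> hF; elim: N => [|N [ih1 ih2]].
  rewrite big_ord0 -[RHS](cmean_cst 0); split.
    by apply: cmean_ext => w _; rewrite big_ord0.
  by move=> w wr; apply: (ccont_ext ltr01) (ccont_cst 0 w) => v _; rewrite big_ord0.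
split.
  rewrite big_ord_recr /= -ih1 -cmeanD//; apply: cmean_ext => w _.
  by rewrite big_ord_recr.
move=> w wr; apply: (ccont_ext ltr01) (ccontD (ih2 w wr) (hF N w wr)) => v _.
by rewrite big_ord_recr.
Qed.

Lemma kernel_bound w z : cabs z < r -> cabs w = r -> cabs (w / (w - z)) <= r / (r - cabs z).
Proof.
move=> zr wr; rewrite cabsM cabsV wr ler_pM2l// lef_pV2 ?posrE.
- by rewrite -wr; exact: cabs_subr.
- by rewrite cabs_gt0; exact: circ_neq.
- lra.
Qed.

(** Averages [geometric_expansion] against h. With h = 1 it evaluates the mean of the kernel; with h
    a derivative of a Bloch function it gives the error of Taylor truncation. *)
Lemma cauchy_expansion_aux h z N (M : R) : cabs z < r -> ccont_circ r h ->
  (forall w, cabs w = r -> cabs (h w) <= M) ->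
  cabs (cmean r (fun w => h w * (w / (w - z))) -
        \sum_(k < N) cmean r (fun w => h w * (w ^+ k)^-1) * z ^+ k)
  <= M * ((cabs z / r) ^+ N * (r / (r - cabs z))).
Proof.
move=> zr hh hM.
have c0 k := ccont_circM hh (ccont_circV k); have c1 k := ccont_circZ (z ^+ k) (c0 k).
have [E1 c2] := cmean_sum N c1.
have c3 := ccont_circM hh (ccont_circZ (z ^+ N) (ccont_circM (ccont_circV N) (ccont_kernel zr))).
rewrite (@cmean_ext _ (fun w => (\sum_(k < N) z ^+ k * (h w * (w ^+ k)^-1)) +
   h w * (z ^+ N * ((w ^+ N)^-1 * (w / (w - z)))))); last first.
  move=> w wr; rewrite {1}(@geometric_expansion w z N); [|exact: circ_neq0|exact: circ_neq].
  rewrite mulrDr mulr_sumr; congr (_ + _); apply: eq_bigr => k _; ring.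
rewrite cmeanD// E1 addrAC.
rewrite (eq_bigr (fun k : 'I_N => cmean r (fun w => h w * (w ^+ k)^-1) * z ^+ k)); last first.
  by move=> k _; rewrite cmeanZ 1?mulrC.
rewrite subrr add0r; apply: cmean_bound => // w wr.
rewrite cabsM; apply: ler_pM; rewrite ?cabs_ge0//; first exact: hM.
have := kernel_bound zr wr; move: (w / (w - z)) => K hK.
rewrite !cabsM cabsV !cabsX wr mulrA -exprVn -exprMn.
by rewrite ler_wpM2l ?exprn_ge0 ?divr_ge0 ?cabs_ge0 ?(ltW r0).
Qed.

(** The negative powers of w have mean 0, so only the term k = 0 of the expansion survives, and the
    remainder is arbitrarily small. *)
Lemma cmean_kernel z : cabs z < r -> cmean r (fun w => w / (w - z)) = 1.
Proof.
move=> zr; apply/eqP; rewrite -subr_eq0; apply/eqP/cabs0_eq0/le_anti.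
rewrite cabs_ge0 andbT; apply: arbitrarily_small => e e0.
have rz : 0 < r / (r - cabs z) by apply: divr_gt0 => //; lra.
have [||N hN] := @expn_small R (cabs z / r) (e / (r / (r - cabs z))).
- by rewrite divr_ge0 ?cabs_ge0 ?ltW//= ltr_pdivrMr ?mul1r.
- by rewrite divr_gt0.
(* The index N + 1 ensures that the sum contains its term k = 0. *)
have := @cauchy_expansion_aux (fun=> 1) z N.+1 1 zr (fun w _ => ccont_cst 1 w).
rewrite big_ord_recl /= big1 ?addr0; last first.
  move=> k _; rewrite (@cmean_ext _ (fun w => (w ^+ (lift ord0 k))^-1)); last by move=> w _; rewrite mul1r.
  by rewrite lift0 cmean_negpow mul0r.
rewrite (@cmean_ext (fun w => 1 * (w ^+ 0)^-1) (fun=> 1)); last by move=> w _; rewrite expr0 invr1 mulr1.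
rewrite cmean_cst expr0 mul1r (@cmean_ext (fun w => 1 * (w / (w - z))) (fun w => w / (w - z))); last first.
  by move=> w _; rewrite mul1r.
move=> h; apply: le_trans (h _) _; first by move=> w _; rewrite cabs1.
rewrite mul1r -ler_pdivlMr//; apply: le_trans hN; rewrite exprS ler_piMl//.
  by rewrite exprn_ge0// divr_ge0 ?cabs_ge0 ?ltW.
by rewrite ler_pdivrMr ?mul1r ?ltW.
Qed.

End Circle.

End CauchyFormula.

(** * The Cauchy formula and derivatives of holomorphic functions *)

Section Cauchy.
Variable R : realType.
Local Notation C := (R[i]).
Implicit Types (f g h F : C -> C) (z w : C) (t : R).

Lemma ball_unif f (r : R) : r < 1 -> ccont_disk f -> forall e : R, 0 < e ->
  exists2 d : R, 0 < d & forall z w, cabs z <= r -> cabs w <= r ->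
    cabs (z - w) <= d -> cabs (f z - f w) <= e.
Proof.
move=> r1 hf; apply: (@ctends_unif R [set z | cabs z <= r]).
- move=> u hu; have [s [hs [l hl]]] := bw_complex hu.
  by exists s; split => //; exists l; split => //=; apply: (ctends_bound hl) => n; exact: hu.
- by move=> z /= zr; apply: hf; rewrite /disk /= (le_lt_trans zr).
Qed.

Section Radius.
Variable r : R.
Hypotheses (r0 : 0 < r) (r1 : r < 1).

Lemma circ_disk w : cabs w = r -> disk w.
Proof. by rewrite /disk /= => ->. Qed.

Lemma holo_ccont_circ g : holo g -> ccont_circ r g.
Proof. by move=> /holo_ccont cg w /circ_disk; exact: cg. Qed.

Lemma ball_disk z : cabs z < r -> disk z.
Proof. by rewrite /disk /= => /lt_trans; apply. Qed.

Section Primitive.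
Variables (f F : C -> C) (z : C).
Hypotheses (hF : forall w, disk w -> cdiff F w (f w)) (hf : ccont_disk f).
Hypothesis (zr : cabs z < r).

Let good h := ccont_circ r h /\ cmean r (fun w => w * h w) = 0.

(** For t != 0 the function F (z + t (w - z)) / t of w is a primitive; for t = 0 the integrand is
    the constant f z. *)
Let good_point t : 0 <= t <= 1 -> good (fun w => f (z + t%:C%C * (w - z))).
Proof.
move=> t1; have zD := ball_disk zr.
have dl w : cdiff (fun v => z + t%:C%C * (v - z)) w t%:C%C.
  have := cdiffD (cdiff_cst z w) (cdiffZ t%:C%C (cdiffB (cdiff_id w) (cdiff_cst z w))).
  by rewrite subr0 mulr1 add0r.
have hc : ccont_circ r (fun w => f (z + t%:C%C * (w - z))).
  move=> w wr; apply: (ccont_comp (g := fun v => z + t%:C%C * (v - z))).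
    exact: ccont_cdiff (dl w).
  by apply: hf; apply: seg_disk => //; exact: circ_disk.
split => //; have [t0|tn] := eqVneq t%:C%C (0 : C).
  apply: (@cmean_primitive _ _ r0 _ (fun w => f z * w)) => // w wr.
  rewrite t0 mul0r addr0 -[X in cdiff _ _ X]mulr1; apply: cdiffZ; exact: cdiff_id.
apply: (@cmean_primitive _ _ r0 _ (fun w => (t%:C%C)^-1 * F (z + t%:C%C * (w - z)))) => // w wr.
have h1 : cdiff F (z + t%:C%C * (w - z)) (f (z + t%:C%C * (w - z))).
  by apply: hF; apply: seg_disk => //; exact: circ_disk.
apply: (cdiff_eq (cdiffZ _ (cdiff_comp (dl w) h1))); field.
exact: tn.
Qed.

(** Means commute with finite sums. The sub-interval from a to a + b is the generality that the
    induction on halves requires. *)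
Let good_dyad m (a b : R) : 0 <= a -> 0 <= b -> a + b <= 1 ->
  good (fun w => dyad (fun t => f (z + (a + b * t)%:C%C * (w - z))) m).
Proof.
elim: m a b => [|m ih] a b a0 b0 ab /=.
  have [|h1 h2] := @good_point a; first lra.
  split.
    by move=> w wr; apply: (ccont_ext ltr01) (h1 w wr) => v _; rewrite mulr0 addr0.
  by rewrite -[RHS]h2; apply: cmean_ext => // w wr; rewrite mulr0 addr0.
have [||| h1 h2] := ih a (b / 2); [lra..|].
have [||| k1 k2] := ih (a + b / 2) (b / 2); [lra..|].
have E w : (dyad (fun t => f (z + (a + b * (t / 2))%:C%C * (w - z))) m +
    dyad (fun t => f (z + (a + b * ((1 + t) / 2))%:C%C * (w - z))) m) / 2 =
  2^-1 * (dyad (fun t => f (z + (a + b / 2 * t)%:C%C * (w - z))) m +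
    dyad (fun t => f (z + (a + b / 2 + b / 2 * t)%:C%C * (w - z))) m).
  rewrite mulrC; congr (_ * (_ + _)); apply: dyad_ext => t _; congr (f (z + _%:C%C * _)); by field.
split.
  move=> w wr; apply: (ccont_ext ltr01 _ (ccontM (ccont_cst 2^-1 w) (ccontD (h1 w wr) (k1 w wr)))).
  by move=> v _; rewrite E.
have cid h := ccont_circM (@ccont_circ_id R r) (g := h).
rewrite (@cmean_ext _ _ r0 _ (fun w => 2^-1 *
   (w * dyad (fun t => f (z + (a + b / 2 * t)%:C%C * (w - z))) m +
    w * dyad (fun t => f (z + (a + b / 2 + b / 2 * t)%:C%C * (w - z))) m))); last first.
  by move=> w wr; rewrite E; ring.
rewrite cmeanZ//; last exact: (ccont_circD (cid _ h1) (cid _ k1)).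
by rewrite (cmeanD r0 (cid _ h1) (cid _ k1)) h2 k2 addr0 mulr0.
Qed.

(** On the circle F w - F z is w - z times the integral over t of f (z + t (w - z)). Each integrand
    has vanishing w-weighted mean, so F w - F z has mean 0 against the kernel. Dyadic sums in t
    stand in for an exchange of two integrals. *)
Lemma cauchy_primitive : F z = cmean r (fun w => F w * (w / (w - z))).
Proof.
have zD := ball_disk zr.
have cF : ccont_circ r F by move=> w /circ_disk /hF; exact: ccont_cdiff.
have ck := ccont_kernel zr.
pose Q w := integ (fun t => f (z + t%:C%C * (w - z))).
have QE w : cabs w = r -> w * Q w = F w * (w / (w - z)) + (- F z) * (w / (w - z)).
  move=> wr; have := Iseg_ftc hF hf zD (circ_disk wr); rewrite /Iseg -/(Q w) => e.
  have nz : w - z != 0 by exact: circ_neq wr.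
  have -> : Q w = (F w - F z) / (w - z) by rewrite -e; field.
  by field.
have ck1 := ccont_circM cF ck; have ck2 := ccont_circZ (- F z) ck.
pose G w := F w * (w / (w - z)) + (- F z) * (w / (w - z)).
have cG : ccont_circ r G by exact: (ccont_circD ck1 ck2).
suff : cmean r G = 0.
  rewrite /G cmeanD// cmeanZ// cmean_kernel// mulr1 => /eqP.
  by rewrite subr_eq0 => /eqP.
apply/cabs0_eq0/le_anti; rewrite cabs_ge0 andbT; apply: arbitrarily_small => e e0.
(* Uniform continuity on the closed ball gives one level m for all w on the circle; d / 2 is taken
   because |w - z| <= 2. *)
have [d d0 hd] := ball_unif r1 hf e0; have d2 : 0 < d / 2 by lra.
have [m hm] := halfX_small d2.
have [||| h1 h2] := @good_dyad m 0 1; [lra..|].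
have h4 := ccont_circM (@ccont_circ_id R r) h1; have h3 := ccont_circZ (-1) h4.
have -> : cmean r G = cmean r (fun w => G w + -1 * (w * dyad (fun t => f (z + (0 + 1 * t)%:C%C * (w - z))) m)).
  by rewrite (cmeanD r0 cG h3) (cmeanZ r0 _ h4) h2 mulr0 addr0.
apply: cmean_bound => //; first exact: (ccont_circD cG h3).
move=> w wr; rewrite /G -QE// mulN1r -mulrBr cabsM wr.
have wD := circ_disk wr.
have cq : cont01 (fun t => f (z + t%:C%C * (w - z))) by exact: cont01_seg.
suff : cabs (Q w - dyad (fun t => f (z + (0 + 1 * t)%:C%C * (w - z))) m) <= e.
  move=> h; apply: le_trans h; rewrite ler_piMl ?cabs_ge0 ?ltW//.
rewrite (@dyad_ext _ _ (fun t => f (z + t%:C%C * (w - z)))); last first.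
  by move=> t _; rewrite add0r mul1r.
rewrite -subr_le0; apply: arbitrarily_small => e1 /(integ_cvg cq)[N /(_ _ (leq_maxl N m))].
have := @dyad_unif R (fun t => f (z + t%:C%C * (w - z))) (d / 2) e d2 _ m hm (maxn N m) (leq_maxr _ _).
rewrite -/(Q w); set x := dyad _ (maxn _ _); set y := dyad _ m => h5 h6.
have -> : Q w - y = (x - y) - (x - Q w) by ring.
have : cabs (x - y) <= e.
  apply: h5 => s t s1 t1 st; apply: hd.
  - by apply: seg_le => //; [exact: ltW|rewrite wr].
  - by apply: seg_le => //; [exact: ltW|rewrite wr].
  rewrite (_ : _ - _ = (s - t)%:C%C * (w - z)); last by rewrite rmorphB /=; ring.
  have wz : cabs (w - z) <= 2.
    by apply: le_trans (cabsB _ _) _; rewrite wr; move: r1 zr; lra.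
  rewrite cabsM cabsC (_ : d = d / 2 * 2); last by field.
  by apply: ler_pM => //; rewrite cabs_ge0.
by have := cabsB (x - y) (x - Q w); lra.
Qed.

End Primitive.

Lemma cmean_cdiff (k : C -> C -> C) (k' h : C -> C) z (A d : R) :
  0 < d -> 0 <= A -> ccont_circ r h ->
  (forall v, cabs (v - z) < d -> ccont_circ r (k v)) -> ccont_circ r k' ->
  (forall v w, cabs (v - z) < d -> cabs w = r ->
     cabs (k v w - k z w - k' w * (v - z)) <= A * cabs (v - z) ^+ 2) ->
  cdiff (fun v => cmean r (fun w => h w * k v w)) z (cmean r (fun w => h w * k' w)).
Proof.
move=> d0 A0 ch ck ck' hk e e0; have [B B0 hB] := circ_bounded r0 ch.
have AB : 0 <= A * B by rewrite mulr_ge0.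
exists (Num.min d (e / (A * B + 1))); first by rewrite lt_min d0 divr_gt0//; lra.
move=> v; rewrite lt_min => /andP[vd]; rewrite ltr_pdivlMr; last lra.
move=> vAB; have zd : cabs (z - z) < d by rewrite subrr cabs0.
have c1 := ccont_circM ch (ck v vd); have c2' := ccont_circM ch (ck z zd).
have c3' := ccont_circM ch ck'; have c2 := ccont_circZ (-1) c2'.
have c3 := ccont_circZ (- (v - z)) c3'; have c23 := ccont_circD c2 c3.
have -> : cmean r (fun w => h w * k v w) - cmean r (fun w => h w * k z w) -
    cmean r (fun w => h w * k' w) * (v - z) =
  cmean r (fun w => h w * k v w + (-1 * (h w * k z w) + - (v - z) * (h w * k' w))).
  by rewrite (cmeanD r0 c1 c23) (cmeanD r0 c2 c3) !cmeanZ//; ring.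
apply: integ_bound => [|t t1]; first exact: (cont01_circ r0 (ccont_circD c1 c23)).
have wr := cabs_circ r0 t; have {hB} := hB t t1; move: (circ r t) wr => w wr hB.
have -> : h w * k v w + (-1 * (h w * k z w) + - (v - z) * (h w * k' w)) =
  h w * (k v w - k z w - k' w * (v - z)) by ring.
rewrite cabsM; have v0 := cabs_ge0 (v - z).
apply: le_trans (_ : B * (A * cabs (v - z) ^+ 2) <= _).
  by apply: ler_pM; rewrite ?cabs_ge0//; exact: hk.
have -> : B * (A * cabs (v - z) ^+ 2) = (cabs (v - z) * (A * B)) * cabs (v - z) by ring.
by rewrite ler_wpM2r//; lra.
Qed.

Lemma ccont_kernelV n h z : ccont_circ r h -> cabs z < r ->
  ccont_circ r (fun w => h w * ((w - z) ^+ n)^-1).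
Proof.
move=> hh zr; apply: (ccont_circM hh) => w wr; apply: ccontV; first by apply: ccontX; apply: ccontB; [exact: ccont_id|exact: ccont_cst].
by rewrite expf_neq0//; exact: circ_neq wr.
Qed.

(** A point v within half the distance from z to the circle keeps the other half as its own distance
    to it. *)
Let near_circ z v : cabs z < r -> cabs (v - z) < (r - cabs z) / 2 ->
  cabs v < r /\ forall w, cabs w = r -> cabs (w - v)^-1 <= ((r - cabs z) / 2)^-1.
Proof.
move=> zr vz; have vr : cabs v < r by have := cabs_subr v z; lra.
split => // w wr; rewrite cabsV lef_pV2 ?posrE; last lra.
  by have := cabs_subr w v; have := cabs_subr v z; lra.
by rewrite cabs_gt0; exact: circ_neq wr.
Qed.

Lemma cdiff_kernel1 h z : ccont_circ r h -> cabs z < r ->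
  cdiff (fun v => cmean r (fun w => h w * (w - v)^-1)) z
    (cmean r (fun w => h w * ((w - z) ^+ 2)^-1)).
Proof.
move=> ch zr; set d := (r - cabs z) / 2; have d0 : 0 < d by rewrite /d; lra.
have c1 : ccont_circ r (fun=> 1) by move=> w _; exact: ccont_cst.
have zz : cabs (z - z) < d by rewrite subrr cabs0.
apply: (@cmean_cdiff (fun v w => (w - v)^-1) (fun w => ((w - z) ^+ 2)^-1) h z (d^-1 ^+ 3) d) => //.
- by rewrite exprn_ge0// invr_ge0 ltW.
- move=> v /(near_circ zr)[vr _] w wr.
  apply: (ccont_ext ltr01) (@ccont_kernelV 1 _ _ c1 vr w wr) => x _.
  by rewrite mul1r expr1.
- move=> w wr; apply: (ccont_ext ltr01) (@ccont_kernelV 2 _ _ c1 zr w wr) => x _.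
  by rewrite mul1r.
move=> v w vz wr.
have [vr /(_ w wr) hv] := near_circ zr vz; have [_ /(_ w wr) hz] := near_circ zr zz.
have v0 : w - v != 0 by exact: circ_neq wr.
have z0 : w - z != 0 by exact: circ_neq wr.
(* The exact second-order remainder: three reciprocals, each at most 1/d in modulus, times (v -
   z)^2. *)
have -> : (w - v)^-1 - (w - z)^-1 - ((w - z) ^+ 2)^-1 * (v - z) =
   ((w - v)^-1 * (w - z)^-1 ^+ 2) * (v - z) ^+ 2 by field; rewrite ?v0 ?z0.
rewrite cabsM cabsX ler_wpM2r ?exprn_ge0 ?cabs_ge0// cabsM cabsX (exprS d^-1 2).
apply: ler_pM; rewrite ?exprn_ge0 ?cabs_ge0//.
by rewrite lerXn2r ?nnegrE ?cabs_ge0// invr_ge0 ltW.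
Qed.

Lemma cdiff_kernel2 h z : ccont_circ r h -> cabs z < r ->
  cdiff (fun v => cmean r (fun w => h w * ((w - v) ^+ 2)^-1)) z
    (cmean r (fun w => h w * (2 * ((w - z) ^+ 3)^-1))).
Proof.
move=> ch zr; set d := (r - cabs z) / 2; have d0 : 0 < d by rewrite /d; lra.
have c1 : ccont_circ r (fun=> 1) by move=> w _; exact: ccont_cst.
have c2 : ccont_circ r (fun=> 2) by move=> w _; exact: ccont_cst.
have zz : cabs (z - z) < d by rewrite subrr cabs0.
apply: (@cmean_cdiff (fun v w => ((w - v) ^+ 2)^-1) (fun w => 2 * ((w - z) ^+ 3)^-1) h z (5 * d^-1 ^+ 4) d) => //.
- by rewrite mulr_ge0 ?exprn_ge0// invr_ge0 ltW.
- move=> v /(near_circ zr)[vr _] w wr.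
  apply: (ccont_ext ltr01) (@ccont_kernelV 2 _ _ c1 vr w wr) => x _.
  by rewrite mul1r.
- exact: (@ccont_kernelV 3 _ _ c2 zr).
move=> v w vz wr.
have [vr /(_ w wr) hv] := near_circ zr vz; have [_ /(_ w wr) hz] := near_circ zr zz.
have v0 : w - v != 0 by exact: circ_neq wr.
have z0 : w - z != 0 by exact: circ_neq wr.
(* The constant 5 is 3 + 2: in the second term the factor |v - z| < d lowers d^-5 to d^-4. *)
have -> : ((w - v) ^+ 2)^-1 - ((w - z) ^+ 2)^-1 - 2 * ((w - z) ^+ 3)^-1 * (v - z) =
   (3 * ((w - v)^-1 ^+ 2 * (w - z)^-1 ^+ 2) -
    2 * ((v - z) * ((w - v)^-1 ^+ 2 * (w - z)^-1 ^+ 3))) * (v - z) ^+ 2 by field; rewrite ?v0 ?z0.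
rewrite cabsM cabsX ler_wpM2r ?exprn_ge0 ?cabs_ge0//.
apply: le_trans (cabsB _ _) _; rewrite !(cabsX, cabsM) (cabs_nat R 3) (cabs_nat R 2).
have D0 : 0 <= d^-1 by rewrite invr_ge0 ltW.
have x0 := cabs_ge0 (w - v)^-1; have y0 := cabs_ge0 (w - z)^-1; have h0 := cabs_ge0 (v - z).
have dd : d * d^-1 = 1 by rewrite divff// gt_eqF.
move: (cabs (w - v)^-1) (cabs (w - z)^-1) (cabs (v - z)) hv hz x0 y0 h0 vz => x y k.
rewrite -/d; move: (d^-1) D0 dd => D D0 dd hv hz x0 y0 h0 vz.
have X n (u : R) : 0 <= u -> u <= D -> u ^+ n <= D ^+ n by move=> u0 uD; rewrite lerXn2r ?nnegrE.
have a1 : x ^+ 2 * y ^+ 2 <= D ^+ 4.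
  by rewrite (exprD D 2 2); apply: ler_pM; rewrite ?exprn_ge0// X.
have a2 : x ^+ 2 * y ^+ 3 <= D ^+ 5.
  by rewrite (exprD D 2 3); apply: ler_pM; rewrite ?exprn_ge0// X.
have a3 : k * (x ^+ 2 * y ^+ 3) <= d * D ^+ 5.
  by apply: ler_pM; rewrite ?mulr_ge0 ?exprn_ge0// ltW.
by move: a3; rewrite (exprS D 4) [d * _]mulrA dd mul1r; lra.
Qed.

(** For a primitive F of g, the formula of [cauchy_primitive] can be differentiated in z, which
    gives g z as the mean of F w times w / (w - z)^2. Integration by parts then replaces F by g,
    since w times the derivative of F w / (w - z) has mean 0. *)
Lemma cauchy_formula g z : holo g -> cabs z < r ->
  g z = cmean r (fun w => g w * (w / (w - z))).
Proof.
move=> hg zr; have cg := holo_ccont hg; pose F := primitive g.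
have hF w : disk w -> cdiff F w (g w) by exact: primitive_cdiff.
have cF : ccont_circ r F by move=> w /circ_disk /hF; exact: ccont_cdiff.
have cFw := ccont_circM cF (@ccont_circ_id R r).
have E : g z = cmean r (fun w => F w * w * ((w - z) ^+ 2)^-1).
  have [d d0 hd] : exists2 d : R, 0 < d & forall v, cabs (v - z) < d -> cabs v < r.
    by exists (r - cabs z); [lra|move=> v; have := cabs_subr v z; lra].
  have := cdiff_kernel1 cFw zr => /(@cdiff_ext _ _ F _ _ _ d0) h.
  rewrite -(cdiff_cder (hF z (ball_disk zr))) (cdiff_cder (h _))// => v /hd vr.
  rewrite (cauchy_primitive hF cg vr); apply: cmean_ext => // w _.
  by rewrite -mulrA.
have c1 : ccont_circ r (fun w => F w * w * ((w - z) ^+ 2)^-1) by exact: ccont_kernelV.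
have cgc := holo_ccont_circ hg; have c2 := ccont_circM cgc (ccont_kernel zr).
rewrite E; apply/eqP; rewrite eq_sym -subr_eq0; apply/eqP.
have c3 := ccont_circZ (-1) c1.
rewrite -[X in _ - X]mul1r -mulNr -cmeanZ// -cmeanD//.
rewrite -(@cmean_primitive _ _ r0 (fun w => g w * ((w - z) ^+ 1)^-1 + -1 * (F w * ((w - z) ^+ 2)^-1))
  (fun w => F w * (w - z)^-1)).
- apply: cmean_ext => // w wr; rewrite expr1; field; exact: circ_neq wr.
- move=> w wr; have nz : w - z != 0 by exact: circ_neq wr.
  have := cdiffM (hF w (circ_disk wr)) (cdiffV (cdiffB (cdiff_id w) (cdiff_cst z w)) nz).
  by move=> /cdiff_eq; apply; rewrite expr1 subr0; field.
- exact: (ccont_circD (ccont_kernelV 1 cgc zr) (ccont_circZ (-1) (ccont_kernelV 2 cF zr))).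
Qed.

Lemma cauchy_cder g z : holo g -> cabs z < r ->
  cder g z = cmean r (fun w => g w * w * ((w - z) ^+ 2)^-1).
Proof.
move=> hg zr; have cgw := ccont_circM (holo_ccont_circ hg) (@ccont_circ_id R r).
have d0 : 0 < r - cabs z by lra.
have h := cdiff_kernel1 cgw zr; apply: cdiff_cder; apply: cdiff_ext d0 _ h => v vz.
have vr : cabs v < r by have := cabs_subr v z; lra.
rewrite [RHS](cauchy_formula hg vr); apply: cmean_ext => // w _.
by rewrite -mulrA.
Qed.

Lemma cdiff_cder_ball g z : holo g -> cabs z < r -> exists l, cdiff (cder g) z l.
Proof.
move=> hg zr; have cgw := ccont_circM (holo_ccont_circ hg) (@ccont_circ_id R r).
have d0 : 0 < r - cabs z by lra.
have h := cdiff_kernel2 cgw zr; eexists; apply: cdiff_ext d0 _ h => v vz.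
have vr : cabs v < r by have := cabs_subr v z; lra.
by rewrite (cauchy_cder hg vr).
Qed.

Lemma cauchy_expansion g z N (M : R) : holo g -> cabs z < r ->
  (forall w, cabs w = r -> cabs (g w) <= M) ->
  cabs (g z - \sum_(k < N) cmean r (fun w => g w * (w ^+ k)^-1) * z ^+ k)
  <= M * ((cabs z / r) ^+ N * (r / (r - cabs z))).
Proof.
move=> hg zr hM; rewrite {1}(cauchy_formula hg zr); apply: cauchy_expansion_aux => //.
exact: holo_ccont_circ.
Qed.

Lemma cauchy_cder0 g (M : R) : holo g ->
  (forall w, cabs w = r -> cabs (g w) <= M) -> cabs (cder g 0) <= M / r.
Proof.
move=> hg hM; have z0 : cabs (0 : C) < r by rewrite cabs0.
have cgw := ccont_circM (holo_ccont_circ hg) (@ccont_circ_id R r).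
rewrite (cauchy_cder hg z0); apply: cmean_bound => //.
  exact: (ccont_kernelV 2 cgw z0).
move=> w wr; rewrite subr0 !cabsM cabsV cabsX wr.
have -> : cabs (g w) * r * (r ^+ 2)^-1 = cabs (g w) / r by field; exact: lt0r_neq0.
by rewrite ler_wpM2r ?invr_ge0 ?(ltW r0)//; exact: hM.
Qed.

End Radius.

Lemma holo_cder g : holo g -> holo (cder g).
Proof.
move=> hg z; rewrite /disk /= => z1.
have r0 : 0 < (1 + cabs z) / 2 by have := cabs_ge0 z; lra.
have [||l hl] := @cdiff_cder_ball ((1 + cabs z) / 2) r0 _ g z hg; [lra|lra|].
exact: cdiff_derivable hl.
Qed.

End Cauchy.

(** * Holomorphic functions and the norms *)

Section HoloRules.
Variable R : realType.
Local Notation C := (R[i]).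
Implicit Types (f g u phi : C -> C) (z w a : C).

(* The derivative is sealed: otherwise comparing the derivatives of two
   different functions unfolds both of them down to the definition of limits. *)
Lemma dC_subproof : {D : (C -> C) -> C -> C | D = @cder R}.
Proof. by exists (@cder R). Qed.

Definition dC : (C -> C) -> C -> C := sval dC_subproof.

Lemma dCE : dC = @cder R.
Proof. exact: (svalP dC_subproof). Qed.

Definition hol f := forall z, disk z -> cdiff f z (dC f z).

Lemma holE f : holo f <-> hol f.
Proof.
rewrite /hol dCE; split=> h z zD; first exact: holo_cdiff.
exact: cdiff_derivable (h z zD).
Qed.

Lemma cdiff_dC f z a : cdiff f z a -> dC f z = a.
Proof. by rewrite dCE; exact: cdiff_cder. Qed.

Lemma cdiff_hol f (l : C -> C) : (forall z, disk z -> cdiff f z (l z)) -> hol f.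
Proof. by move=> h; apply/holE => z /h; exact: cdiff_derivable. Qed.

Lemma hol_dC f : hol f -> hol (dC f).
Proof. by move=> /holE h; apply/holE; rewrite dCE; exact: holo_cder. Qed.

Lemma dC_ext f g : hol f -> (forall z, disk z -> f z = g z) ->
  forall z, disk z -> cdiff g z (dC f z).
Proof.
move=> hf fg z zD; have [d d0 hd] := disk_nbhs zD.
by apply: cdiff_ext d0 _ (hf z zD) => w /hd /fg.
Qed.

Lemma eq_dC f g : hol f -> (forall z, disk z -> f z = g z) ->
  forall z, disk z -> dC g z = dC f z.
Proof. by move=> hf fg z zD; exact: cdiff_dC (dC_ext hf fg zD). Qed.

Lemma eq_dC2 f g : hol f -> (forall z, disk z -> f z = g z) ->
  forall z, disk z -> dC (dC g) z = dC (dC f) z.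
Proof.
move=> hf fg z zD.
exact: (eq_dC (hol_dC hf) (fun w wD => esym (eq_dC hf fg wD)) zD).
Qed.

Definition holmap phi := hol phi /\ forall z, disk z -> disk (phi z).

Lemma holmapE phi : selfmap phi <-> holmap phi.
Proof. by split=> -[/holE]. Qed.

Lemma hol_cst a : hol (fun=> a).
Proof. by apply: (@cdiff_hol _ (fun=> 0)) => z _; exact: cdiff_cst. Qed.

Lemma holD f g : hol f -> hol g -> hol (fun z => f z + g z).
Proof. by move=> hf hg; apply: cdiff_hol => z zD; apply: cdiffD; auto. Qed.

Lemma holM f g : hol f -> hol g -> hol (fun z => f z * g z).
Proof. by move=> hf hg; apply: cdiff_hol => z zD; apply: cdiffM; auto. Qed.

Lemma holZ a f : hol f -> hol (fun z => a * f z).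
Proof. by move=> hf; apply: cdiff_hol => z zD; apply: cdiffZ; auto. Qed.

Lemma holB f g : hol f -> hol g -> hol (fun z => f z - g z).
Proof. by move=> hf hg; apply: cdiff_hol => z zD; apply: cdiffB; auto. Qed.

Lemma hol_comp f phi : hol f -> holmap phi -> hol (fun z => f (phi z)).
Proof.
move=> hf [hp pD]; apply: cdiff_hol => z zD.
by apply: cdiff_comp; [exact: hp|apply: hf; exact: pD].
Qed.

Lemma hol_sum n (F : nat -> C -> C) : (forall i, (i < n)%N -> hol (F i)) ->
  hol (fun z => \sum_(i < n) F i z).
Proof.
move=> h; apply: (@cdiff_hol _ (fun z => \sum_(i < n) dC (F i) z)) => z zD.
by apply: (cdiff_sum (l := fun i => dC (F i) z)) => i ilt; exact: h.
Qed.

Lemma dCD f g z : hol f -> hol g -> disk z ->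
  dC (fun w => f w + g w) z = dC f z + dC g z.
Proof. by move=> hf hg zD; apply: cdiff_dC; apply: cdiffD; auto. Qed.

Lemma dCZ a f z : hol f -> disk z -> dC (fun w => a * f w) z = a * dC f z.
Proof. by move=> hf zD; apply: cdiff_dC; apply: cdiffZ; auto. Qed.

Lemma dCB f g z : hol f -> hol g -> disk z ->
  dC (fun w => f w - g w) z = dC f z - dC g z.
Proof. by move=> hf hg zD; apply: cdiff_dC; apply: cdiffB; auto. Qed.

Lemma dC2D f g z : hol f -> hol g -> disk z ->
  dC (dC (fun w => f w + g w)) z = dC (dC f) z + dC (dC g) z.
Proof.
move=> hf hg zD; have hf' := hol_dC hf; have hg' := hol_dC hg.
rewrite -(dCD hf' hg' zD); exact: (eq_dC (holD hf' hg') (fun w wD => esym (dCD hf hg wD)) zD).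
Qed.

Lemma dC2Z a f z : hol f -> disk z ->
  dC (dC (fun w => a * f w)) z = a * dC (dC f) z.
Proof.
move=> hf zD; have hf' := hol_dC hf.
have E w : disk w -> a * dC f w = dC (fun w => a * f w) w.
  by move=> wD; rewrite (dCZ a hf wD).
exact: etrans (eq_dC (holZ a hf') E zD) (dCZ a hf' zD).
Qed.

Lemma dC2B f g z : hol f -> hol g -> disk z ->
  dC (dC (fun w => f w - g w)) z = dC (dC f) z - dC (dC g) z.
Proof.
move=> hf hg zD; have hf' := hol_dC hf; have hg' := hol_dC hg.
rewrite -(dCB hf' hg' zD); exact: (eq_dC (holB hf' hg') (fun w wD => esym (dCB hf hg wD)) zD).
Qed.

Lemma hol_wcomp u phi f : hol u -> holmap phi -> hol f -> hol (wcomp u phi f).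
Proof. by move=> hu hp hf; exact: (holM hu (hol_comp hf hp)). Qed.

Lemma dC_wcomp u phi f z : hol u -> holmap phi -> hol f -> disk z ->
  dC (wcomp u phi f) z = dC u z * f (phi z) + u z * (dC f (phi z) * dC phi z).
Proof.
move=> hu [hp pD] hf zD; apply: cdiff_dC; apply: cdiffM; first auto.
by apply: cdiff_comp; [exact: hp|apply: hf; exact: pD].
Qed.

(** Stated for plain variables, so that [ring] meets no derivative. *)
Let leibniz2 (a0 a1 a2 b0 b1 b2 c1 c2 : C) :
  (a2 * b0 + a1 * (b1 * c1)) + (a1 * (b1 * c1) + a0 * (b2 * c1 * c1 + b1 * c2)) =
  a2 * b0 + (2 * a1 * c1 + a0 * c2) * b1 + a0 * c1 ^+ 2 * b2.
Proof. by ring. Qed.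

Lemma dC2_wcomp u phi f z : hol u -> holmap phi -> hol f -> disk z ->
  dC (dC (wcomp u phi f)) z = dC (dC u) z * f (phi z) +
    (2 * dC u z * dC phi z + u z * dC (dC phi) z) * dC f (phi z) +
    u z * dC phi z ^+ 2 * dC (dC f) (phi z).
Proof.
move=> hu hp hf zD; have hu' := hol_dC hu; have hf' := hol_dC hf.
have hp' := hol_dC hp.1; have pD := hp.2 _ zD.
have cp := hp.1 _ zD.
have H : cdiff (fun w => dC u w * f (phi w) + u w * (dC f (phi w) * dC phi w)) z
   ((dC (dC u) z * f (phi z) + dC u z * (dC f (phi z) * dC phi z)) +
   (dC u z * (dC f (phi z) * dC phi z) +
    u z * (dC (dC f) (phi z) * dC phi z * dC phi z + dC f (phi z) * dC (dC phi) z))).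
  have df := cdiff_comp cp (hf _ pD).
  have df' := cdiff_comp cp (hf' _ pD).
  exact: (cdiffD (cdiffM (hu' _ zD) df)
    (cdiffM (hu _ zD) (cdiffM df' (hp' _ zD)))).
have [d d0 hd] := disk_nbhs zD.
have E w : cabs (w - z) < d -> dC u w * f (phi w) + u w * (dC f (phi w) * dC phi w) =
    dC (wcomp u phi f) w.
  by move=> /hd wD; exact: esym (dC_wcomp hu hp hf wD).
exact: etrans (cdiff_dC (cdiff_ext d0 E H)) (leibniz2 _ _ _ _ _ _ _ _).
Qed.

Lemma cabs_disk_sq z : disk z -> 0 < 1 - cabs z ^+ 2.
Proof. by rewrite /disk /= => h; have := cabs_ge0 z; nra. Qed.

(** The passage from suprema in the extended reals to pointwise real inequalities, on which all
    later norm estimates rest. *)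
Lemma ereal_sup_disk_le (q : C -> R) (x a : R) :
  ((x%:E + ereal_sup [set (q z)%:E | z in @disk R])%E <= a%:E)%E <->
  (forall z, disk z -> x + q z <= a).
Proof.
split=> h.
  move=> z zD; rewrite -lee_fin EFinD; apply: le_trans h.
  by rewrite leeD2l//; apply: ereal_sup_ubound; exists z.
rewrite addeC -leeBrDr//; apply: ge_ereal_sup => _ [z zD <-].
by rewrite leeBrDr// addeC -EFinD lee_fin; exact: h.
Qed.

Lemma bloch_normP f (a : R) : (bloch_norm f <= a%:E)%E <->
  (forall z, disk z -> cabs (f 0) + (1 - cabs z ^+ 2) * cabs (dC f z) <= a).
Proof. rewrite dCE; exact: ereal_sup_disk_le. Qed.

Lemma zyg_normP beta f (a : R) : (zyg_norm beta f <= a%:E)%E <->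
  (forall z, disk z -> cabs (f 0) + cabs (dC f 0) +
     wgt beta z * cabs (dC (dC f) z) <= a).
Proof. rewrite dCE; exact: ereal_sup_disk_le. Qed.

Lemma wgt_ge0 beta z : 0 <= wgt beta z.
Proof. exact: powR_ge0. Qed.

Lemma ereal_sup_disk_ge0 (q : C -> R) : 0 <= q 0 ->
  (0 <= ereal_sup [set (q z)%:E | z in @disk R])%E.
Proof.
move=> q0; apply: (@le_trans _ _ (q 0)%:E); first by rewrite lee_fin.
by apply: ereal_sup_ubound; exists 0 => //; exact: disk0.
Qed.

Lemma zyg_norm_ge0 beta f : (0 <= zyg_norm beta f)%E.
Proof.
rewrite adde_ge0//; first by rewrite lee_fin addr_ge0 ?cabs_ge0.
by apply: ereal_sup_disk_ge0; rewrite mulr_ge0 ?wgt_ge0 ?cabs_ge0.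
Qed.

Lemma bloch_norm_ge0 f : (0 <= bloch_norm f)%E.
Proof.
rewrite adde_ge0//; first by rewrite lee_fin cabs_ge0.
by apply: ereal_sup_disk_ge0; rewrite mulr_ge0 ?cabs_ge0// ltW// cabs_disk_sq//; exact: disk0.
Qed.

Lemma in_zyg_fin beta f : in_zyg beta f -> exists2 a : R, 0 <= a & zyg_norm beta f = a%:E.
Proof.
move=> [_ h]; have := zyg_norm_ge0 beta f.
have : (zyg_norm beta f < +oo)%E by rewrite /zyg_norm lte_add_pinfty// ltry.
by case: (zyg_norm beta f) => [a||]// _; rewrite lee_fin => a0; exists a.
Qed.

Lemma in_zygP beta f (a : R) : hol f -> (zyg_norm beta f <= a%:E)%E -> in_zyg beta f.
Proof.
move=> /holE hf /zyg_normP h; split => //; rewrite dCE in h; apply: le_lt_trans (ltry a).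
apply: ge_ereal_sup => _ [z /h hz <-]; rewrite lee_fin; apply: le_trans hz.
by rewrite lerDr addr_ge0 ?cabs_ge0.
Qed.

Lemma in_blochP f (a : R) : hol f -> (bloch_norm f <= a%:E)%E -> in_bloch f.
Proof.
move=> /holE hf /bloch_normP h; split => //; rewrite dCE in h; apply: le_lt_trans (ltry a).
apply: ge_ereal_sup => _ [z /h hz <-]; rewrite lee_fin; apply: le_trans hz.
by rewrite lerDr cabs_ge0.
Qed.

Lemma zyg_normD beta f g (a b : R) : hol f -> hol g ->
  (zyg_norm beta f <= a%:E)%E -> (zyg_norm beta g <= b%:E)%E ->
  (zyg_norm beta (fun z => f z + g z)%R <= (a + b)%:E)%E.
Proof.
move=> hf hg /zyg_normP ha /zyg_normP hb; apply/zyg_normP => z zD.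
have := ha z zD; have := hb z zD; rewrite (dCD hf hg (disk0 R)) (dC2D hf hg zD); have w0 := wgt_ge0 beta z.
have h1 := cabsD (f 0) (g 0); have h2 := cabsD (dC f 0) (dC g 0).
have h3 : wgt beta z * cabs (dC (dC f) z + dC (dC g) z) <=
   wgt beta z * (cabs (dC (dC f) z) + cabs (dC (dC g) z)).
  by rewrite ler_wpM2l// cabsD.
by lra.
Qed.

Lemma zyg_normZ beta f (c : C) (a : R) : hol f ->
  (zyg_norm beta f <= a%:E)%E -> (zyg_norm beta (fun z => c * f z)%R <= (cabs c * a)%:E)%E.
Proof.
move=> hf /zyg_normP ha; apply/zyg_normP => z zD.
rewrite (dCZ c hf (disk0 R)) (dC2Z c hf zD) !cabsM.
apply: le_trans (ler_wpM2l (cabs_ge0 c) (ha z zD)); apply: eq_ler; ring.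
Qed.

Lemma zyg_norm_ext beta f g (a : R) : hol f -> (forall z, disk z -> f z = g z) ->
  (zyg_norm beta f <= a%:E)%E -> (zyg_norm beta g <= a%:E)%E.
Proof.
move=> hf fg /zyg_normP h; apply/zyg_normP => z zD.
rewrite -(fg 0 (disk0 R)) (eq_dC hf fg (disk0 R)) (eq_dC2 hf fg zD).
exact: h.
Qed.

Lemma zyg_normB beta f g (a b : R) : hol f -> hol g ->
  (zyg_norm beta f <= a%:E)%E -> (zyg_norm beta g <= b%:E)%E ->
  (zyg_norm beta (fun z => f z - g z)%R <= (a + b)%:E)%E.
Proof.
move=> hf hg ha hb; have := zyg_normZ (-1) hg hb; rewrite cabsN cabs1 mul1r => hb'.
apply: (zyg_norm_ext _ _ (zyg_normD hf (holZ (-1) hg) ha hb')).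
  by apply: holD => //; exact: holZ.
by move=> z _; rewrite mulN1r.
Qed.

End HoloRules.

(** * Growth of Bloch functions and of their dilations *)

Section BlochEstimates.
Variable R : realType.
Local Notation C := (R[i]).
Implicit Types (f g h : C -> C) (z w a : C).

Lemma mean_value_ineq g z w (s M : R) : hol g -> s < 1 -> cabs z <= s -> cabs w <= s ->
  (forall v, cabs v <= s -> cabs (dC g v) <= M) -> cabs (g z - g w) <= M * cabs (z - w).
Proof.
move=> hg s1 zs ws hM.
have D v : cabs v <= s -> disk v by move=> vs; rewrite /disk /= (le_lt_trans vs).
have := @mvt_cmp R (fun t => g (w + t%:C%C * (z - w)))
  (fun t => dC g (w + t%:C%C * (z - w)) * (z - w))
  (fun t => M * cabs (z - w) * t) (fun=> M * cabs (z - w)) 0 1 ler01.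
rewrite mulr1 mulr0 subr0 mul1r rmorph0 mul0r addr0.
rewrite (_ : w + (z - w) = z); last by ring.
apply=> t t1.
- apply: (rdiff_comp (q := fun s => w + s%:C%C * (z - w))); first exact: rdiff_affine.
  by apply: hg; apply: D; exact: seg_le.
- exact: is_derive_mull.
by rewrite cabsM ler_wpM2r ?cabs_ge0//; apply: hM; exact: seg_le.
Qed.

Lemma hol_affine (z0 : C) (d : R) : 0 < d -> d <= 1 - cabs z0 ->
  holmap (fun w => z0 + d%:C%C * w).
Proof.
move=> d0 hd; split.
  apply: (@cdiff_hol _ _ (fun=> 0 + d%:C%C * 1)) => w _.
  by apply: cdiffD; [exact: cdiff_cst|apply: cdiffZ; exact: cdiff_id].
move=> w; rewrite /disk /= => w1; apply: le_lt_trans (cabsD _ _) _.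
by rewrite cabsM cabsC gtr0_norm//; have := cabs_ge0 w; nra.
Qed.

(** Cauchy's inequality on the circle of centre z and radius d / 2, where d = 1 - |z|. There the
    distance to the unit circle is at least d / 2, which costs 2^n; the radius costs one more factor
    2. *)
Lemma cauchy_estimate g (A : R) n : hol g ->
  (forall z, disk z -> cabs (g z) * (1 - cabs z) ^+ n <= A) ->
  forall z, disk z -> cabs (dC g z) * (1 - cabs z) ^+ n.+1 <= 2 ^+ n.+1 * A.
Proof.
move=> hg hA z; rewrite /disk /= => z1; set d := 1 - cabs z; have d0 : 0 < d by rewrite /d; lra.
have hm := hol_affine d0 (lexx d).
have hG := hol_comp hg hm.
have E : dC (fun w => g (z + d%:C%C * w)) 0 = dC g z * d%:C%C.
  have h1 : cdiff (fun w => z + d%:C%C * w) 0 (0 + d%:C%C * 1).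
    by apply: cdiffD; [exact: cdiff_cst|apply: cdiffZ; exact: cdiff_id].
  have e0 : z + d%:C%C * 0 = z by rewrite mulr0 addr0.
  have h2 : cdiff g (z + d%:C%C * 0) (dC g z) by rewrite e0; apply: hg.
  rewrite (cdiff_dC (cdiff_comp h1 h2)); by rewrite add0r mulr1.
have hr : 0 < (2^-1 : R) by [].
have hr1 : (2^-1 : R) < 1 by lra.
have := @cauchy_cder0 R 2^-1 hr hr1 (fun w => g (z + d%:C%C * w)) (A * 2 ^+ n / d ^+ n).
rewrite -dCE E cabsM cabsC gtr0_norm// invrK => H.
have {H} : cabs (dC g z) * d <= A * 2 ^+ n / d ^+ n * 2.
  apply: H; first exact/holE.
  move=> w wr; have wD : disk w by rewrite /disk /= wr.
  have := hA _ (hm.2 _ wD); set v := z + _ => hv.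
  have vd : d / 2 <= 1 - cabs v.
    have := cabsD z (d%:C%C * w); rewrite -/v cabsM cabsC gtr0_norm// wr /d; lra.
  rewrite ler_pdivlMr ?exprn_gt0//.
  have -> : d ^+ n = 2 ^+ n * (d / 2) ^+ n by rewrite -exprMn; congr (_ ^+ _); field.
  rewrite mulrCA [A * _]mulrC ler_pM2l ?exprn_gt0//; apply: le_trans hv.
  by rewrite ler_wpM2l ?cabs_ge0// lerXn2r ?nnegrE; lra.
rewrite mulrAC ler_pdivlMr ?exprn_gt0// => h.
by move: h; rewrite (exprS d n) (exprS 2 n); lra.
Qed.

(** A bound on the Bloch seminorm in [R], without the term |f 0|, so that constants add and scale by
    plain arithmetic. *)
Definition semi_le f (b : R) := forall z, disk z -> (1 - cabs z ^+ 2) * cabs (dC f z) <= b.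

Lemma semi_le_ge0 f b : semi_le f b -> 0 <= b.
Proof.
move=> /(_ 0 (disk0 R)); apply: le_trans.
by rewrite mulr_ge0 ?cabs_ge0// ltW// cabs_disk_sq//; exact: disk0.
Qed.

Lemma bloch_dC f b : semi_le f b -> forall z, disk z -> cabs (dC f z) * (1 - cabs z) ^+ 1 <= b.
Proof.
move=> h z zD; apply: le_trans (h z zD); rewrite mulrC ler_wpM2r ?cabs_ge0//.
by have := cabs_ge0 z; move: zD; rewrite /disk /= expr1; nra.
Qed.

Lemma bloch_dC2 f b : hol f -> semi_le f b -> forall z, disk z ->
  cabs (dC (dC f) z) * (1 - cabs z) ^+ 2 <= 4 * b.
Proof.
move=> hf h z zD; have := cauchy_estimate (hol_dC hf) (bloch_dC h) zD.
by rewrite (_ : 2 ^+ 2 = 4)//; ring.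
Qed.

Lemma bloch_dC3 f b : hol f -> semi_le f b -> forall z, disk z ->
  cabs (dC (dC (dC f)) z) * (1 - cabs z) ^+ 3 <= 32 * b.
Proof.
move=> hf h z zD; have := cauchy_estimate (hol_dC (hol_dC hf)) (bloch_dC2 hf h) zD.
by rewrite mulrA (_ : 2 ^+ 3 * 4 = 32)//; ring.
Qed.

(** Integrates |f'| <= b / (1 - t |z|) along the radius to z. *)
Lemma bloch_growth f b z : hol f -> semi_le f b -> disk z ->
  cabs (f z - f 0) <= b * - ln (1 - cabs z).
Proof.
move=> hf h zD; have b0 := semi_le_ge0 h; have z0 := cabs_ge0 z.
have z1 : cabs z < 1 by [].
have := @mvt_cmp R (fun t => f (0 + t%:C%C * (z - 0))) (fun t => dC f (0 + t%:C%C * (z - 0)) * (z - 0))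
  (fun t => - b * ln (1 - cabs z * t)) (fun t => - b * ((1 - cabs z * t)^-1 * - cabs z)) 0 1 ler01.
rewrite !subr0 rmorph1 rmorph0 mul0r mul1r !add0r mulr1 mulr0 subr0 ln1 mulr0 subr0 => H.
rewrite mulrN -mulNr; apply: H => t t1.
- apply: (rdiff_comp (q := fun s => 0 + s%:C%C * z)); first exact: rdiff_affine.
  apply: hf; rewrite /disk /= add0r cabsM cabsC ger0_norm; nra.
- have t2 : 0 < 1 - cabs z * t by nra.
  have dl : is_derive (t : R^o) 1 ((fun s => 1 - cabs z * s) : R^o -> R^o) (- cabs z).
    apply/is_derive_littleo => e1 e10; exists 1 => // y _.
    by rewrite (_ : _ - _ - _ = 0) ?normr0 ?mulr_ge0// ?ltW//; ring.
  have d2 := @is_derive1_comp R (@ln R) (fun s => 1 - cabs z * s) t _ _ (is_derive1_ln t2) dl.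
  exact: (@is_deriveZ R R^o R^o (fun s => ln (1 - cabs z * s)) (- b) t 1 _ d2).
rewrite cabsM; set v := 0 + _.
have t2 : 0 < 1 - cabs z * t by nra.
have t0 : 0 <= t by case/andP: t1.
have vE : cabs v = cabs z * t by rewrite /v add0r cabsM cabsC (ger0_norm t0) mulrC.
have vD : cabs v < 1 by rewrite vE; lra.
have := bloch_dC h vD; rewrite expr1 vE -ler_pdivlMr// => hv.
have -> : - b * ((1 - cabs z * t)^-1 * - cabs z) = b / (1 - cabs z * t) * cabs z by ring.
by rewrite ler_wpM2r.
Qed.

Definition dil (r : R) f : C -> C := fun z => f (r%:C%C * z).

Lemma dil_disk (r : R) z : 0 <= r <= 1 -> disk z -> disk (r%:C%C * z).
Proof.
rewrite /disk /= cabsM cabsC => /andP[r0 r1] z1; rewrite ger0_norm//.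
by have := cabs_ge0 z; nra.
Qed.

Lemma cdiff_dil (r : R) f z : 0 <= r <= 1 -> hol f -> disk z ->
  cdiff (dil r f) z (r%:C%C * dC f (r%:C%C * z)).
Proof.
move=> r1 hf zD; have h1 : cdiff (fun w => r%:C%C * w) z (r%:C%C * 1) by apply: cdiffZ; exact: cdiff_id.
apply: cdiff_eq (cdiff_comp h1 (hf _ (dil_disk r1 zD))) _.
by rewrite mulr1 mulrC.
Qed.

Lemma hol_dil (r : R) f : 0 <= r <= 1 -> hol f -> hol (dil r f).
Proof. by move=> r1 hf; apply: cdiff_hol => z zD; exact: cdiff_dil. Qed.

Lemma dC_dil (r : R) f z : 0 <= r <= 1 -> hol f -> disk z ->
  dC (dil r f) z = r%:C%C * dC f (r%:C%C * z).
Proof. by move=> r1 hf zD; exact: cdiff_dC (cdiff_dil r1 hf zD). Qed.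

Lemma dC2_dil (r : R) f z : 0 <= r <= 1 -> hol f -> disk z ->
  dC (dC (dil r f)) z = r%:C%C * (r%:C%C * dC (dC f) (r%:C%C * z)).
Proof.
move=> r1 hf zD; have hf' := hol_dC hf.
have E w : disk w -> r%:C%C * dil r (dC f) w = dC (dil r f) w.
  by move=> wD; rewrite (dC_dil r1 hf wD).
rewrite (eq_dC (holZ r%:C%C (hol_dil r1 hf')) E zD).
by rewrite (dCZ _ (hol_dil r1 hf') zD) (dC_dil r1 hf' zD).
Qed.

(** Holds because r (1 - |z|^2) <= 1 - |r z|^2. *)
Lemma semi_le_dil (r b : R) f : 0 <= r <= 1 -> hol f -> semi_le f b -> semi_le (dil r f) b.
Proof.
move=> r1 hf h z zD; rewrite (dC_dil r1 hf zD); apply: le_trans (h _ (dil_disk r1 zD)).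
rewrite !cabsM cabsC; have /andP[r0 r2] := r1; rewrite (ger0_norm r0).
have := cabs_ge0 z; have := cabs_ge0 (dC f (r%:C%C * z)).
move: (cabs (dC f (r%:C%C * z))) zD; rewrite /disk /=; move: (cabs z) => x y x1 y0 x0.
rewrite mulrA ler_wpM2r//.
have : (r * x) ^+ 2 <= x ^+ 2 by rewrite lerXn2r ?nnegrE ?mulr_ge0// ler_piMl.
have : 0 <= 1 - x ^+ 2 by rewrite subr_ge0 expr_le1// ltW.
move: (x ^+ 2) ((r * x) ^+ 2) => X Y; nra.
Qed.

Section DilationDifference.
Variables (r b : R) (f : C -> C).
Hypotheses (r0 : 0 <= r) (r1 : r <= 1) (hf : hol f) (fb : semi_le f b).
Let h := fun z => f z - dil r f z.
Let r01 : 0 <= r <= 1. Proof. by rewrite r0. Qed.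

Lemma hol_dilB : hol h.
Proof. by apply: holB => //; exact: hol_dil. Qed.

Let dC_h z : disk z -> dC h z = dC f z - r%:C%C * dC f (r%:C%C * z).
Proof. by move=> zD; rewrite (dCB hf (hol_dil r01 hf) zD) (dC_dil r01 hf zD). Qed.

Let dC2_h z : disk z -> dC (dC h) z = dC (dC f) z - r%:C%C * (r%:C%C * dC (dC f) (r%:C%C * z)).
Proof. by move=> zD; rewrite (dC2B hf (hol_dil r01 hf) zD) (dC2_dil r01 hf zD). Qed.

Let cabs_rz z : cabs (r%:C%C * z) <= cabs z.
Proof. by rewrite cabsM cabsC ger0_norm// ler_piMl// cabs_ge0. Qed.

Lemma dilB_le_semi z : disk z -> (1 - cabs z ^+ 2) * cabs (dC h z) <= 2 * b.
Proof.
move=> zD; rewrite (dCB hf (hol_dil r01 hf) zD).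
have := fb zD; have := semi_le_dil r01 hf fb zD; have := cabs_disk_sq zD.
have := cabsB (dC f z) (dC (dil r f) z).
move: (1 - cabs z ^+ 2) => x; nra.
Qed.

Lemma dilB_growth z : disk z -> cabs (h z) <= 2 * b * - ln (1 - cabs z).
Proof.
move=> zD; have h1 := bloch_growth hf fb zD.
have := bloch_growth (hol_dil r01 hf) (semi_le_dil r01 hf fb) zD.
rewrite {2}/dil mulr0 => h2.
have -> : h z = (f z - f 0) - (dil r f z - f 0) by rewrite /h; ring.
by apply: le_trans (cabsB _ _) _; lra.
Qed.

Lemma dilB_dC2 z : disk z -> cabs (dC (dC h) z) * (1 - cabs z) ^+ 2 <= 8 * b.
Proof.
move=> zD; rewrite (dC2B hf (hol_dil r01 hf) zD).
have := bloch_dC2 hf fb zD; have := bloch_dC2 (hol_dil r01 hf) (semi_le_dil r01 hf fb) zD.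
have := cabsB (dC (dC f) z) (dC (dC (dil r f)) z).
have : 0 <= (1 - cabs z) ^+ 2 by rewrite sqr_ge0.
move: ((1 - cabs z) ^+ 2) => x; nra.
Qed.

Section Compact.
Variables (s : R) (z : C).
Hypotheses (s1 : s < 1) (zs : cabs z <= s).

Let rzs : cabs (r%:C%C * z) <= s.
Proof. exact: le_trans (cabs_rz z) zs. Qed.

Let small (w : C) : cabs w <= s -> disk w /\ (1 - s) <= 1 - cabs w.
Proof. by move=> ws; split; [rewrite /disk /= (le_lt_trans ws)|rewrite lerD2l lerN2]. Qed.

Let zrz : cabs (z - r%:C%C * z) <= 1 - r.
Proof.
have -> : z - r%:C%C * z = (1 - r)%:C%C * z by rewrite rmorphB /= rmorph1; ring.
rewrite cabsM cabsC ger0_norm; last by move: r1; lra.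
by rewrite ler_piMr ?subr_ge0//; move: s1 zs; lra.
Qed.

Let est n g (A : R) : 0 <= A -> (forall w, disk w -> cabs (g w) * (1 - cabs w) ^+ n <= A) ->
  forall w, cabs w <= s -> cabs (g w) <= A / (1 - s) ^+ n.
Proof.
move=> A0 hA w ws; have [wD h1] := small ws; have s0 : 0 < 1 - s by move: s1; lra.
rewrite ler_pdivlMr ?exprn_gt0//; apply: le_trans (hA w wD).
by rewrite ler_wpM2l ?cabs_ge0// lerXn2r ?nnegrE//; lra.
Qed.

Let b0 : 0 <= b. Proof. exact: semi_le_ge0 fb. Qed.
Let s0 : 0 < 1 - s. Proof. by move: s1; lra. Qed.

Let e1 := @est 1 _ _ b0 (bloch_dC fb).
Let b4 : 0 <= 4 * b. Proof. by rewrite mulr_ge0. Qed.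
Let b32 : 0 <= 32 * b. Proof. by rewrite mulr_ge0. Qed.
Let e2 := @est 2 _ _ b4 (bloch_dC2 hf fb).
Let e3 := @est 3 _ _ b32 (bloch_dC3 hf fb).

Let V := (1 - s) ^- 1.
Let inv_le n m : (n <= m)%N -> ((1 - s) ^+ n)^-1 <= ((1 - s) ^+ m)^-1.
Proof.
move=> nm; rewrite lef_pV2 ?posrE ?exprn_gt0//.
rewrite ler_wiXn2l//; first exact: ltW.
by rewrite lerBlDr lerDl; apply: le_trans zs; exact: cabs_ge0.
Qed.

Let unit_r : 0 <= 1 - r. Proof. by move: r1; lra. Qed.

(** One bound serves the function and its first two derivatives. The constant is dictated by the
    second: 32 from the third derivative of f and 8 from 1 - r^2 <= 2 (1 - r) times |f''| <= 4 b /
    (1 - s)^2. *)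
Lemma dilB_small0 : cabs (h z) <= (1 - r) * (40 * b / (1 - s) ^+ 3).
Proof.
have := @mean_value_ineq f z (r%:C%C * z) s _ hf s1 zs rzs e1.
rewrite -/(dil r f z) -/(h z) => H; apply: le_trans H _.
have h1 := @inv_le 1 3 isT; have := zrz; have := cabs_ge0 (z - r%:C%C * z).
have bb := b0; have uu := unit_r.
have h2 : 0 <= ((1 - s) ^+ 1)^-1 by rewrite invr_ge0 exprn_ge0// ltW.
move: h1 h2; move: (((1 - s) ^+ 1)^-1) (((1 - s) ^+ 3)^-1) => x y xy x0 w0 w1.
rewrite [leRHS]mulrC; apply: ler_pM => //; first by rewrite mulr_ge0.
by apply: ler_pM => //; lra.
Qed.

Lemma dilB_small1 : cabs (dC h z) <= (1 - r) * (40 * b / (1 - s) ^+ 3).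
Proof.
have [zD _] := small zs; rewrite (dC_h zD).
have -> : dC f z - r%:C%C * dC f (r%:C%C * z) =
   (dC f z - dC f (r%:C%C * z)) + (1 - r)%:C%C * dC f (r%:C%C * z) by rewrite rmorphB /= rmorph1; ring.
apply: le_trans (cabsD _ _) _; rewrite cabsM cabsC (ger0_norm unit_r).
have := @mean_value_ineq (dC f) z (r%:C%C * z) s _ (hol_dC hf) s1 zs rzs e2.
have := e1 rzs; have h1 := @inv_le 1 3 isT; have h2 := @inv_le 2 3 isT; have := zrz; have := cabs_ge0 (z - r%:C%C * z).
have bb := b0; have uu := unit_r.
have p3 : 0 <= ((1 - s) ^+ 3)^-1 by rewrite invr_ge0 exprn_ge0// ltW.
move: h1 h2 p3; move: (((1 - s) ^+ 1)^-1) (((1 - s) ^+ 2)^-1) (((1 - s) ^+ 3)^-1) => x y t xt yt t0 w0 w1 h1 h2.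
have y1 : 4 * b * y <= 4 * b * t by rewrite ler_wpM2l ?mulr_ge0.
have x1 : b * x <= b * t by rewrite ler_wpM2l.
have h3 : 4 * b * y * cabs (z - r%:C%C * z) <= 4 * b * t * (1 - r).
  apply: le_trans (_ : 4 * b * t * cabs (z - r%:C%C * z) <= _); first by rewrite ler_wpM2r.
  by rewrite ler_wpM2l ?mulr_ge0.
have h4 : (1 - r) * cabs (dC f (r%:C%C * z)) <= (1 - r) * (b * t).
  by rewrite ler_wpM2l//; lra.
have : 0 <= (1 - r) * (b * t).
  by rewrite !mulr_ge0.
by lra.
Qed.

Lemma dilB_small2 : cabs (dC (dC h) z) <= (1 - r) * (40 * b / (1 - s) ^+ 3).
Proof.
have [zD _] := small zs; rewrite (dC2_h zD).
have -> : dC (dC f) z - r%:C%C * (r%:C%C * dC (dC f) (r%:C%C * z)) =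
   (dC (dC f) z - dC (dC f) (r%:C%C * z)) + ((1 - r) * (1 + r))%:C%C * dC (dC f) (r%:C%C * z).
  by rewrite rmorphM rmorphB rmorphD /= rmorph1; ring.
apply: le_trans (cabsD _ _) _; rewrite cabsM cabsC ger0_norm; last first.
  by rewrite mulr_ge0 ?unit_r// addr_ge0.
have := @mean_value_ineq (dC (dC f)) z (r%:C%C * z) s _ (hol_dC (hol_dC hf)) s1 zs rzs e3.
have := e2 rzs; have h2 := @inv_le 2 3 isT; have := zrz; have := cabs_ge0 (z - r%:C%C * z).
have bb := b0; have uu := unit_r; have rr := r0; have rr1 := r1.
move: h2; have q := e3 zs; move: q; move: (((1 - s) ^+ 2)^-1) (((1 - s) ^+ 3)^-1) => y t q yt w0 w1 h1 h2.
have t0 : 0 <= 32 * b * t by apply: le_trans q; exact: cabs_ge0.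
have y1 : 4 * b * y <= 4 * b * t by rewrite ler_wpM2l ?mulr_ge0.
have h3 : 32 * b * t * cabs (z - r%:C%C * z) <= 32 * b * t * (1 - r) by rewrite ler_wpM2l.
have h4 : (1 - r) * (1 + r) * cabs (dC (dC f) (r%:C%C * z)) <= (1 - r) * 2 * (4 * b * t).
  apply: ler_pM; rewrite ?cabs_ge0 ?mulr_ge0//; [lra| |lra].
  by rewrite ler_wpM2l//; lra.
by lra.
Qed.

End Compact.
End DilationDifference.

End BlochEstimates.

(** * The upper bound *)

Section FiniteRank.
Variable R : realType.
Local Notation C := (R[i]).
Implicit Types (f g h : C -> C) (z w a : C).

Section Truncation.
Variable r : R.
Hypotheses (r0 : 0 < r) (r1 : r < 1).
Let R1 : R := (1 + r) / 2.
Let R10 : 0 < R1. Proof. by rewrite /R1; move: r0; lra. Qed.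
Let R11 : R1 < 1. Proof. by rewrite /R1; move: r1; lra. Qed.
Let rR1 : r < R1. Proof. by rewrite /R1; move: r1; lra. Qed.
Let rle : 0 <= r <= 1. Proof. by apply/andP; split; apply: ltW. Qed.

(** The k-th Taylor coefficient of f', as a Cauchy integral over a circle of radius strictly between
    r and 1: points r z lie inside it with a uniform margin. *)
Definition taylor_coef k f : C := cmean ((1 + r) / 2) (fun w => dC f w * (w ^+ k)^-1).

(** The expansion of the derivative of the dilated function is integrated term by term, since the
    Bloch seminorm only sees derivatives. *)
Definition trunc_fun k f : C :=
  if k is k'.+1 then taylor_coef k' f * (r%:C%C ^+ k / k%:R) else f 0.

Definition trunc N f : C -> C := fun z => \sum_(k < N.+1) trunc_fun k f * z ^+ k.

Lemma hol_expn n : hol (fun z : C => z ^+ n).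
Proof. by apply: (@cdiff_hol _ _ (fun z => n%:R * z ^+ n.-1 * 1)) => z _; exact: (cdiffX n (cdiff_id z)). Qed.

Lemma dC_expn n z : dC (fun z : C => z ^+ n) z = n%:R * z ^+ n.-1.
Proof. by rewrite (cdiff_dC (cdiffX n (cdiff_id z))) mulr1. Qed.

Lemma hol_trunc N f : hol (trunc N f).
Proof.
apply: (@hol_sum R N.+1 (fun k z => trunc_fun k f * z ^+ k)) => k _.
by apply: holZ; exact: hol_expn.
Qed.

Lemma dC_trunc N f z : dC (trunc N f) z =
  r%:C%C * \sum_(k < N) taylor_coef k f * (r%:C%C * z) ^+ k.
Proof.
have H := @cdiff_sum R N.+1 (fun k z => trunc_fun k f * z ^+ k)
  (fun k => trunc_fun k f * (k%:R * z ^+ k.-1 * 1)) z.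
rewrite (cdiff_dC (H _)); last first.
  by move=> k _; apply: cdiffZ; exact: (cdiffX k (cdiff_id z)).
rewrite big_ord_recl /= !mul0r mulr0 add0r mulr_sumr; apply: eq_bigr => k _.
rewrite /bump /= add1n /= exprS exprMn; field.
by rewrite addrC natr1 pnatr_eq0.
Qed.

Let dC_circ f b : hol f -> semi_le f b -> forall w, cabs w = R1 -> cabs (dC f w) <= b / (1 - R1).
Proof.
move=> hf fb w wr; have wD : disk w by rewrite /disk /= wr; exact: R11.
have := bloch_dC fb wD; rewrite expr1 wr ler_pdivlMr//; by move: R11; lra.
Qed.

Let ccont_dC f n : hol f -> ccont_circ R1 (fun w => dC f w * (w ^+ n)^-1).
Proof.
move=> hf w wr; apply: ccontM; last exact: (ccont_circV R10 n wr).
by apply: ccont_cdiff; apply: (hol_dC hf); rewrite /disk /= wr; exact: R11.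
Qed.

Lemma taylor_coef_bound k f b : hol f -> semi_le f b ->
  cabs (taylor_coef k f) <= b * ((1 - R1)^-1 * (R1 ^+ k)^-1).
Proof.
move=> hf fb; apply: (cmean_bound R10 (ccont_dC k hf)) => w wr.
rewrite cabsM cabsV cabsX wr mulrA ler_wpM2r ?invr_ge0 ?exprn_ge0 ?(ltW R10)//.
exact: dC_circ.
Qed.

Lemma taylor_coefD k f g a : hol f -> hol g ->
  taylor_coef k (fun z => f z + a * g z) = taylor_coef k f + a * taylor_coef k g.
Proof.
move=> hf hg; have cf := ccont_dC k hf; have cg := ccont_dC k hg.
have cag := ccont_circZ a cg.
rewrite /taylor_coef -/R1 -(cmeanZ R10 a cg) -(cmeanD R10 cf cag).
apply: (cmean_ext R10) => w wr.
have wD : disk w by rewrite /disk /= wr; exact: R11.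
by rewrite (dCD hf (holZ a hg) wD) (dCZ a hg wD); ring.
Qed.

Lemma taylor_coef_ext k f g : hol f -> (forall z, disk z -> f z = g z) ->
  taylor_coef k f = taylor_coef k g.
Proof.
move=> hf fg; apply: (cmean_ext R10) => w wr.
by rewrite (eq_dC hf fg)// /disk /= wr; exact: R11.
Qed.

Lemma dil_trunc0 N f : dil r f 0 - trunc N f 0 = 0.
Proof.
rewrite /dil /trunc mulr0 big_ord_recl /= expr0 mulr1 big1 ?addr0 ?subrr// => k _.
by rewrite /bump /= add1n expr0n mulr0.
Qed.

Lemma hol_dil_trunc N f : hol f -> hol (fun z => dil r f z - trunc N f z).
Proof. by move=> hf; apply: holB; [exact: hol_dil|exact: hol_trunc]. Qed.

(** The degree is chosen before f: this uniformity turns pointwise approximation into approximation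
    in operator norm. *)
Lemma trunc_approx (e : R) : 0 < e -> exists N, forall f b, hol f -> semi_le f b ->
  semi_le (fun z => dil r f z - trunc N f z) (b * e).
Proof.
move=> e0; have p1 : 0 < 1 - R1 by move: R11; lra.
have p2 : 0 < R1 - r by move: rR1; lra.
(* The constant of [cauchy_expansion] for |r z| <= r and seminorm 1; it is independent of f, hence
   so is N. *)
pose A : R := (1 - R1)^-1 * (R1 / (R1 - r)).
have A0 : 0 < A.
  by apply: mulr_gt0; [rewrite invr_gt0|apply: divr_gt0; [exact: R10|]].
have [||N hN] := @expn_small R (r / R1) (e / A).
- apply/andP; split; first by rewrite divr_ge0// ltW.
  by rewrite ltr_pdivrMr ?mul1r.
- by rewrite divr_gt0.
exists N => f b hf fb z zD; have b0 := semi_le_ge0 fb.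
have hd := hol_dil rle hf.
rewrite (dCB hd (@hol_trunc N f) zD) (dC_dil rle hf zD) dC_trunc -mulrBr.
have rzr : cabs (r%:C%C * z) <= r.
  by rewrite cabsM cabsC (ger0_norm (ltW r0)) ler_piMr ?(ltW r0)//; exact: ltW.
have rz : cabs (r%:C%C * z) < R1 by exact: le_lt_trans rzr rR1.
have := @cauchy_expansion R R1 R10 R11 (dC f) (r%:C%C * z) N (b / (1 - R1)) _ rz (dC_circ hf fb).
move=> H; have {}H := H (iffRL (holE _) (hol_dC hf)).
apply: le_trans (_ : 1 * (1 * (b * e)) <= _); last by rewrite !mul1r.
have zz := cabs_disk_sq zD; have z2 : 0 <= cabs z ^+ 2 by rewrite sqr_ge0.
apply: ler_pM; rewrite ?cabs_ge0 ?(ltW zz)//; first lra.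
rewrite cabsM; apply: ler_pM; rewrite ?cabs_ge0//.
  by rewrite cabsC ger0_norm ?(ltW r0)// ltW.
apply: le_trans H _.
rewrite -mulrA ler_wpM2l//.
apply: le_trans (_ : (1 - R1)^-1 * ((r / R1) ^+ N * (R1 / (R1 - r))) <= _).
  rewrite ler_wpM2l ?invr_ge0 ?(ltW p1)//; apply: ler_pM.
  - by rewrite exprn_ge0// divr_ge0 ?cabs_ge0 ?(ltW R10).
  - by rewrite divr_ge0 ?(ltW R10)//; move: rz; lra.
  - apply: lerXn2r.
    + by rewrite nnegrE divr_ge0 ?cabs_ge0 ?(ltW R10).
    + by rewrite nnegrE divr_ge0 ?(ltW r0) ?(ltW R10).
    + by apply: ler_wpM2r rzr; rewrite invr_ge0 (ltW R10).
  - rewrite ler_pM2l// lef_pV2 ?posrE//; first by rewrite lerD2l lerN2.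
    by move: rz; lra.
rewrite mulrCA -/A -ler_pdivlMr//.
Qed.

End Truncation.

Lemma ereal_cvg0P (v : nat -> \bar R) : (forall n, (0 <= v n)%E) ->
  (v @ \oo --> 0%E) <-> (forall e : R, 0 < e -> exists N : nat, forall n, (N <= n)%N -> (v n <= e%:E)%E).
Proof.
move=> v0; split.
- move=> /fine_cvgP[[N1 _ h1] /cvgrPdist_le h2] e /h2[N2 _ {}h2].
  exists (maxn N1 N2) => n; rewrite geq_max => /andP[n1 n2].
  have := h2 n n2; rewrite /= sub0r normrN => h3.
  rewrite -(fineK (h1 n n1)) lee_fin; apply: le_trans h3; exact: ler_norm.
- move=> h; apply/fine_cvgP; split.
    have [N hN] := h 1 ltr01; exists N => // n /= /hN h1.
    by rewrite ge0_fin_numE//; apply: le_lt_trans h1 (ltry _).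
  apply/cvgrPdist_le => e /h[N hN]; exists N => // n /= /hN h1.
  rewrite sub0r normrN ger0_norm ?fine_ge0//.
  by rewrite -lee_fin fineK// ge0_fin_numE//; apply: le_lt_trans h1 (ltry _).
Qed.

Variable beta : R.

Lemma zyg_norm0 : zyg_norm beta (fun=> 0 : C) = 0%E.
Proof.
apply/eqP; rewrite eq_le zyg_norm_ge0 andbT; apply/zyg_normP => z zD.
have E w : dC (fun=> 0 : C) w = 0 by exact: cdiff_dC (cdiff_cst 0 w).
have E2 : dC (dC (fun=> 0 : C)) z = 0.
  have := eq_dC (hol_cst 0) (fun w _ => esym (E w)) zD => ->; exact: E.
by rewrite E2 E !cabs0 mulr0 !addr0.
Qed.

Lemma in_bloch_hol f : in_bloch f -> hol f.
Proof. by case=> /holE. Qed.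

Lemma in_zyg_hol f : in_zyg beta f -> hol f.
Proof. by case=> /holE. Qed.

Lemma in_zygD f g : in_zyg beta f -> in_zyg beta g -> in_zyg beta (fun z => f z + g z).
Proof.
move=> hf hg; have [a _ fa] := in_zyg_fin hf; have [b _ gb] := in_zyg_fin hg.
have Hf := in_zyg_hol hf; have Hg := in_zyg_hol hg.
apply: (@in_zygP _ _ _ (a + b)); first exact: holD.
by apply: zyg_normD => //; rewrite ?fa ?gb.
Qed.

Lemma in_zygZ (c : C) f : in_zyg beta f -> in_zyg beta (fun z => c * f z).
Proof.
move=> hf; have [a _ fa] := in_zyg_fin hf; have Hf := in_zyg_hol hf.
apply: (@in_zygP _ _ _ (cabs c * a)); first exact: holZ.
by apply: zyg_normZ => //; rewrite fa.
Qed.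

Lemma in_zyg0 : in_zyg beta (fun=> 0).
Proof. by apply: (@in_zygP _ _ _ 0); [exact: hol_cst|rewrite zyg_norm0]. Qed.

Lemma compact_op0 : compact_op beta (fun (_ : C -> C) (_ : C) => 0).
Proof.
split.
- by [].
- by move=> f g a _ _ z _; rewrite mulr0 addr0.
- by move=> f _; exact: in_zyg0.
- move=> fs _; exists id; split => //; exists (fun=> 0); split; first exact: in_zyg0.
  apply/ereal_cvg0P; first by move=> n; exact: zyg_norm_ge0.
  move=> e e0; exists 0%N => n _.
  rewrite (_ : (fun _ : C => _) = fun=> 0); last by apply/funext => z; rewrite subrr.
  by rewrite zyg_norm0 lee_fin ltW.
Qed.

(** The values of a bounded functional on the unit ball have a convergent subsequence, and the image
    is a fixed function times these values. *)
Lemma compact_op_rank1 (l : (C -> C) -> C) (e : C -> C) (L : R) : in_zyg beta e ->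
  (forall f g, in_bloch f -> in_bloch g -> (forall z, disk z -> f z = g z) -> l f = l g) ->
  (forall f g a, in_bloch f -> in_bloch g -> l (fun w => f w + a * g w) = l f + a * l g) ->
  (forall f, in_bloch f -> (bloch_norm f <= 1)%E -> cabs (l f) <= L) ->
  compact_op beta (fun f z => l f * e z).
Proof.
move=> he lw ll lL; split.
- by move=> f g hf hg fg z _; rewrite (lw f g).
- by move=> f g a hf hg z _; rewrite ll//; ring.
- by move=> f _; exact: in_zygZ.
- move=> fs hfs; have [n|s [hs [c hc]]] := @bw_complex R (fun n => l (fs n)) L.
    by have [h1 h2] := hfs n; exact: lL.
  exists s; split => //; exists (fun z => c * e z); split; first exact: in_zygZ.
  apply/ereal_cvg0P; first by move=> n; exact: zyg_norm_ge0.
  have [a a0 ea] := in_zyg_fin he; have He := in_zyg_hol he.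
  move=> d d0; have d1 : 0 < d / (a + 1) by apply: divr_gt0 => //; lra.
  have [N hN] := hc _ d1; exists N => n /hN h1.
  rewrite (_ : (fun z => l (fs (s n)) * e z - c * e z) = (fun z => (l (fs (s n)) - c) * e z)); last first.
    by apply/funext => z; ring.
  have ea' : (zyg_norm beta e <= a%:E)%E by rewrite ea.
  apply: le_trans (zyg_normZ (l (fs (s n)) - c) He ea') _.
  rewrite lee_fin; move: h1 => /=; rewrite ler_pdivlMr; last lra.
  by move=> h1; have := cabs_ge0 (l (fs (s n)) - c); lra.
Qed.

Lemma compact_opD K1 K2 : compact_op beta K1 -> compact_op beta K2 ->
  compact_op beta (fun f z => K1 f z + K2 f z).
Proof.
move=> [w1 l1 z1 c1] [w2 l2 z2 c2]; split.
- by move=> f g hf hg fg z zD; rewrite (w1 f g)// (w2 f g).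
- by move=> f g a hf hg z zD; rewrite l1// l2//; ring.
- by move=> f hf; apply: in_zygD; [exact: z1|exact: z2].
- move=> fs hfs; have [s1 [hs1 [g1 [hg1 cv1]]]] := c1 fs hfs.
  have [n|s2 [hs2 [g2 [hg2 cv2]]]] := c2 (fun n => fs (s1 n)); first exact: hfs.
  exists (s1 \o s2); split; first by move=> n /=; apply: subseq_lt.
  exists (fun z => g1 z + g2 z); split; first exact: in_zygD.
  have p1 n := zyg_norm_ge0 beta (fun z => K1 (fs (s1 n)) z - g1 z).
  have p2 n := zyg_norm_ge0 beta (fun z => K2 (fs (s1 (s2 n))) z - g2 z).
  apply/ereal_cvg0P; first by move=> n; exact: zyg_norm_ge0.
  move=> e e0; have e2 : 0 < e / 2 by lra.
  have /(_ _ e2)[N1 h1] := iffLR (ereal_cvg0P p1) cv1.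
  have /(_ _ e2)[N2 h2] := iffLR (ereal_cvg0P p2) cv2.
  exists (maxn N1 N2) => n; rewrite geq_max => /andP[n1 /h2 {}h2].
  have {}h1 := h1 (s2 n) (leq_trans n1 (subseq_ge hs2 n)).
  have [hb _] := hfs (s1 (s2 n)).
  have H1 := holB (in_zyg_hol (z1 _ hb)) (in_zyg_hol hg1).
  have H2 := holB (in_zyg_hol (z2 _ hb)) (in_zyg_hol hg2).
  rewrite (_ : (fun z : C => _) = (fun z => (K1 (fs (s1 (s2 n))) z - g1 z) + (K2 (fs (s1 (s2 n))) z - g2 z))); last first.
    by apply/funext => z /=; ring.
  have := zyg_normD H1 H2 h1 h2; by rewrite (_ : e / 2 + e / 2 = e)//; field.
Qed.

End FiniteRank.

(** * Bounded coefficients and the estimate of the essential norm from above *)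

Section UpperBound.
Variable R : realType.
Local Notation C := (R[i]).
Implicit Types (f g h u phi : C -> C) (z w a : C).

Definition coefU u : C -> C := dC (dC u).
Definition coefV u phi : C -> C := fun z => 2 * dC u z * dC phi z + u z * dC (dC phi) z.
Definition coefW u phi : C -> C := fun z => u z * dC phi z ^+ 2.

Variables (beta : R) (u phi : C -> C).
Hypotheses (hu : hol u) (hphi : holmap phi) (hb : bounded_op beta (wcomp u phi)).

Definition wabs (g : C -> C) z := wgt beta z * cabs (g z).

Lemma wabs_ge0 g z : 0 <= wabs g z.
Proof. by rewrite mulr_ge0 ?wgt_ge0 ?cabs_ge0. Qed.

Lemma semi_le_bloch f b : hol f -> semi_le f b ->
  in_bloch f /\ (bloch_norm f <= (cabs (f 0) + b)%:E)%E.
Proof.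
move=> hf fb; have H : (bloch_norm f <= (cabs (f 0) + b)%:E)%E.
  by apply/bloch_normP => z zD; rewrite lerD2l; exact: fb.
by split => //; exact: in_blochP H.
Qed.

Lemma bloch_semi_le f b : (bloch_norm f <= b%:E)%E -> semi_le f b /\ cabs (f 0) <= b.
Proof.
move=> /bloch_normP h; split.
  by move=> z /h; have := cabs_ge0 (f 0); lra.
have := h 0 (disk0 R); have : 0 <= (1 - cabs (0 : C) ^+ 2) * cabs (dC f 0).
  by rewrite mulr_ge0 ?cabs_ge0// ltW// cabs_disk_sq//; exact: disk0.
by lra.
Qed.

Lemma wcomp_bound : exists2 M : R, 0 <= M & forall f b, hol f -> semi_le f b ->
  (zyg_norm beta (wcomp u phi f) <= (M * (cabs (f 0) + b))%:E)%E.
Proof.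
case: hb => _ _ _ [M hM]; exists (Num.max 0 M); first by rewrite le_max lexx.
move=> f b hf fb; have [h1 h2] := semi_le_bloch hf fb.
apply: le_trans (hM f h1) _; rewrite EFinM.
apply: le_trans (_ : (Num.max 0 M)%:E * bloch_norm f <= _)%E.
  by apply: lee_wpmul2r; [exact: bloch_norm_ge0|rewrite lee_fin le_max lexx orbT].
by apply: lee_wpmul2l => //; rewrite lee_fin le_max lexx.
Qed.

Lemma zyg_wgt_le g (M : R) : (zyg_norm beta g <= M%:E)%E ->
  forall z, disk z -> wgt beta z * cabs (dC (dC g) z) <= M.
Proof.
move=> /zyg_normP h z /h; have := cabs_ge0 (g 0); have := cabs_ge0 (dC g 0); lra.
Qed.

Lemma dC2_wcompE f z : hol f -> disk z -> dC (dC (wcomp u phi f)) z =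
  coefU u z * f (phi z) + coefV u phi z * dC f (phi z) + coefW u phi z * dC (dC f) (phi z).
Proof. by move=> hf zD; rewrite (dC2_wcomp hu hphi hf zD). Qed.

Lemma disk_le1 z : disk z -> cabs z <= 1.
Proof. by rewrite /disk /= => /ltW. Qed.

Lemma semi_le_expn n : semi_le (fun z : C => z ^+ n) n%:R.
Proof.
move=> z zD; rewrite dC_expn cabsM (cabs_nat R) cabsX.
have h1 : cabs z ^+ n.-1 <= 1 by rewrite exprn_ile1 ?cabs_ge0 ?disk_le1.
have h2 : 0 <= cabs z ^+ n.-1 by rewrite exprn_ge0 ?cabs_ge0.
have h3 := cabs_disk_sq zD; have h4 : 0 <= cabs z ^+ 2 by rewrite sqr_ge0.
rewrite mulrCA ler_piMr// mulr_ile1//; last lra.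
exact: ltW.
Qed.

Lemma dC2_expn n z : dC (dC (fun z : C => z ^+ n)) z = n%:R * (n.-1%:R * z ^+ n.-2).
Proof.
rewrite (_ : dC (fun z : C => z ^+ n) = (fun z => n%:R * z ^+ n.-1)).
  by rewrite (cdiff_dC (cdiffZ _ (cdiffX n.-1 (cdiff_id z)))) mulr1.
by apply/funext => w; exact: dC_expn.
Qed.

(** The functions 1, z and z^2 give bounds for U, then V, then W: M, 2 M and 7 M / 2, rounded up to
    10 M. *)
Lemma coef_bounded : exists2 B : R, 0 <= B & forall z, disk z ->
  [/\ wabs (coefU u) z <= B, wabs (coefV u phi) z <= B & wabs (coefW u phi) z <= B].
Proof.
have [M M0 hM] := wcomp_bound; exists (10 * M); first by rewrite mulr_ge0.
move=> z zD; have w0 := wgt_ge0 beta z; have pz := disk_le1 (hphi.2 _ zD).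
have e n := zyg_wgt_le (hM _ _ (@hol_expn R n) (semi_le_expn n)) zD.
have := e 0%N; have := e 1%N; have := e 2%N.
rewrite !(dC2_wcompE (@hol_expn R _) zD) !dC_expn !dC2_expn /=.
rewrite !expr0n !expr0 !expr1 /= !mul0r !mulr0 !mulr1 !addr0 ?mul1r cabs0 cabs1.
rewrite /wabs; move: (coefU u z) (coefV u phi z) (coefW u phi z) => x y t.
move: (phi z) pz => p pz h2 h1 h0.
have a1 : cabs y <= cabs (x * p + y) + cabs x.
  have := cabsB (x * p + y) (x * p); rewrite addrAC subrr add0r => /le_trans; apply.
  by rewrite lerD2l cabsM ler_piMr ?cabs_ge0.
have a2 : 2 * cabs t <= cabs (x * p ^+ 2 + y * (2 * p) + t * 2) + (cabs x + 2 * cabs y).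
  have := cabsB (x * p ^+ 2 + y * (2 * p) + t * 2) (x * p ^+ 2 + y * (2 * p)).
  rewrite addrAC subrr add0r (cabsM t) (cabs_nat R 2) (mulrC (cabs t)) => /le_trans; apply.
  rewrite lerD2l; apply: le_trans (cabsD _ _) _; apply: lerD.
    by rewrite cabsM ler_piMr ?cabs_ge0// cabsX exprn_ile1 ?cabs_ge0.
  rewrite !cabsM (cabs_nat R 2) mulrCA ler_pM2l// ler_piMr ?cabs_ge0//.
have b1 : wgt beta z * cabs y <= wgt beta z * (cabs (x * p + y) + cabs x) by rewrite ler_wpM2l.
have b2 := ler_wpM2l w0 a2.
split; lra.
Qed.

Lemma compact_op_sum n (l : nat -> (C -> C) -> C) (e : nat -> C -> C) :
  (forall k, compact_op beta (fun f z => l k f * e k z)) ->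
  compact_op beta (fun f z => \sum_(k < n) l k f * e k z).
Proof.
move=> h; elim: n => [|n ih].
  rewrite (_ : (fun _ _ => _) = (fun (_ : C -> C) (_ : C) => 0)); first exact: compact_op0.
  by apply/funext => f; apply/funext => z; rewrite big_ord0.
rewrite (_ : (fun _ _ => _) = (fun f z => (\sum_(k < n) l k f * e k z) + l n f * e n z)).
  exact: (compact_opD ih (h n)).
by apply/funext => f; apply/funext => z; rewrite big_ord_recr.
Qed.

(** A finite sum of rank-one operators with ranges spanned by u phi^k, the images of the Bloch
    functions z^k. *)
Lemma compact_wcomp_trunc (r : R) N : 0 < r -> r < 1 ->
  compact_op beta (fun f => wcomp u phi (trunc r N f)).
Proof.
move=> r0 r1; rewrite (_ : (fun f => _) = (fun f z => \sum_(k < N.+1) trunc_fun r k f * (u z * phi z ^+ k))).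
  apply: (@compact_op_sum _ (trunc_fun r) (fun k z => u z * phi z ^+ k)) => k.
  have he : in_zyg beta (fun z => u z * phi z ^+ k).
    have [hk _] := semi_le_bloch (@hol_expn R k) (@semi_le_expn k).
    by case: hb => _ _ /(_ _ hk).
  case: k he => [|k] he.
    apply: (@compact_op_rank1 R beta (fun f => f 0) _ 1) => //.
      by move=> f g _ _; apply; exact: disk0.
    by move=> f _ /bloch_semi_le[].
  apply: (@compact_op_rank1 R beta (trunc_fun r k.+1) _
    ((1 * ((1 - (1 + r) / 2)^-1 * (((1 + r) / 2) ^+ k)^-1)) * cabs (r%:C%C ^+ k.+1 / k.+1%:R))) => //.
  - by move=> f g /in_bloch_hol hf _ fg; rewrite /= (@taylor_coef_ext _ _ r0 r1 _ _ _ hf fg).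
  - move=> f g a /in_bloch_hol hf /in_bloch_hol hg /=.
    by rewrite (@taylor_coefD _ _ r0 r1 _ _ _ _ hf hg); ring.
  - move=> f /in_bloch_hol hf /bloch_semi_le[fb _]; rewrite /= cabsM.
    rewrite ler_wpM2r ?cabs_ge0//; exact: (@taylor_coef_bound _ _ r0 r1 _ _ _ hf fb).
apply/funext => f; apply/funext => z; rewrite /wcomp /trunc mulr_sumr.
by apply: eq_bigr => k _; ring.
Qed.

Let weighted_triangle (k : R) (x y t p q s : C) : 0 <= k ->
  k * cabs (x * p + y * q + t * s) <=
  k * cabs x * cabs p + k * cabs y * cabs q + k * cabs t * cabs s.
Proof.
move=> k0; rewrite -!mulrA -!mulrDr ler_wpM2l// -!cabsM.
by apply: le_trans (cabsD _ _) _; rewrite lerD2r cabsD.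
Qed.

(** Near the circle the terms in U, V and W give 2 m, 2 m and 8 m; the values at 0 add m and the
    truncation another m, 14 m in all. *)
Lemma essnorm_upper (s0 m : R) : 0 < m -> s0 < 1 ->
  (forall z, disk z -> s0 < cabs (phi z) ->
    [/\ wabs (coefU u) z * - ln (1 - cabs (phi z)) <= m,
        wabs (coefV u phi) z <= m * (1 - cabs (phi z)) &
        wabs (coefW u phi) z <= m * (1 - cabs (phi z)) ^+ 2]) ->
  (essnorm beta (wcomp u phi) <= (14 * m)%:E)%E.
Proof.
move=> m0 s01 hm.
have [B B0 hB] := coef_bounded; have [M M0 hM] := wcomp_bound.
have p0 := hphi.2 _ (disk0 R).
(* Including |phi 0| puts the value and the derivative at 0 into the compact part. *)
pose s := Num.max s0 (cabs (phi 0)); have s1 : s < 1 by rewrite gt_max s01.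
pose Q : R := cabs (u 0) + cabs (dC u 0) + cabs (u 0 * dC phi 0) + 3 * B.
have Q0 : 0 <= Q by rewrite !addr_ge0 ?cabs_ge0 ?mulr_ge0.
have ds : 0 < 1 - s by lra.
have ds3 : 0 < (1 - s) ^+ 3 by rewrite exprn_gt0.
(* This is 1 - r, so small that the bound of [dilB_small0] to [dilB_small2] times Q stays below m;
   the entry 1/2 keeps r positive. *)
pose k := Num.min (2^-1) (m * (1 - s) ^+ 3 / (40 * (Q + 1))).
have k0 : 0 < k by rewrite lt_min; apply/andP; split => //; rewrite divr_gt0 ?mulr_gt0//; lra.
have k1 : k <= 2^-1 by rewrite ge_min lexx.
have k2 : k <= m * (1 - s) ^+ 3 / (40 * (Q + 1)) by rewrite ge_min lexx orbT.
pose r := 1 - k; have r0 : 0 < r by rewrite /r; lra.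
have r1 : r < 1 by rewrite /r; lra.
have kap : (1 - r) * (40 * 1 / (1 - s) ^+ 3) * Q <= m.
  have -> : 1 - r = k by rewrite /r; ring.
  move: k2; rewrite ler_pdivlMr; last by rewrite mulr_gt0//; lra.
  move=> k2; have -> : k * (40 * 1 / (1 - s) ^+ 3) * Q = (k * (40 * Q)) / (1 - s) ^+ 3 by field; exact: lt0r_neq0.
  by rewrite ler_pdivrMr//; lra.
have [|N hN] := trunc_approx r0 r1 (e := m / (M + 1)); first by apply: divr_gt0 => //; lra.
apply: (@le_trans _ _ (opnorm beta (fun f z => wcomp u phi f z - wcomp u phi (trunc r N f) z))).
  apply: ereal_inf_lbound; exists (fun f => wcomp u phi (trunc r N f)); last reflexivity.
  exact: compact_wcomp_trunc.
apply: ge_ereal_sup => _ [f [/in_bloch_hol hf /bloch_semi_le[fb f0]] <-].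
have hd := hol_dilB (ltW r0) (ltW r1) hf.
have ht := hol_dil_trunc r0 r1 N hf.
have F : forall z, disk z -> wcomp u phi (fun w => f w - dil r f w) z +
  wcomp u phi (fun w => dil r f w - trunc r N f w) z = wcomp u phi f z - wcomp u phi (trunc r N f) z.
  by move=> z _; rewrite /wcomp; ring.
have H1 := hol_wcomp hu hphi hd; have H2 := hol_wcomp hu hphi ht.
apply: (zyg_norm_ext (holD H1 H2) F).
rewrite (_ : 14 * m = 13 * m + m); last by ring.
apply: zyg_normD => //; last first.
  apply: le_trans (hM _ _ ht (hN f 1 hf fb)) _; rewrite lee_fin dil_trunc0 cabs0 add0r mul1r.
  by rewrite mulrA ler_pdivrMr; lra.
apply/zyg_normP => z zD.
have sm0 := dilB_small0 (ltW r0) (ltW r1) hf fb s1.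
have sm1 := dilB_small1 (ltW r0) (ltW r1) hf fb s1.
have sm2 := dilB_small2 (ltW r0) (ltW r1) hf fb s1.
have ps : cabs (phi 0) <= s by rewrite le_max lexx orbT.
move: sm0 sm1 sm2 kap; set kp := (1 - r) * _ => sm0 sm1 sm2 kap.
have kp0 : 0 <= kp by apply: le_trans (sm0 _ ps); exact: cabs_ge0.
pose h := fun w => f w - dil r f w.
have a0 : cabs (wcomp u phi h 0) <= cabs (u 0) * kp.
  by rewrite /wcomp cabsM ler_wpM2l ?cabs_ge0//; exact: sm0.
have a1 : cabs (dC (wcomp u phi h) 0) <= (cabs (dC u 0) + cabs (u 0 * dC phi 0)) * kp.
  rewrite (dC_wcomp hu hphi hd (disk0 R)) mulrDl; apply: le_trans (cabsD _ _) _.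
  apply: lerD; first by rewrite cabsM ler_wpM2l ?cabs_ge0//; exact: sm0.
  rewrite (mulrC (dC h _)) mulrA (cabsM (u 0 * _)) ler_wpM2l ?cabs_ge0//; exact: sm1.
have E := dC2_wcompE hd zD; rewrite -/h in E *.
have [bU bV bW] := hB z zD; have w0 := wgt_ge0 beta z.
have pD := hphi.2 _ zD.
have U0 := wabs_ge0 (coefU u) z; have V0 := wabs_ge0 (coefV u phi) z; have W0 := wabs_ge0 (coefW u phi) z.
have a2 : wgt beta z * cabs (dC (dC (wcomp u phi h)) z) <=
   wabs (coefU u) z * cabs (h (phi z)) + wabs (coefV u phi) z * cabs (dC h (phi z)) +
   wabs (coefW u phi) z * cabs (dC (dC h) (phi z)).
  by rewrite E; exact: weighted_triangle.
have [zs|zs] := leP (cabs (phi z)) s.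
  have c0 : wabs (coefU u) z * cabs (h (phi z)) <= B * kp by apply: ler_pM; rewrite ?cabs_ge0//; exact: sm0.
  have c1 : wabs (coefV u phi) z * cabs (dC h (phi z)) <= B * kp by apply: ler_pM; rewrite ?cabs_ge0//; exact: sm1.
  have c2 : wabs (coefW u phi) z * cabs (dC (dC h) (phi z)) <= B * kp by apply: ler_pM; rewrite ?cabs_ge0//; exact: sm2.
  by move: kap; rewrite /Q; lra.
have zs0 : s0 < cabs (phi z) by apply: le_lt_trans zs; rewrite le_max lexx.
have [mU mV mW] := hm z zD zs0.
have d0 : 0 < 1 - cabs (phi z) by rewrite subr_gt0; exact: pD.
have g0 := dilB_growth (ltW r0) (ltW r1) hf fb pD.
have g1 : cabs (dC h (phi z)) * (1 - cabs (phi z)) <= 2.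
  have := dilB_le_semi (ltW r0) (ltW r1) hf fb pD; rewrite -/h mulr1; apply: le_trans.
  rewrite mulrC ler_wpM2r ?cabs_ge0//; have := cabs_ge0 (phi z); nra.
have g2 := dilB_dC2 (ltW r0) (ltW r1) hf fb pD.
rewrite -/h !mulr1 in g0 g2.
have c0 : wabs (coefU u) z * cabs (h (phi z)) <= 2 * m.
  apply: le_trans (ler_wpM2l U0 g0) _; lra.
have c1 : wabs (coefV u phi) z * cabs (dC h (phi z)) <= 2 * m.
  apply: le_trans (ler_wpM2r (cabs_ge0 _) mV) _; rewrite -mulrA [_ * cabs _]mulrC [leRHS]mulrC.
  by rewrite ler_pM2l.
have c2 : wabs (coefW u phi) z * cabs (dC (dC h) (phi z)) <= 8 * m.
  apply: le_trans (ler_wpM2r (cabs_ge0 _) mW) _; rewrite -mulrA [_ * cabs _]mulrC [leRHS]mulrC.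
  by rewrite ler_pM2l.
have q : (cabs (u 0) + (cabs (dC u 0) + cabs (u 0 * dC phi 0))) * kp <= m.
  apply: le_trans kap; rewrite [leRHS]mulrC ler_wpM2r// /Q.
  by rewrite addrA lerDl mulr_ge0.
by lra.
Qed.

End UpperBound.

(** * Weights and scales *)

Section Scales.
Variable R : realType.
Implicit Types (x d s m : R).

Lemma bernoulli d n : 0 <= d <= 1 -> 1 - n%:R * d <= (1 - d) ^+ n.
Proof.
move=> /andP[d0 d1]; elim: n => [|n ih]; first by rewrite mul0r subr0 expr0.
rewrite exprS -natr1; have : 0 <= n%:R :> R by [].
have : (1 - d) * (1 - n%:R * d) <= (1 - d) * (1 - d) ^+ n by rewrite ler_wpM2l//; lra.
by move: (n%:R : R) => k; nra.
Qed.

(** About 1 / (2 d): small enough for (1 - d)^n >= 1/2 by Bernoulli, and large enough for n d >= 1/4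
    when d <= 1/4. *)
Definition scale d : nat := Num.truncn (2 * d)^-1.

Lemma scaleP d : 0 < d -> d <= 4^-1 ->
  [/\ (scale d)%:R * d <= 2^-1, (4 * d)^-1 <= (scale d)%:R & (2 * d)^-1 <= (scale d).+1%:R].
Proof.
move=> d0 d4.
have p : 0 <= (2 * d)^-1 by rewrite invr_ge0; lra.
have /andP[] := truncn_itv p; rewrite -/(scale d); move: (scale d) => n h1 h2.
have E : (2 * d)^-1 * d = 2^-1 by field; exact: lt0r_neq0.
have i4 : 1 <= (4 * d)^-1 by rewrite invf_ge1; lra.
have E2 : (2 * d)^-1 = 2 * (4 * d)^-1 by field; exact: lt0r_neq0.
split; last exact: ltW.
  by rewrite -E ler_pM2r.
by move: h2; rewrite -natr1 E2; lra.
Qed.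

Lemma scale_large N : exists2 s : R, s < 1 & forall x, s < x -> x < 1 ->
  [/\ 0 < 1 - x, 1 - x <= 4^-1 & (N <= scale (1 - x))%N].
Proof.
have [e eE] : exists e : R, e = N.+1%:R^-1 by eexists.
have e0 : 0 < e by rewrite eE invr_gt0.
have e1 : e <= 1 by rewrite eE invf_le1// ler1n.
exists (1 - 4^-1 * e); first lra.
move=> x xs x1; have d0 : 0 < 1 - x by lra.
have d4 : 1 - x <= 4^-1 by lra.
split => //; have [_ h _] := scaleP d0 d4.
rewrite -(ler_nat R); apply: le_trans h.
apply: (@le_trans _ _ N.+1%:R); first by rewrite ler_nat.
rewrite -[leLHS]invrK -eE lef_pV2 ?posrE ?mulr_gt0//; lra.
Qed.

Lemma pow_scale x n : x < 1 -> 0 <= x -> n%:R * (1 - x) <= 2^-1 -> 2^-1 <= x ^+ n.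
Proof.
move=> x1 x0 h; have := @bernoulli (1 - x) n; rewrite (_ : 1 - (1 - x) = x); last by ring.
by move=> H; have {}H := H _; apply: le_trans (H _); lra.
Qed.

(** Each of the n + 1 terms of 1 + x + ... + x^n is at least x^n, and 1 - x times that sum is 1 -
    x^(n + 1). *)
Lemma geometric_weight x n : 0 <= x <= 1 -> n.+1%:R * x ^+ n * (1 - x) <= 1.
Proof.
move=> /andP[x0 x1].
have : n.+1%:R * x ^+ n * (1 - x) <= 1 - x ^+ n.+1.
  elim: n => [|n ih]; first by rewrite expr0 expr1; lra.
  have p : 0 <= x ^+ n.+1 by rewrite exprn_ge0.
  have q : x ^+ n.+1 <= 1 by rewrite exprn_ile1.
  have : x * (n.+1%:R * x ^+ n * (1 - x)) <= x * (1 - x ^+ n.+1) by rewrite ler_wpM2l.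
  rewrite -[n.+2%:R]natr1 (exprS x n.+1).
  have -> : x * (n.+1%:R * x ^+ n * (1 - x)) = n.+1%:R * x ^+ n.+1 * (1 - x) by rewrite exprS; ring.
  move: (x ^+ n.+1) (n.+1%:R : R) p q => y k p q h.
  have : 0 <= (1 - x) * (1 - y) by rewrite mulr_ge0// subr_ge0.
  lra.
by move=> /le_trans; apply; rewrite lerBlDr lerDl exprn_ge0.
Qed.

(** The square of [geometric_weight] at y = sqrt x: 1 - x = (1 - y) (1 + y), and (1 + y)^2 <= 4. *)
Lemma geometric_weight2 x n : 0 <= x <= 1 -> n.+1%:R ^+ 2 * x ^+ n * (1 - x) ^+ 2 <= 4.
Proof.
move=> /andP[x0 x1]; set y := Num.sqrt x.
have y0 : 0 <= y by exact: sqrtr_ge0.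
have yE : y ^+ 2 = x by rewrite sqr_sqrtr.
have y1 : y <= 1 by rewrite -(@sqrtr1 R) ler_wsqrtr.
have h := @geometric_weight y n; rewrite y0 y1 in h.
have {}h : n.+1%:R * y ^+ n * (1 - y) <= 1 by exact: h.
have p : 0 <= n.+1%:R * y ^+ n * (1 - y) by rewrite !mulr_ge0 ?exprn_ge0// subr_ge0.
rewrite -yE -exprM mulnC exprM.
have -> : n.+1%:R ^+ 2 * (y ^+ n) ^+ 2 * (1 - y ^+ 2) ^+ 2 =
  (n.+1%:R * y ^+ n * (1 - y)) ^+ 2 * (1 + y) ^+ 2 by ring.
have -> : 4 = 1 * 2 ^+ 2 :> R by ring.
apply: ler_pM; rewrite ?sqr_ge0// ?expr_le1//.
by rewrite lerXn2r ?nnegrE; lra.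
Qed.

(** Compare n with 1/(1 - x): the excess ln (n (1 - x)) is at most n (1 - x), and x^n absorbs it by
    [geometric_weight]. *)
Lemma log_weight x n : 0 <= x < 1 -> ln n%:R * x ^+ n <= - ln (1 - x) + 1.
Proof.
move=> /andP[x0 x1]; have d0 : 0 < 1 - x by lra.
have lnd : ln (1 - x) <= 0 by apply: ln_le0; lra.
(* At n = 0 the default value 0 of [ln 0] is used. *)
case: n => [|n]; first by rewrite ln0// mul0r; lra.
have n0 : 0 < n.+1%:R :> R by [].
have p1 : x ^+ n.+1 <= 1 by rewrite exprn_ile1// ltW.
have p0 : 0 <= x ^+ n.+1 by rewrite exprn_ge0.
have -> : ln n.+1%:R = - ln (1 - x) + ln (n.+1%:R * (1 - x)) by rewrite lnM ?posrE//; ring.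
have h1 : ln (n.+1%:R * (1 - x)) <= n.+1%:R * (1 - x).
  by apply/ltW/ln_sublinear; rewrite mulr_gt0.
rewrite mulrDl; apply: lerD; first by rewrite ler_piMr// oppr_ge0.
apply: le_trans (ler_wpM2r p0 h1) _.
have := @geometric_weight x n; rewrite x0 (ltW x1) => /(_ isT).
apply: le_trans; rewrite mulrAC ler_wpM2r ?(ltW d0)// ler_wpM2l//.
by rewrite exprS ler_piMl ?exprn_ge0// ltW.
Qed.

Lemma ln_nat_ge0 n : 0 <= ln (n%:R : R).
Proof. by case: n => [|n]; [rewrite ln0|apply: ln_ge0; rewrite ler1n]. Qed.

(** A crude bound, so that [weight_vanishes] serves for all three weights. *)
Lemma ln_nat_le n : ln (n%:R : R) <= n.+1%:R ^+ 2.
Proof.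
case: n => [|n]; first by rewrite ln0// sqr_ge0.
have n0 : 0 < n.+1%:R :> R by [].
apply: le_trans (ltW (ln_sublinear n0)) _.
rewrite -natrX ler_nat; nia.
Qed.

(** [geometric_weight] at the fourth root of x, raised to the fourth power, bounds (n + 1)^4 x^n;
    the two spare factors n + 1 give the decay. *)
Lemma weight_vanishes x (e : R) : 0 <= x < 1 -> 0 < e -> exists N, forall n, (N <= n)%N ->
  n.+1%:R ^+ 2 * x ^+ n <= e.
Proof.
move=> /andP[x0 x1] e0.
set y := Num.sqrt x; set t := Num.sqrt y.
have y0 : 0 <= y by exact: sqrtr_ge0.
have yE : y ^+ 2 = x by rewrite sqr_sqrtr.
have tE : t ^+ 2 = y by rewrite sqr_sqrtr.
have t0 : 0 <= t by exact: sqrtr_ge0.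
have t1 : t < 1.
  by rewrite ltNge; apply/negP => t1; have : 1 <= x; [rewrite -yE -tE -exprM exprn_ege1|lra].
have d0 : 0 < 1 - t by lra.
pose A := ((1 - t) ^+ 4)^-1.
have A0 : 0 < A by rewrite invr_gt0 exprn_gt0.
have h n : n.+1%:R ^+ 4 * x ^+ n <= A.
  have := @geometric_weight t n; rewrite t0 (ltW t1) => /(_ isT) h.
  have p : 0 <= n.+1%:R * t ^+ n * (1 - t) by rewrite !mulr_ge0 ?exprn_ge0// ltW.
  have : (n.+1%:R * t ^+ n * (1 - t)) ^+ 4 <= 1 by rewrite exprn_ile1.
  rewrite !exprMn -(exprM t n 4) mulnC exprM (_ : t ^+ 4 = x); last by rewrite -yE -tE -exprM.
  by rewrite -ler_pdivlMr ?exprn_gt0// div1r.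
exists (Num.bound (A / e)) => n hn.
have hb : A / e < n.+1%:R.
  apply: lt_le_trans (archi_boundP _) _; first by rewrite divr_ge0 ?ltW.
  by rewrite ler_nat; apply: leqW.
rewrite ltr_pdivrMr// in hb.
have n1 : 1 <= n.+1%:R :> R by rewrite ler1n.
have n0 : 0 < n.+1%:R :> R by [].
have := h n; have : 0 <= x ^+ n by rewrite exprn_ge0.
move: (x ^+ n) (n.+1%:R : R) n1 n0 hb => X k k1 k0 hb X0.
have -> : k ^+ 4 * X = k ^+ 2 * (k ^+ 2 * X) by ring.
move=> hk; have : k ^+ 2 * (k ^+ 2 * X) <= k ^+ 2 * e; last by rewrite ler_pM2l ?exprn_gt0.
apply: le_trans hk _; apply: le_trans (ltW hb) _.
by rewrite expr2 -mulrA ler_pM2l// ler_peMl// ltW.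
Qed.

Lemma limn_esup_lt (v : nat -> \bar R) (a : \bar R) : (limn_esup v < a)%E ->
  exists N, forall n, (N <= n)%N -> (v n <= a)%E.
Proof.
move=> /ereal_inf_lt[_ [V [N _ NV] <-]] h; exists N => n Nn.
apply: le_trans (ltW h); apply: ereal_sup_ubound; exists n => //; exact: NV.
Qed.

Lemma limn_esup_le (v : nat -> \bar R) (a : \bar R) N : (forall n, (N <= n)%N -> (v n <= a)%E) ->
  (limn_esup v <= a)%E.
Proof.
move=> h; apply: le_trans (_ : ereal_sup (v @` [set n | (N <= n)%N]) <= _)%E.
  by apply: ereal_inf_lbound; exists [set n | (N <= n)%N] => //; exists N.
by apply: ge_ereal_sup => _ [n /h hn <-].
Qed.

Lemma mul_nu_norm_leP beta (g : R[i] -> R[i]) (k a : R) : 0 <= k ->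
  ((k%:E * nu_norm beta g)%E <= a%:E)%E <-> (forall z, disk z -> k * wabs beta g z <= a).
Proof.
move=> k0; split.
  move=> h z zD; rewrite -lee_fin EFinM; apply: le_trans h.
  by apply: lee_wpmul2l => //; apply: ereal_sup_ubound; exists z.
(* For k = 0, which occurs as [ln 0] and [ln 1], the product is 0 even if the norm is infinite, and
   no division is possible. *)
move: k0; rewrite le_eqVlt => /orP[/eqP<-|k0] h.
  by rewrite mul0e lee_fin; have := h 0 (disk0 R); rewrite mul0r.
rewrite muleC -lee_pdivlMr//; apply: ge_ereal_sup => _ [z /h hz <-].
by rewrite lee_pdivlMr// -EFinM lee_fin mulrC.
Qed.

Lemma wabs_pow beta (g phi : R[i] -> R[i]) n z :
  wabs beta (fun z => g z * phi z ^+ n) z = wabs beta g z * cabs (phi z) ^+ n.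
Proof. by rewrite /wabs cabsM cabsX mulrA. Qed.

End Scales.

(** * Compact operators and gliding humps *)

Section GlidingHump.
Variable R : realType.
Local Notation C := (R[i]).
Implicit Types (f g h u phi : C -> C) (z w a : C).
Variable beta : R.

(** The bound L on the derivative need not be uniform over a family. It makes the weighted
    derivative of a finite sum small near the circle, which leaves room there for the next hump. *)
Definition bump_le f (b : R) := [/\ hol f, f 0 = 0, semi_le f b &
  exists2 L : R, 0 <= L & forall z, disk z -> cabs (dC f z) <= L].

Definition bloch_bump f := bump_le f 1.

Lemma semi_leZ a f b : hol f -> semi_le f b -> semi_le (fun z => a * f z) (cabs a * b).
Proof.
move=> hf fb z zD; rewrite (dCZ a hf zD) cabsM mulrCA ler_wpM2l ?cabs_ge0//.
exact: fb.
Qed.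

Lemma in_bloch_semi f b : hol f -> semi_le f b -> in_bloch f.
Proof. by move=> hf fb; have [] := semi_le_bloch hf fb. Qed.

Lemma in_bloch0 : in_bloch (fun=> 0 : C).
Proof.
apply: (@in_bloch_semi _ 0); first exact: hol_cst.
by move=> w _; rewrite (cdiff_dC (cdiff_cst 0 w)) cabs0 mulr0.
Qed.

Lemma bump_bloch f : bloch_bump f -> in_bloch f /\ (bloch_norm f <= 1)%E.
Proof.
move=> [hf f0 fb _]; have [h1 h2] := semi_le_bloch hf fb; split => //.
by move: h2; rewrite f0 cabs0 add0r.
Qed.

Section CompactOperator.
Variable K : (C -> C) -> (C -> C).
Hypothesis cK : compact_op beta K.

Lemma compact_op_bounded : exists2 B : R, 0 <= B & forall f, in_bloch f ->
  (bloch_norm f <= 1)%E -> (zyg_norm beta (K f) <= B%:E)%E.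
Proof.
case: cK => _ _ zK cvK; apply: contrapT => h.
have H (n : nat) : exists f, (in_bloch f /\ (bloch_norm f <= 1)%E) /\ ~ (zyg_norm beta (K f) <= n%:R%:E)%E.
  apply: contrapT => hn; apply: h; exists n%:R => // f hf f1.
  by apply: contrapT => hh; apply: hn; exists f.
have [fs hfs] := choice H.
have [|s [hs [g [hg cvg]]]] := cvK fs; first by move=> n; have [] := hfs n.
have [a a0 ga] := in_zyg_fin hg.
have p n := zyg_norm_ge0 beta (fun z => K (fs (s n)) z - g z).
have /(_ _ ltr01)[N hN] := iffLR (ereal_cvg0P p) cvg.
pose n := maxn N (Num.bound (1 + a)).
have [[hb _] nle] := hfs (s n); apply: nle.
have Hg := in_zyg_hol hg; have Hk := in_zyg_hol (zK _ hb).
have gle : (zyg_norm beta g <= a%:E)%E by rewrite ga.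
have := zyg_normD (holB Hk Hg) Hg (hN n (leq_maxl _ _)) gle.
rewrite (_ : (fun z => K (fs (s n)) z - g z + g z) = K (fs (s n))); last by apply/funext => z; ring.
move=> /le_trans; apply; rewrite lee_fin.
have : 1 + a < (Num.bound (1 + a))%:R by apply: archi_boundP; lra.
have : (Num.bound (1 + a))%:R <= (s n)%:R :> R.
  by rewrite ler_nat; apply: leq_trans (subseq_ge hs n); exact: leq_maxr.
by lra.
Qed.

Lemma op_lin0 z : disk z -> K (fun=> 0) z = 0.
Proof.
case: cK => wK lK _ _ zD; have h0 := in_bloch0.
have E : (fun w : C => 0 + 1 * 0 : C) = (fun=> 0) by apply/funext => w; rewrite mulr0 addr0.
have := lK _ _ 1 h0 h0 z zD; rewrite E mul1r.
move: (K _ z) => x /eqP; rewrite -subr_eq0 opprD addrA subrr sub0r oppr_eq0.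
by move=> /eqP.
Qed.

Lemma compact_bound_scaled : exists2 B : R, 0 <= B & forall f b, hol f -> f 0 = 0 ->
  semi_le f b -> 0 < b -> (zyg_norm beta (K f) <= (b * B)%:E)%E.
Proof.
have [B B0 hB] := compact_op_bounded; exists B => // f b hf f0 fb b0.
have bn : b%:C%C != 0 by apply/eqP => -[] /eqP; rewrite gt_eqF.
pose g z := (b%:C%C)^-1 * f z.
have hg : hol g by exact: holZ.
have gb : semi_le g 1.
  have := semi_leZ (b%:C%C)^-1 hf fb.
  by rewrite cabsV cabsC gtr0_norm// mulVf// gt_eqF.
have [g1 g2] := semi_le_bloch hg gb.
have g0 : g 0 = 0 by rewrite /g f0 mulr0.
have g3 : (bloch_norm g <= 1)%E by move: g2; rewrite g0 cabs0 add0r.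
have h0 := in_bloch0; case: cK => wK lK zK _.
have Hk := in_zyg_hol (zK _ g1).
have E z : disk z -> b%:C%C * K g z = K f z.
  move=> zD; rewrite -[LHS]add0r -(op_lin0 zD) -(lK _ _ b%:C%C h0 g1 z zD).
  congr (K _ z); apply/funext => w; rewrite /g add0r; field; exact: bn.
have H := zyg_normZ b%:C%C Hk (hB g g1 g3); rewrite cabsC (gtr0_norm b0) in H.
exact: (zyg_norm_ext (holZ _ Hk) E H).
Qed.

Variable fs : nat -> C -> C.
Hypothesis bfs : forall n, bloch_bump (fs n).
Hypothesis fs0 : forall (rho e : R), rho < 1 -> 0 < e -> exists N, forall n, (N <= n)%N ->
  forall z, cabs z <= rho -> cabs (dC (fs n) z) <= e.

(* The function [S] is a sum of [J] terms of the sequence.  Each new term is small where the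
   derivative of the previous sum is large, so that the Bloch seminorm stays bounded while
   [K S] stays close to [J%:R * g]; hence the limit [g] has norm 0. *)
Lemma gliding_step s g (J : nat) : (forall n, (s n < s n.+1)%N) -> in_zyg beta g ->
  (fun n => zyg_norm beta (fun z => K (fs (s n)) z - g z)) @ \oo --> 0%E ->
  exists2 S : C -> C, bump_le S (3 - 2^-1 ^+ J) &
    (zyg_norm beta (fun z => K S z - J%:R * g z)%R <= (2 - 2^-1 ^+ J)%:E)%E.
Proof.
move=> hs hg cvg; have Hg := in_zyg_hol hg.
case: cK => wK lK zK _.
have dC0 z : dC (fun=> 0 : C) z = 0 by exact: cdiff_dC (cdiff_cst 0 z).
elim: J => [|J [S [hS S0 bS [L L0 hL]] eS]].
  exists (fun=> 0); [split => //|].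
  - exact: hol_cst.
  - by move=> z _; rewrite dC0 cabs0 mulr0 expr0; lra.
  - by exists 0 => // z _; rewrite dC0 cabs0.
  - apply: (@zyg_norm_ext _ _ (fun=> 0)); first exact: hol_cst.
      by move=> z zD; rewrite op_lin0// mul0r subrr.
    by rewrite zyg_norm0 lee_fin expr0; lra.
pose d := 2^-1 ^+ J.+1 : R; have d0 : 0 < d by rewrite exprn_gt0.
have d1 : d <= 1 by rewrite exprn_ile1//; lra.
have dE : 2^-1 ^+ J = 2 * d by rewrite /d exprS; field.
(* Beyond this radius 1 - |z|^2 <= 1 / (L + 1), so the weighted derivative of [S] is at most 1. *)
pose rho : R := 1 - (2 * (L + 1))^-1.
have L1 : 0 < (2 * (L + 1))^-1 by rewrite invr_gt0; lra.
have L2 : (2 * (L + 1))^-1 * (2 * (L + 1)) = 1 by rewrite mulVf//; apply/eqP; lra.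
have rho1 : rho < 1 by rewrite /rho; lra.
have [N1 h1] := fs0 rho1 d0.
have p n := zyg_norm_ge0 beta (fun z => K (fs (s n)) z - g z).
have /(_ _ d0)[N2 h2] := iffLR (ereal_cvg0P p) cvg.
pose n := maxn N1 N2; pose f := fs (s n).
have [hf f0 fb [Lf Lf0 hLf]] := bfs (s n); rewrite -/f in hf f0 fb hLf.
have {}h1 z : cabs z <= rho -> cabs (dC f z) <= d.
  by apply: h1; apply: leq_trans (subseq_ge hs n); exact: leq_maxl.
have {}h2 := h2 n (leq_maxr _ _); rewrite -/f in h2.
exists (fun z => S z + f z); [split|].
- exact: holD.
- by rewrite S0 f0 addr0.
- move=> z zD; rewrite (dCD hS hf zD) -/d.
  have w0 := cabs_disk_sq zD; have z2 : 0 <= cabs z ^+ 2 by rewrite sqr_ge0.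
  apply: le_trans (ler_wpM2l (ltW w0) (cabsD _ _)) _; rewrite mulrDr.
  have := bS z zD; have := fb z zD; rewrite dE; have := cabs_ge0 (dC f z).
  (* Inside, the new term adds at most d to the old bound 3 - 2 d; outside, each of the two terms
     contributes at most 1. *)
  have [zr|zr] := leP (cabs z) rho.
    have := h1 z zr => x1 x0 _ x2.
    have : (1 - cabs z ^+ 2) * cabs (dC f z) <= 1 * d by apply: ler_pM => //; lra.
    by lra.
  move=> _ x1 _.
  have : (1 - cabs z ^+ 2) * cabs (dC S z) <= (2 * (L + 1))^-1 * 2 * (L + 1).
    have z1 : cabs z < 1 by [].
    apply: ler_pM; rewrite ?cabs_ge0 ?(ltW w0)//; last by have := hL z zD; lra.
    by move: zr; rewrite /rho; have := cabs_ge0 z; nra.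
  by rewrite -mulrA L2; lra.
- exists (L + Lf); first exact: addr_ge0.
  move=> z zD; rewrite (dCD hS hf zD); apply: le_trans (cabsD _ _) _.
  by apply: lerD; [exact: hL|exact: hLf].
- have bS' := in_bloch_semi hS bS; have bf' := in_bloch_semi hf fb.
  have HS := in_zyg_hol (zK _ bS'); have Hf := in_zyg_hol (zK _ bf').
  have A1 := holB HS (holZ J%:R Hg); have A2 := holB Hf Hg.
  have -> : 2 - 2^-1 ^+ J.+1 = (2 - 2^-1 ^+ J) + d by rewrite dE -/d; ring.
  apply: (zyg_norm_ext (holD A1 A2) _ (zyg_normD A1 A2 eS h2)) => z zD.
  have := lK S f 1 bS' bf' z zD; rewrite mul1r.
  rewrite (_ : (fun w => S w + 1 * f w) = (fun w => S w + f w)); last first.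
    by apply/funext => w; rewrite mul1r.
  move=> ->; rewrite -natr1; ring.
Qed.

(** Since |K S| <= 3 B while K S is within 2 of J g, the norm of g is at most (3 B + 2) / J for
    every J > 0. A single index is enough, because [test_family] feeds in a sequence of
    counterexamples. *)
Lemma gliding_hump (e : R) : 0 < e -> exists n, (zyg_norm beta (K (fs n)) <= e%:E)%E.
Proof.
move=> e0; have [B B0 hB] := compact_bound_scaled.
case: (cK) => wK lK zK cvK.
have [|s [hs [g [hg cvg]]]] := cvK fs; first by move=> n; exact: bump_bloch.
have [a a0 ga] := in_zyg_fin hg; have Hg := in_zyg_hol hg.
have gle : (zyg_norm beta g <= a%:E)%E by rewrite ga.
have Ja (J : nat) : J%:R * a <= 3 * B + 2.
  case: J => [|J]; first by rewrite mul0r addr_ge0 ?mulr_ge0.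
  have [S [hS S0 bS _] eS] := gliding_step J.+1 hs hg cvg.
  have p0 : 0 < 2^-1 ^+ J.+1 :> R by rewrite exprn_gt0.
  have p1 : 2^-1 ^+ J.+1 <= 1 :> R by rewrite exprn_ile1//; lra.
  have S3 : semi_le S 3 by move=> z /bS h; apply: le_trans h _; lra.
  have HS := in_zyg_hol (zK _ (in_bloch_semi hS bS)).
  have p3 : 0 < 3 :> R by [].
  have b3 := hB S 3 hS S0 S3 p3.
  have A1 := holB HS (holZ J.+1%:R Hg).
  have jn : J.+1%:R != 0 :> C by rewrite pnatr_eq0.
  have := zyg_normZ (J.+1%:R)^-1 (holB HS A1) (zyg_normB HS A1 b3 eS).
  rewrite (_ : (fun z => _) = g); last by apply/funext => z; field; rewrite addrC natr1.
  rewrite ga lee_fin cabsV (cabs_nat R) mulrC ler_pdivlMr// mulrC; lra.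
have a00 : a <= 0.
  apply: arbitrarily_small => d d0.
  have [N hN] : exists N : nat, (3 * B + 2) / d < N%:R.
    by exists (Num.bound ((3 * B + 2) / d)); apply: archi_boundP; rewrite divr_ge0 ?(ltW d0)//; lra.
  have := Ja N; rewrite ltr_pdivrMr// in hN; have : 0 < N%:R :> R.
    by rewrite -(pmulr_lgt0 _ d0) (lt_trans _ hN)//; lra.
  move: (N%:R : R) hN => x hN x0 h; rewrite leNgt; apply/negP => da.
  have : x * d < x * a by rewrite ltr_pM2l.
  lra.
have p n := zyg_norm_ge0 beta (fun z => K (fs (s n)) z - g z).
have /(_ _ e0)[N hN] := iffLR (ereal_cvg0P p) cvg.
exists (s N); have [hb _] := bump_bloch (bfs (s N)).
have Hk := in_zyg_hol (zK _ hb).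
have := zyg_normD (holB Hk Hg) Hg (hN N (leqnn _)) gle.
rewrite (_ : (fun z => K (fs (s N)) z - g z + g z) = K (fs (s N))); last by apply/funext => z; ring.
by move=> /le_trans; apply; rewrite lee_fin; lra.
Qed.

End CompactOperator.

(** Were the bound to fail near the circle, points z_n with |phi z_n| tending to 1 would violate it,
    and the functions F (phi z_n) would vanish locally. At the index given by [gliding_hump] the
    part K costs only e, a contradiction. *)
Lemma test_family u phi K (t : R) (F : C -> C -> C) (s0 e : R) :
  hol u -> holmap phi -> bounded_op beta (wcomp u phi) -> compact_op beta K ->
  (opnorm beta (fun f z => wcomp u phi f z - K f z)%R <= t%:E)%E ->
  s0 < 1 -> (forall w, disk w -> s0 < cabs w -> bloch_bump (F w)) ->
  (forall rho d : R, 0 <= rho -> rho < 1 -> 0 < d -> exists2 s : R, s < 1 & forall w, disk w -> s < cabs w ->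
     forall z, cabs z <= rho -> cabs (dC (F w) z) <= d) ->
  0 < e -> exists2 s : R, s < 1 & forall z, disk z -> s < cabs (phi z) ->
    wgt beta z * cabs (dC (dC (wcomp u phi (F (phi z)))) z) <= t + e.
Proof.
move=> hu hphi hb cK ht s01 hF hF0 e0; apply: contrapT => h.
have H (n : nat) : exists z, [/\ disk z, s0 < cabs (phi z), 1 - n.+1%:R^-1 < cabs (phi z) &
    ~ (wgt beta z * cabs (dC (dC (wcomp u phi (F (phi z)))) z) <= t + e)].
  apply: contrapT => hn; apply: h; exists (Num.max s0 (1 - n.+1%:R^-1)).
    have n0 : 0 < n.+1%:R^-1 :> R by rewrite invr_gt0.
    by rewrite gt_max s01 /=; move: n0; move: (_^-1) => x x0; lra.
  move=> z zD; rewrite gt_max => /andP[z1 z2]; apply: contrapT => hz; apply: hn.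
  by exists z.
have [zs hz] := choice H.
have bF n : bloch_bump (F (phi (zs n))).
  by have [zD z0 _ _] := hz n; apply: hF => //; exact: hphi.2.
have [|n hn] := @gliding_hump K cK (fun n => F (phi (zs n))) bF _ e e0.
  move=> rho d rho1 d0.
  have [||s s1 hs] := hF0 (Num.max 0 rho) d _ _ d0; [by rewrite le_max lexx|by rewrite gt_max ltr01|].
  have [N hN] : exists N : nat, (1 - s)^-1 < N%:R.
    by exists (Num.bound (1 - s)^-1); apply: archi_boundP; rewrite invr_ge0; lra.
  exists N => n Nn z zr; have [zD _ zn _] := hz n; apply: hs.
  - exact: hphi.2.
  - apply: le_lt_trans zn; rewrite lerBrDr -lerBrDl.
    have s10 : 0 < 1 - s by lra.
    rewrite -[leRHS]invrK lef_pV2 ?posrE ?invr_gt0//; apply: le_trans (ltW hN) _.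
    by rewrite ler_nat; apply: leqW.
  - by rewrite le_max zr orbT.
have [zD _ _] := hz n; apply.
have [b1 b2] := bump_bloch (bF n); have [hf _ _ _] := bF n.
case: cK => _ _ zK _; have Hk := in_zyg_hol (zK _ b1).
have HT := hol_wcomp hu hphi hf.
have TK : (zyg_norm beta (fun z => wcomp u phi (F (phi (zs n))) z - K (F (phi (zs n))) z)%R <= t%:E)%E.
  by apply: le_trans ht; apply: ereal_sup_ubound; exists (F (phi (zs n))).
apply: (zyg_wgt_le _ zD).
have := zyg_normD (holB HT Hk) Hk TK hn.
apply: (zyg_norm_ext (holD (holB HT Hk) Hk)) => z _; ring.
Qed.

End GlidingHump.

(** * The lower bound *)

Section TestFunctions.
Variable R : realType.
Local Notation C := (R[i]).
Implicit Types (f g h : C -> C) (z w a c : C).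

Lemma bump_le1 f (b : R) : b <= 1 -> bump_le f b -> bloch_bump f.
Proof.
by move=> b1 [hf f0 fb fL]; split => // z /fb h; exact: le_trans h b1.
Qed.

Lemma bump_leD f g (b b' : R) : bump_le f b -> bump_le g b' -> bump_le (fun z => f z + g z) (b + b').
Proof.
move=> [hf f0 fb [L L0 hL]] [hg g0 gb [L' L0' hL']]; split.
- exact: holD.
- by rewrite f0 g0 addr0.
- move=> z zD; rewrite (dCD hf hg zD).
  apply: le_trans (ler_wpM2l (ltW (cabs_disk_sq zD)) (cabsD _ _)) _.
  by rewrite mulrDr; apply: lerD; [exact: fb|exact: gb].
- exists (L + L'); first exact: addr_ge0.
  move=> z zD; rewrite (dCD hf hg zD); apply: le_trans (cabsD _ _) _.
  by apply: lerD; [exact: hL|exact: hL'].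
Qed.

Definition mono a n : C -> C := fun z => a * z ^+ n.

Lemma hol_mono a n : hol (mono a n).
Proof. exact: (holZ a (@hol_expn R n)). Qed.

Lemma dC_mono a n z : dC (mono a n) z = a * (n%:R * z ^+ n.-1).
Proof. by rewrite (cdiff_dC (cdiffZ a (cdiffX n (cdiff_id z)))) mulr1. Qed.

Lemma dC2_mono a n z : dC (dC (mono a n)) z = a * (n%:R * (n.-1%:R * z ^+ n.-2)).
Proof.
rewrite (_ : dC (mono a n) = (fun z => a * (n%:R * z ^+ n.-1))).
  by rewrite (cdiff_dC (cdiffZ a (cdiffZ n%:R (cdiffX n.-1 (cdiff_id z))))) mulr1.
by apply/funext => w; exact: dC_mono.
Qed.

Lemma cabs_dC_mono a n z : cabs (dC (mono a n) z) = cabs a * n%:R * cabs z ^+ n.-1.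
Proof. by rewrite dC_mono !cabsM (cabs_nat R) cabsX mulrA. Qed.

(** [geometric_weight] handles the factor 1 - |z| of the weight; the constant 2 bounds the factor 1
    + |z|. *)
Lemma bump_mono a n : (0 < n)%N -> bump_le (mono a n) (cabs a * 2).
Proof.
case: n => // n _; split.
- exact: hol_mono.
- by rewrite /mono expr0n mulr0.
- move=> z zD; rewrite dC_mono cabsM mulrCA ler_wpM2l ?cabs_ge0//= cabsM (cabs_nat R) cabsX.
  have z1 := disk_le1 zD; have z0 := cabs_ge0 z.
  have := @geometric_weight R (cabs z) n; rewrite z0 z1 => /(_ isT).
  have : 0 <= n.+1%:R * cabs z ^+ n by rewrite mulr_ge0 ?exprn_ge0.
  move: (n.+1%:R * cabs z ^+ n) z1 z0; move: (cabs z) => x y z1 z0 y0 h.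
  have : (y * (1 - x)) * (1 + x) <= 1 * 2.
    by apply: ler_pM => //; rewrite ?mulr_ge0//; lra.
  have -> : (1 - x ^+ 2) * y = (y * (1 - x)) * (1 + x) by ring.
  by rewrite mul1r.
- exists (cabs a * n.+1%:R); first by rewrite mulr_ge0 ?cabs_ge0.
  move=> z zD; have z1 := disk_le1 zD; rewrite cabs_dC_mono.
  by rewrite ler_piMr ?mulr_ge0 ?cabs_ge0// exprn_ile1 ?cabs_ge0.
Qed.

(** Exponents k n are reduced to n, so that all terms of a test polynomial share one local bound. *)
Lemma mono_dC_local a (n k : nat) (rho : R) z : (0 < k)%N -> (0 < n)%N -> 0 <= rho -> rho < 1 ->
  cabs z <= rho -> cabs (dC (mono a (k * n)) z) <= cabs a * k%:R * (n%:R * rho ^+ n.-1).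
Proof.
move=> k0 n0 r0 r1 zr; rewrite cabs_dC_mono natrM -!mulrA !ler_wpM2l ?cabs_ge0//.
apply: (@le_trans _ _ (rho ^+ (k * n).-1)).
  by rewrite lerXn2r ?nnegrE ?cabs_ge0.
rewrite ler_wiXn2l//; first exact: ltW.
by have := leq_pmull n k0; lia.
Qed.

(* Up to a constant, these are z^n (z^n - x)^2 and z^n (z^n - x), used with x = w^n. *)
Definition test2 (n : nat) (x : C) : C -> C := fun z =>
  mono 8^-1 (3 * n) z + (mono (- (x / 4)) (2 * n) z + mono (x ^+ 2 / 8) (1 * n) z).

Definition test1 (n : nat) (x : C) : C -> C := fun z =>
  mono 8^-1 (2 * n) z + mono (- (x / 8)) (1 * n) z.

Let hol_test2 n x : [/\ hol (mono 8^-1 (3 * n)), hol (mono (- (x / 4)) (2 * n)) &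
  hol (mono (x ^+ 2 / 8) (1 * n))].
Proof. by split; exact: hol_mono. Qed.

Let hol_test1 n x : hol (mono 8^-1 (2 * n)) /\ hol (mono (- (x / 8)) (1 * n)).
Proof. by split; exact: hol_mono. Qed.

Let cabs_8V : cabs (8^-1 : C) = 8^-1.
Proof. by rewrite cabsV (cabs_nat R 8). Qed.

Let cabs_4V : cabs (4^-1 : C) = 4^-1.
Proof. by rewrite cabsV (cabs_nat R 4). Qed.

(** The coefficients 1/8, 1/4, 1/8 sum to 1/2, and the factor 2 of [bump_mono] makes this exactly
    1. *)
Lemma bump_test2 n x : (0 < n)%N -> cabs x <= 1 -> bloch_bump (test2 n x).
Proof.
move=> n0 x1; have X2 : cabs x ^+ 2 <= 1 by rewrite exprn_ile1 ?cabs_ge0.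
have H := bump_leD (@bump_mono 8^-1 (3 * n) _)
  (bump_leD (@bump_mono (- (x / 4)) (2 * n) _) (@bump_mono (x ^+ 2 / 8) (1 * n) _)).
apply: (bump_le1 _ (H _ _ _)); try by rewrite muln_gt0.
rewrite cabsN !(cabsX, cabsM) cabs_8V cabs_4V; lra.
Qed.

Lemma bump_test1 n x : (0 < n)%N -> cabs x <= 1 -> bloch_bump (test1 n x).
Proof.
move=> n0 x1.
have H := bump_leD (@bump_mono 8^-1 (2 * n) _) (@bump_mono (- (x / 8)) (1 * n) _).
apply: (bump_le1 _ (H _ _)); try by rewrite muln_gt0.
rewrite cabsN !cabsM cabs_8V; lra.
Qed.

Lemma test2_local n x (rho : R) z : (0 < n)%N -> cabs x <= 1 -> 0 <= rho -> rho < 1 ->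
  cabs z <= rho -> cabs (dC (test2 n x) z) <= n%:R * rho ^+ n.-1.
Proof.
move=> n0 x1 r0 r1 zr; have zD : disk z by exact: le_lt_trans r1.
have X2 : cabs x ^+ 2 <= 1 by rewrite exprn_ile1 ?cabs_ge0.
have [h1 h2 h3] := hol_test2 n x.
rewrite (dCD h1 (holD h2 h3) zD) (dCD h2 h3 zD).
have m1 := @mono_dC_local 8^-1 n 3 rho z isT n0 r0 r1 zr.
have m2 := @mono_dC_local (- (x / 4)) n 2 rho z isT n0 r0 r1 zr.
have m3 := @mono_dC_local (x ^+ 2 / 8) n 1 rho z isT n0 r0 r1 zr.
apply: le_trans (cabsD _ _) _; apply: le_trans (lerD (lexx _) (cabsD _ _)) _.
apply: le_trans (lerD m1 (lerD m2 m3)) _.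
rewrite cabsN !(cabsX, cabsM) cabs_8V cabs_4V.
have : 0 <= n%:R * rho ^+ n.-1 by rewrite mulr_ge0 ?exprn_ge0.
move: (n%:R * rho ^+ n.-1) => y y0.
rewrite -!mulrDl ler_piMl//; lra.
Qed.

Lemma test1_local n x (rho : R) z : (0 < n)%N -> cabs x <= 1 -> 0 <= rho -> rho < 1 ->
  cabs z <= rho -> cabs (dC (test1 n x) z) <= n%:R * rho ^+ n.-1.
Proof.
move=> n0 x1 r0 r1 zr; have zD : disk z by exact: le_lt_trans r1.
have [h1 h2] := hol_test1 n x.
rewrite (dCD h1 h2 zD).
have m1 := @mono_dC_local 8^-1 n 2 rho z isT n0 r0 r1 zr.
have m2 := @mono_dC_local (- (x / 8)) n 1 rho z isT n0 r0 r1 zr.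
apply: le_trans (cabsD _ _) _; apply: le_trans (lerD m1 m2) _.
rewrite cabsN !cabsM cabs_8V.
have : 0 <= n%:R * rho ^+ n.-1 by rewrite mulr_ge0 ?exprn_ge0.
move: (n%:R * rho ^+ n.-1) => y y0.
rewrite -!mulrDl ler_piMl//; lra.
Qed.

Lemma test2_value n w : test2 n (w ^+ n) w = 0.
Proof. by rewrite /test2 /mono mul1n (mulnC 3) (mulnC 2) !exprM; field. Qed.

Lemma test1_value n w : test1 n (w ^+ n) w = 0.
Proof. by rewrite /test1 /mono mul1n (mulnC 2) !exprM; field. Qed.

(** The factor w restores the exponent and makes the formula valid at m = 0; derivatives at w become
    polynomials in x = w^n. *)
Let mul_dC_mono a m w : w * dC (mono a m) w = a * m%:R * w ^+ m.
Proof.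
rewrite dC_mono; case: m => [|m]; first by rewrite mul0r !mulr0 mul0r.
by rewrite exprS /=; ring.
Qed.

Let mul_dC2_mono a m w : w ^+ 2 * dC (dC (mono a m)) w = a * (m%:R * (m%:R - 1)) * w ^+ m.
Proof.
rewrite dC2_mono; case: m => [|[|m]]; first by rewrite !mul0r !mulr0 mul0r.
  by rewrite /= subrr mul0r !mulr0 mul0r.
by rewrite !exprS /= -[m.+2%:R]natr1 addrK; ring.
Qed.

Lemma test2_dC n w : disk w -> w != 0 -> dC (test2 n (w ^+ n)) w = 0.
Proof.
move=> wD w0; set x := w ^+ n.
have [h1 h2 h3] := hol_test2 n x.
apply: (mulfI w0); rewrite (dCD h1 (holD h2 h3) wD) (dCD h2 h3 wD) !mulrDr !mul_dC_mono.
rewrite mul1n (mulnC 3) (mulnC 2) !exprM -/x !natrM; by field.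
Qed.

(** At a double zero only the square of the derivative of z^n - x survives: x * 2 (n x)^2 / 8. *)
Lemma test2_dC2 n w : disk w -> w ^+ 2 * dC (dC (test2 n (w ^+ n))) w = n%:R ^+ 2 * (w ^+ n) ^+ 3 / 4.
Proof.
move=> wD; set x := w ^+ n.
have [h1 h2 h3] := hol_test2 n x.
rewrite (dC2D h1 (holD h2 h3) wD) (dC2D h2 h3 wD) !mulrDr !mul_dC2_mono.
rewrite mul1n (mulnC 3) (mulnC 2) !exprM -/x !natrM; by field.
Qed.

Lemma test1_dC n w : disk w -> w * dC (test1 n (w ^+ n)) w = n%:R * (w ^+ n) ^+ 2 / 8.
Proof.
move=> wD; set x := w ^+ n.
have [h1 h2] := hol_test1 n x.
rewrite (dCD h1 h2 wD) !mulrDr !mul_dC_mono.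
rewrite mul1n (mulnC 2) !exprM -/x !natrM; by field.
Qed.

Lemma test2_dC2_lower n w : disk w -> w != 0 -> 2^-1 <= cabs w ^+ n ->
  n%:R ^+ 2 / 32 <= cabs (dC (dC (test2 n (w ^+ n))) w).
Proof.
move=> wD w0 hw; have := congr1 (@cabs R) (test2_dC2 n wD).
have w1 := disk_le1 wD.
have -> : cabs (w ^+ 2 * dC (dC (test2 n (w ^+ n))) w) =
  cabs w ^+ 2 * cabs (dC (dC (test2 n (w ^+ n))) w) by rewrite cabsM cabsX.
have -> : cabs (n%:R ^+ 2 * (w ^+ n) ^+ 3 / 4) = n%:R ^+ 2 * (cabs w ^+ n) ^+ 3 / 4.
  by rewrite !(cabsX, cabsM) cabs_4V (cabs_nat R).
move=> E; apply: (@le_trans _ _ (n%:R ^+ 2 * (cabs w ^+ n) ^+ 3 / 4)).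
  have : (2^-1) ^+ 3 <= (cabs w ^+ n) ^+ 3 by rewrite lerXn2r ?nnegrE ?exprn_ge0 ?cabs_ge0.
  have : 0 <= n%:R ^+ 2 :> R by rewrite sqr_ge0.
  by move: ((cabs w ^+ n) ^+ 3) (n%:R ^+ 2 : R) => y k; nra.
by rewrite -E ler_piMl ?cabs_ge0// exprn_ile1 ?cabs_ge0.
Qed.

Lemma test1_dC_lower n w : disk w -> 2^-1 <= cabs w ^+ n ->
  n%:R / 32 <= cabs (dC (test1 n (w ^+ n)) w).
Proof.
move=> wD hw; have := congr1 (@cabs R) (test1_dC n wD).
have w1 := disk_le1 wD.
have -> : cabs (w * dC (test1 n (w ^+ n)) w) = cabs w * cabs (dC (test1 n (w ^+ n)) w) by rewrite cabsM.
have -> : cabs (n%:R * (w ^+ n) ^+ 2 / 8) = n%:R * (cabs w ^+ n) ^+ 2 / 8.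
  by rewrite !(cabsX, cabsM) cabs_8V (cabs_nat R).
move=> E; apply: (@le_trans _ _ (n%:R * (cabs w ^+ n) ^+ 2 / 8)).
  have : (2^-1) ^+ 2 <= (cabs w ^+ n) ^+ 2 by rewrite lerXn2r ?nnegrE ?exprn_ge0 ?cabs_ge0.
  have : 0 <= n%:R :> R by [].
  by move: ((cabs w ^+ n) ^+ 2) (n%:R : R) => y k; nra.
by rewrite -E ler_piMl ?cabs_ge0.
Qed.

(* For |c| = 1 this is a block of the series of - log (1 - c z): it vanishes to order p at 0
   and is of size log p at the point w with c w = |w|, when 1 - |w| is of order 1/p^2. *)
Definition testlog (p : nat) c : C -> C := fun z =>
  \sum_(i < p ^ 2 - p) mono (8^-1 * (c ^+ (p + i) / (p + i)%:R)) (p + i) z.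

Lemma hol_testlog p c : hol (testlog p c).
Proof.
by apply: (@hol_sum R _ (fun i z => mono (8^-1 * (c ^+ (p + i) / (p + i)%:R)) (p + i) z)) => i _; exact: hol_mono.
Qed.

Lemma dC_testlog p c z : (0 < p)%N ->
  dC (testlog p c) z = 8^-1 * c * \sum_(i < p ^ 2 - p) (c * z) ^+ (p.-1 + i).
Proof.
case: p => // p _.
have H := @cdiff_sum R (p.+1 ^ 2 - p.+1) (fun i z => mono (8^-1 * (c ^+ (p.+1 + i) / (p.+1 + i)%:R)) (p.+1 + i) z)
  (fun i => 8^-1 * (c ^+ (p.+1 + i) / (p.+1 + i)%:R) * ((p.+1 + i)%:R * z ^+ (p.+1 + i).-1 * 1)) z.
rewrite (cdiff_dC (H _)); last first.
  by move=> i _; apply: cdiffZ; exact: (cdiffX _ (cdiff_id z)).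
rewrite mulr_sumr; apply: eq_bigr => i _; rewrite addSn /= exprMn exprS.
have : (p + i).+1%:R != 0 :> C by rewrite pnatr_eq0.
by move: ((p + i).+1%:R : C) => k nz; field.
Qed.

Lemma geometric_sum_le (v : C) q m (r : R) : cabs v <= r -> r < 1 ->
  cabs (\sum_(i < m) v ^+ (q + i)) * (1 - r) <= 2 * cabs v ^+ q.
Proof.
move=> vr r1; have v0 := cabs_ge0 v.
have E : (\sum_(i < m) v ^+ (q + i)) * (1 - v) = v ^+ q * (1 - v ^+ m).
  elim: m => [|m ih]; first by rewrite big_ord0 mul0r expr0 subrr mulr0.
  by rewrite big_ord_recr /= mulrDl ih exprD exprS; ring.
have h : 1 - r <= cabs (1 - v) by have := cabs_subr 1 v; rewrite cabs1; lra.
apply: (@le_trans _ _ (cabs (v ^+ q * (1 - v ^+ m)))).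
  by rewrite -E cabsM ler_wpM2l ?cabs_ge0.
rewrite cabsM cabsX mulrC ler_wpM2r ?exprn_ge0//.
apply: le_trans (cabsB _ _) _; rewrite cabs1 cabsX.
have : cabs v ^+ m <= 1 by rewrite exprn_ile1//; lra.
by lra.
Qed.

(** With r = |z| this is the Bloch bound; with r fixed and p large it is local smallness. *)
Lemma testlog_dC_le p c z (r : R) : (0 < p)%N -> cabs c = 1 -> cabs z <= r -> r < 1 ->
  cabs (dC (testlog p c) z) * (1 - r) <= 4^-1 * r ^+ p.-1.
Proof.
move=> p0 c1 zr r1; rewrite dC_testlog// !cabsM c1 cabs_8V mulr1 -mulrA.
have cz : cabs (c * z) = cabs z by rewrite cabsM c1 mul1r.
have zr' : cabs (c * z) <= r by rewrite cz.
have := @geometric_sum_le (c * z) p.-1 (p ^ 2 - p) r zr' r1.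
rewrite cz; have : cabs z ^+ p.-1 <= r ^+ p.-1.
  by rewrite lerXn2r ?nnegrE ?cabs_ge0//; apply: le_trans zr; exact: cabs_ge0.
lra.
Qed.

Lemma bump_testlog p c : (0 < p)%N -> cabs c = 1 -> bloch_bump (testlog p c).
Proof.
move=> p0 c1; split.
- exact: hol_testlog.
- by rewrite /testlog big1// => i _; rewrite /mono expr0n addn_eq0 eqn0Ngt p0 mulr0.
- move=> z zD; have := testlog_dC_le p0 c1 (lexx _) zD.
  have z0 := cabs_ge0 z; have z1 := disk_le1 zD.
  have : cabs z ^+ p.-1 <= 1 by rewrite exprn_ile1.
  move: (cabs z ^+ p.-1) => y y1; have := cabs_ge0 (dC (testlog p c) z).
  move: (cabs (dC (testlog p c) z)) z0 z1; move: (cabs z) => x d x0 x1 d0 h.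
  have -> : (1 - x ^+ 2) * d = (d * (1 - x)) * (1 + x) by ring.
  have : (d * (1 - x)) * (1 + x) <= 2^-1 * 2.
    by apply: ler_pM; [rewrite mulr_ge0//; lra|lra|lra|lra].
  lra.
- exists (8^-1 * (p ^ 2 - p)%:R); first by rewrite mulr_ge0.
  move=> z zD; rewrite dC_testlog// !cabsM c1 mulr1 cabs_8V ler_pM2l//.
  apply: le_trans (cabs_sum _ _ _) _.
  apply: (@le_trans _ _ (\sum_(i < p ^ 2 - p) 1)); last by rewrite sumr_const card_ord.
  apply: ler_sum => i _; rewrite cabsX cabsM c1 mul1r exprn_ile1 ?cabs_ge0//.
  exact: disk_le1.
Qed.

(** Telescopes ln (1 + 1/q) <= 1/q over q from p to p + m - 1. *)
Lemma ln_harmonic p m : (0 < p)%N -> ln ((p + m)%:R / p%:R : R) <= \sum_(i < m) ((p + i)%:R)^-1.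
Proof.
move=> p0; elim: m => [|m ih].
  by rewrite addn0 divff ?ln1 ?big_ord0// pnatr_eq0 -lt0n.
rewrite big_ord_recr /=.
have q0 : 0 < (p + m)%:R :> R by rewrite ltr0n addn_gt0 p0.
have p1 : 0 < p%:R :> R by rewrite ltr0n.
have -> : (p + m.+1)%:R / p%:R = (p + m)%:R / p%:R * (1 + (p + m)%:R^-1) :> R.
  rewrite addnS -natr1; move: ((p + m)%:R : R) (p%:R : R) q0 p1 => x y x0 y0.
  by field; rewrite !lt0r_neq0.
have s1 : 0 < (p + m)%:R / p%:R :> R by rewrite divr_gt0.
have s2 : 0 < 1 + (p + m)%:R^-1 :> R by rewrite addr_gt0 ?invr_gt0.
rewrite lnM ?posrE//.
apply: lerD => //.
have := @expR_ge1Dx R ((p + m)%:R^-1) => h.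
by rewrite -[leRHS]expRK ler_ln ?posrE ?expR_gt0.
Qed.

(** Since c w = |w|, all terms are nonnegative reals and cannot cancel; each power of |w| is at
    least 1/2, and the harmonic sum from p to p^2 - 1 is at least ln (p^2 / p). *)
Lemma testlog_value p w : (0 < p)%N -> w != 0 -> disk w -> 2^-1 <= cabs w ^+ (p ^ 2) ->
  16^-1 * ln (p%:R : R) <= cabs (testlog p ((w^*)%C / (cabs w)%:C%C) w).
Proof.
move=> p0 w0 wD hw; set c := _ / _.
have m0 : 0 < cabs w by rewrite cabs_gt0.
have cw : c * w = (cabs w)%:C%C.
  rewrite /c mulrAC mul_conj expr2 rmorphM /=; field.
  by apply/eqP => -[] /eqP; rewrite gt_eqF.
have E : testlog p c w = (\sum_(i < p ^ 2 - p) (8^-1 * (cabs w ^+ (p + i) / (p + i)%:R)))%:C%C.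
  rewrite rmorph_sum /=; apply: eq_bigr => i _.
  rewrite /mono rmorphM rmorphM /= !fmorphV /= !(rmorph_nat (real_complex R)) rmorphXn /= -cw (exprMn _ c w).
  by ring.
rewrite E cabsC.
have T i : (i < p ^ 2 - p)%N -> 16^-1 * ((p + i)%:R)^-1 <= 8^-1 * (cabs w ^+ (p + i) / (p + i)%:R) :> R.
  move=> ilt; have : 2^-1 <= cabs w ^+ (p + i).
    apply: le_trans hw _; rewrite ler_wiXn2l//; [exact: ltW|exact: disk_le1|lia].
  have : 0 <= ((p + i)%:R)^-1 :> R by rewrite invr_ge0.
  by move: (((p + i)%:R)^-1) (cabs w ^+ _) => y x; nra.
apply: le_trans (ler_norm _).
apply: (@le_trans _ _ (\sum_(i < p ^ 2 - p) 16^-1 * ((p + i)%:R)^-1)); last first.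
  by apply: ler_sum => i _; exact: T.
rewrite -mulr_sumr ler_pM2l//.
have := @ln_harmonic p (p ^ 2 - p) p0; rewrite subnKC; last by rewrite -{1}(expn1 p) leq_pexp2l.
rewrite natrX expr2 mulfK// pnatr_eq0 -lt0n//.
Qed.

End TestFunctions.

(** * Pointwise bounds on the coefficients from the essential norm *)

Section EssentialNorm.
Variable R : realType.
Local Notation C := (R[i]).
Implicit Types (w z : C) (d : R).

(** [testlog] has exponents up to about p^2, so p^2, rather than p, has to be of order 1 / (2 d). *)
Definition lscale d : nat := Num.truncn (Num.sqrt (2 * d)^-1).

Lemma lscaleP d : 0 < d -> d <= 64^-1 ->
  [/\ (0 < lscale d)%N, (lscale d)%:R ^+ 2 * d <= 2^-1 & - ln d <= 4 * ln (lscale d)%:R].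
Proof.
move=> d0 d1; set y := (2 * d)^-1; have y0 : 0 < y by rewrite invr_gt0; lra.
have yd : y * d = 2^-1 by rewrite /y; field; exact: lt0r_neq0.
have y32 : 32 <= y.
  have : 32 * d <= y * d by rewrite yd; lra.
  by rewrite ler_pM2r.
have sy := sqr_sqrtr (ltW y0); have s0 : 0 <= Num.sqrt y by exact: sqrtr_ge0.
have s1 : 1 <= Num.sqrt y by rewrite -(@sqrtr1 R) ler_wsqrtr//; lra.
have /andP[] := truncn_itv s0; rewrite -/(lscale d).
have p1 : (0 < lscale d)%N by rewrite truncn_gt0.
have : 1 <= (lscale d)%:R :> R by rewrite ler1n.
rewrite -natr1; have p0 : 0 < (lscale d)%:R :> R by rewrite ltr0n.
move: ((lscale d)%:R : R) p0 => p p0 p1' h1 h2; split => //.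
  by rewrite -yd ler_pM2r// -sy lerXn2r ?nnegrE//; lra.
have h3 : y <= 4 * p ^+ 2.
  have : y <= (2 * p) ^+ 2 by rewrite -sy lerXn2r ?nnegrE//; lra.
  by rewrite exprMn; lra.
have -> : 4 * ln p = ln (p ^+ 4) by rewrite lnXn// mulr_natl.
rewrite -lnV ?posrE// ler_ln ?posrE ?invr_gt0 ?exprn_gt0//.
have h4 : 8^-1 <= p ^+ 2 * d.
  have : y * d <= (4 * p ^+ 2) * d by rewrite ler_pM2r.
  by rewrite yd; lra.
rewrite -[leLHS]mul1r ler_pdivrMr//.
(* From p^2 d >= 1/8 and d <= 1/64 = (1/8)^2 follows p^4 d >= 1; this is the origin of 64. *)
have -> : p ^+ 4 * d = (p ^+ 2 * d) ^+ 2 / d by field; exact: lt0r_neq0.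
rewrite ler_pdivlMr// mul1r; apply: (le_trans d1).
have -> : 64^-1 = (8^-1) ^+ 2 :> R by field.
by rewrite lerXn2r ?nnegrE//; lra.
Qed.

Lemma lscale_large N : exists2 s : R, s < 1 & forall x, s < x -> x < 1 ->
  [/\ 0 < 1 - x, 1 - x <= 64^-1 & (N <= lscale (1 - x))%N].
Proof.
have [e eE] : exists e : R, e = (N.+1%:R ^+ 2)^-1 by eexists.
have n2 : 1 <= N.+1%:R ^+ 2 :> R by apply: exprn_ege1; rewrite ler1n.
have e0 : 0 < e by rewrite eE invr_gt0; lra.
have e1 : e <= 1 by rewrite eE invf_le1//; lra.
exists (1 - 64^-1 * e); first lra.
move=> x xs x1; have d0 : 0 < 1 - x by lra.
have d4 : 1 - x <= 64^-1 by lra.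
split => //; rewrite truncn_ge_nat ?sqrtr_ge0//.
apply: (@le_trans _ _ N.+1%:R); first by rewrite ler_nat.
rewrite -[leLHS]ger0_norm// -sqrtr_sqr ler_wsqrtr//.
rewrite -[leLHS]invrK -eE lef_pV2 ?posrE ?mulr_gt0//; lra.
Qed.

Lemma vanishing_index (rho d : R) : 0 <= rho -> rho < 1 -> 0 < d -> exists N : nat,
  forall n, (N <= n)%N -> (0 < n)%N /\ n%:R * rho ^+ n.-1 <= d.
Proof.
move=> r0 r1 d0; have [||N hN] := @weight_vanishes R rho d; [by rewrite r0|by []|].
exists N.+1 => -[//|n] Nn; split => //=; apply: le_trans (hN n Nn).
rewrite expr2 -mulrA ler_peMl// ?ler1n//.
by rewrite mulr_ge0// exprn_ge0.
Qed.

Section Operator.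
Variables (beta : R) (u phi : C -> C).
Hypotheses (hu : hol u) (hphi : holmap phi) (hb : bounded_op beta (wcomp u phi)).

Local Notation U := (wabs beta (coefU u)).
Local Notation V := (wabs beta (coefV u phi)).
Local Notation W := (wabs beta (coefW u phi)).
Local Notation del z := (1 - cabs (phi z)).

(** The reverse triangle inequality for (u C_phi f)'', solved for each of the three terms. *)
Lemma wcomp_coef_lower f z : hol f -> disk z ->
  [/\ W z * cabs (dC (dC f) (phi z)) <= wgt beta z * cabs (dC (dC (wcomp u phi f)) z) +
        U z * cabs (f (phi z)) + V z * cabs (dC f (phi z)),
      V z * cabs (dC f (phi z)) <= wgt beta z * cabs (dC (dC (wcomp u phi f)) z) +
        U z * cabs (f (phi z)) + W z * cabs (dC (dC f) (phi z)) &
      U z * cabs (f (phi z)) <= wgt beta z * cabs (dC (dC (wcomp u phi f)) z) +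
        V z * cabs (dC f (phi z)) + W z * cabs (dC (dC f) (phi z))].
Proof.
move=> hf zD; rewrite (dC2_wcompE hu hphi hf zD) /wabs; have := wgt_ge0 beta z.
move: (wgt beta z) (coefU u z) (coefV u phi z) (coefW u phi z) (f _) (dC f _) (dC (dC f) _).
move=> k x y t p q s k0.
have A (a b c : C) : k * cabs a <= k * cabs (a + (b + c)) + k * cabs b + k * cabs c.
  rewrite -!mulrDr ler_wpM2l//.
  have := cabsB (a + (b + c)) (b + c); rewrite addrK => h; have := cabsD b c; lra.
rewrite -!mulrA -!cabsM; split.
- by have := A (t * s) (x * p) (y * q); rewrite (_ : t * s + _ = x * p + y * q + t * s)//; ring.
- by have := A (y * q) (x * p) (t * s); rewrite (_ : y * q + _ = x * p + y * q + t * s)//; ring.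
- by have := A (x * p) (y * q) (t * s); rewrite addrA.
Qed.

(** A triangular elimination at w = phi z: [test2] leaves only the W term, [test1] the V and W
    terms, [testlog] all three, and each bound enters the next. *)
Lemma essnorm_lower K (t e : R) : compact_op beta K ->
  (opnorm beta (fun f z => wcomp u phi f z - K f z)%R <= t%:E)%E -> 0 <= t -> 0 < e ->
  exists2 s : R, s < 1 & forall z, disk z -> s < cabs (phi z) ->
    [/\ U z * - ln (del z) <= 64 * (1 + 128 * (1 + 4 * 512) + 4 * 512) * (t + e),
        V z <= 128 * (1 + 4 * 512) * (t + e) * del z &
        W z <= 512 * (t + e) * del z ^+ 2].
Proof.
move=> cK ht t0 e0; set T := t + e; have T0 : 0 < T by rewrite /T; lra.
have [sa sa1 ha] := scale_large R 1.
have pw w n : disk w -> cabs (w ^+ n) <= 1.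
  by move=> wD; rewrite cabsX exprn_ile1 ?cabs_ge0// disk_le1.
have loc (F : nat -> C -> C -> C) :
  (forall n x (rho : R) z, (0 < n)%N -> cabs x <= 1 -> 0 <= rho -> rho < 1 ->
    cabs z <= rho -> cabs (dC (F n x) z) <= n%:R * rho ^+ n.-1) ->
  forall rho d : R, 0 <= rho -> rho < 1 -> 0 < d -> exists2 s : R, s < 1 & forall w, disk w -> s < cabs w ->
     forall z, cabs z <= rho -> cabs (dC (F (scale (1 - cabs w)) (w ^+ scale (1 - cabs w))) z) <= d.
  move=> hF rho d r0 r1 d0; have [N hN] := vanishing_index r0 r1 d0.
  have [s s1 hs] := scale_large R N; exists s => // w wD ws z zr.
  have [_ _ /hN[n0 hn]] := hs _ ws wD; apply: le_trans hn.
  by apply: hF => //; exact: pw.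
have b2 w : disk w -> sa < cabs w -> bloch_bump (test2 (scale (1 - cabs w)) (w ^+ scale (1 - cabs w))).
  by move=> wD wa; have [_ _ n0] := ha _ wa wD; apply: bump_test2 => //; exact: pw.
have b1 w : disk w -> sa < cabs w -> bloch_bump (test1 (scale (1 - cabs w)) (w ^+ scale (1 - cabs w))).
  by move=> wD wa; have [_ _ n0] := ha _ wa wD; apply: bump_test1 => //; exact: pw.
have [s2 s21 h2] := test_family hu hphi hb cK ht sa1 b2 (loc _ (@test2_local R)) e0.
have [s3 s31 h3] := test_family hu hphi hb cK ht sa1 b1 (loc _ (@test1_local R)) e0.
have [sl sl1 hl] := lscale_large 1.
pose cc w := (w^*)%C / (cabs w)%:C%C.
have cc1 w : w != 0 -> cabs (cc w) = 1.
  by move=> w0; rewrite cabsM cabsV cabs_conj cabsC ger0_norm ?cabs_ge0// divff// gt_eqF// cabs_gt0.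
(* The maximum with 0 excludes w = 0, where [cc w] would not have modulus 1. *)
pose s0 := Num.max 0 sl; have s01 : s0 < 1 by rewrite gt_max ltr01.
have b3 w : disk w -> s0 < cabs w -> bloch_bump (testlog (lscale (1 - cabs w)) (cc w)).
  move=> wD; rewrite gt_max cabs_gt0 => /andP[w0 wl].
  by have [_ _ n0] := hl _ wl wD; apply: bump_testlog => //; exact: cc1.
have loc3 (rho d : R) : 0 <= rho -> rho < 1 -> 0 < d -> exists2 s : R, s < 1 & forall w, disk w -> s < cabs w ->
     forall z, cabs z <= rho -> cabs (dC (testlog (lscale (1 - cabs w)) (cc w)) z) <= d.
  move=> r0 r1 d0; have [||N hN] := @expn_small R rho (d * (1 - rho)); [by rewrite r0|by rewrite mulr_gt0// subr_gt0|].
  (* One more than N, because the exponent in [testlog_dC_le] is p - 1. *)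
  have [s s1 hs] := lscale_large N.+1; exists (Num.max 0 s); first by rewrite gt_max ltr01.
  move=> w wD; rewrite gt_max cabs_gt0 => /andP[w0 ws] z zr.
  have [_ _ n0] := hs _ ws wD.
  have p0 : (0 < lscale (1 - cabs w))%N by exact: leq_trans n0.
  have := testlog_dC_le p0 (cc1 _ w0) zr r1.
  have : rho ^+ (lscale (1 - cabs w)).-1 <= rho ^+ N.
    by rewrite ler_wiXn2l//; [exact: ltW|move: n0; case: (lscale _)].
  have : 0 <= rho ^+ N by rewrite exprn_ge0.
  move=> x0 x1 x2; have : cabs (dC (testlog (lscale (1 - cabs w)) (cc w)) z) * (1 - rho) <= d * (1 - rho) by lra.
  by rewrite ler_pM2r// subr_gt0.
have [s4 s41 h4] := test_family hu hphi hb cK ht s01 b3 loc3 e0.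
exists (Num.max (Num.max s2 s3) (Num.max s4 (Num.max sa s0))).
  by rewrite !gt_max s21 s31 s41 sa1 ltr01 sl1.
move=> z zD; rewrite !gt_max => /andP[/andP[/(h2 z zD) {}h2 /(h3 z zD) {}h3]].
move=> /andP[/(h4 z zD) {}h4 /andP[za /andP[z0 zl]]].
have wD := hphi.2 _ zD; move: h2 h3 h4; rewrite -/T; set w := phi z in za z0 zl wD *.
have w0 : w != 0 by rewrite -cabs_gt0.
have [d0 d4 n0] := ha _ za wD; have [nd n4 _] := scaleP d0 d4.
have wn := pow_scale wD (cabs_ge0 w) nd.
have [_ d64 _] := hl _ zl wD; have [p0 pd lnp] := lscaleP d0 d64.
have wp : 2^-1 <= cabs w ^+ (lscale (1 - cabs w) ^ 2).
  by apply: (pow_scale wD (cabs_ge0 w)); rewrite natrX.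
have hb2 := b2 w wD za; have hb1 := b1 w wD za.
have hb3 : bloch_bump (testlog (lscale (1 - cabs w)) (cc w)).
  by apply: b3 => //; rewrite gt_max z0.
have v2 := test2_value (scale (1 - cabs w)) w.
have v2' := test2_dC (scale (1 - cabs w)) wD w0.
have v2'' := test2_dC2_lower wD w0 wn.
have v1 := test1_value (scale (1 - cabs w)) w.
have v1' := test1_dC_lower wD wn.
have v3 := testlog_value p0 w0 wD wp; rewrite -/(cc w) in v3.
move: (scale (1 - cabs w)) n0 nd n4 wn hb2 hb1 v2 v2' v2'' v1 v1' => n n0 nd n4 wn hb2 hb1 v2 v2' v2'' v1 v1'.
move: (lscale (1 - cabs w)) p0 pd lnp wp hb3 v3 => p p0 pd lnp wp hb3 v3 h2 h3 h4.
have [hf2 _ _ _] := hb2; have [hf1 _ f1b _] := hb1; have [hf3 _ f3b _] := hb3.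
have [g2 _ _] := wcomp_coef_lower hf2 zD; rewrite -/w v2 v2' cabs0 !mulr0 !addr0 in g2.
have [_ g1 _] := wcomp_coef_lower hf1 zD; rewrite -/w v1 cabs0 mulr0 addr0 in g1.
have [_ _ g3] := wcomp_coef_lower hf3 zD; rewrite -/w in g3.
have U0 := wabs_ge0 beta (coefU u) z; have V0 := wabs_ge0 beta (coefV u phi) z.
have W0 := wabs_ge0 beta (coefW u phi) z.
have e1 := bloch_dC2 hf1 f1b wD; have e3 := bloch_dC2 hf3 f3b wD; have e3' := bloch_dC f3b wD.
rewrite expr1 in e3'.
move: U0 V0 W0 g1 g2 g3 e1 e3 e3' v2'' v1' v3 h2 h3 h4.
move: (U z) (V z) (W z) => X Y Z X0 Y0 Z0.
move: (cabs (dC (dC (test2 n (w ^+ n))) w)) (cabs (dC (test1 n (w ^+ n)) w)) (cabs (dC (dC (test1 n (w ^+ n))) w)).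
move: (cabs (testlog p (cc w) w)) (cabs (dC (testlog p (cc w)) w)) (cabs (dC (dC (testlog p (cc w))) w)).
move: d0 n4 nd lnp; set d := 1 - cabs w => d0 n4 nd lnp.
move=> L0 L1 L2 B2 A1 A2 g1 g2 g3 e1 e3 e3' v2'' v1' v3 h2 h3 h4.
have d2 : 0 < d ^+ 2 by rewrite exprn_gt0.
have nd4 : 4^-1 <= n%:R * d.
  have : (4 * d)^-1 * d <= n%:R * d by rewrite ler_pM2r.
  by rewrite (_ : (4 * d)^-1 * d = 4^-1)//; field; exact: lt0r_neq0.
(* The factor 512 is 32 * 16, from |f''| >= n^2 / 32 and n d >= 1/4. *)
have WB : Z <= 512 * T * d ^+ 2.
  have {}g2 : Z * B2 <= T by exact: le_trans h2.
  have n16 : 16^-1 <= (n%:R * d) ^+ 2.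
    by rewrite (_ : 16^-1 = 4^-1 ^+ 2 :> R); [rewrite lerXn2r ?nnegrE//; lra|field].
  have h5 : Z * (n%:R ^+ 2 / 32) <= T by apply: le_trans g2; rewrite ler_wpM2l.
  have h6 : Z * (n%:R ^+ 2 / 32) * d ^+ 2 <= T * d ^+ 2 by rewrite ler_pM2r.
  have h7 : Z * 16^-1 <= Z * (n%:R * d) ^+ 2 by rewrite ler_wpM2l.
  have h8 : Z * (n%:R ^+ 2 / 32) * d ^+ 2 = Z * (n%:R * d) ^+ 2 / 32 by field.
  by rewrite h8 in h6; lra.
(* A test function of seminorm 1 has |f''| <= 4 / d^2 at w, so by [WB] its W term is at most 4 * 512
   T. *)
have W4 a : a * d ^+ 2 <= 4 * 1 -> Z * a <= 4 * 512 * T.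
  move=> ha4; have h5 : (Z * a) * d ^+ 2 <= (4 * 512 * T) * d ^+ 2; last by rewrite ler_pM2r in h5.
  have h6 : Z * (a * d ^+ 2) <= Z * (4 * 1) by rewrite ler_wpM2l.
  by lra.
(* The factor 128 is 32 * 4, from |f'| >= n / 32 and n d >= 1/4. *)
have VB : Y <= 128 * (1 + 4 * 512) * T * d.
  have h5 : Y * A1 <= (1 + 4 * 512) * T by have := W4 _ e1; lra.
  have h6 : Y * (n%:R / 32) <= Y * A1 by rewrite ler_wpM2l.
  have h7 : Y * (n%:R / 32) * d <= (1 + 4 * 512) * T * d by rewrite ler_pM2r//; exact: le_trans h5.
  have h8 : Y * 4^-1 <= Y * (n%:R * d) by rewrite ler_wpM2l.
  have h9 : Y * (n%:R / 32) * d = Y * (n%:R * d) / 32 by field.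
  by rewrite h9 in h7; lra.
split => //.
have h5 : Y * L1 <= 128 * (1 + 4 * 512) * T.
  have h6 : (Y * L1) * d <= (128 * (1 + 4 * 512) * T) * d; last by rewrite ler_pM2r in h6.
  have h7 : Y * (L1 * d) <= Y * 1 by rewrite ler_wpM2l.
  by lra.
have h6 := W4 _ e3.
have h7 : X * L0 <= (1 + 128 * (1 + 4 * 512) + 4 * 512) * T by lra.
(* The factor 64 is 16 * 4: the value is at least ln p / 16, and -ln d <= 4 ln p. *)
have h8 : X * (16^-1 * ln p%:R) <= X * L0 by rewrite ler_wpM2l.
have h9 : X * - ln d <= X * (4 * ln p%:R) by rewrite ler_wpM2l.
lra.
Qed.

End Operator.

End EssentialNorm.

(** * From pointwise bounds to the three limits superior *)

Section MainTheorem.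
Variable R : realType.
Local Notation C := (R[i]).
Variables (beta : R) (u phi : C -> C).
Hypotheses (hu : hol u) (hphi : holmap phi) (hb : bounded_op beta (wcomp u phi)).

Local Notation U := (wabs beta (coefU u)).
Local Notation V := (wabs beta (coefV u phi)).
Local Notation W := (wabs beta (coefW u phi)).

Definition limsupV : \bar R := limn_esup (fun n : nat => ((n.+1)%:R)%:E *
  nu_norm beta (fun z => (coefV u phi z * phi z ^+ n)%R))%E.
Definition limsupW : \bar R := limn_esup (fun n : nat => ((n.+1)%:R ^+ 2)%R%:E *
  nu_norm beta (fun z => (coefW u phi z * phi z ^+ n)%R))%E.
Definition limsupU : \bar R := limn_esup (fun n : nat => (ln (n%:R : R))%:E *
  nu_norm beta (fun z => (coefU u z * phi z ^+ n)%R))%E.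

(** For each z only the index n = [scale (1 - cabs (phi z))] is used, at which |phi z|^n >= 1/2. The
    worst loss is the factor 8 for W, and 112 = 14 * 8. *)
Lemma essnorm_le_limsup (m : R) : 0 < m -> (limsupU < m%:E)%E -> (limsupV < m%:E)%E ->
  (limsupW < m%:E)%E -> (essnorm beta (wcomp u phi) <= (112 * m)%:E)%E.
Proof.
move=> m0 /limn_esup_lt[N1 h1] /limn_esup_lt[N2 h2] /limn_esup_lt[N3 h3].
pose N := maxn N1 (maxn N2 N3).
have [s s1 hs] := scale_large R N.
have [sl sl1 hl] := @lscale_large R 0.
have -> : 112 * m = 14 * (8 * m) by ring.
apply: (essnorm_upper hu hphi hb (s0 := Num.max s sl)); [lra|by rewrite gt_max s1|].
move=> z zD; rewrite gt_max => /andP[zs zl]; have wD := hphi.2 _ zD.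
have [d0 d4 nN] := hs _ zs wD; have [_ d64 _] := hl _ zl wD.
have [nd n4 n2] := scaleP d0 d4; have wn := pow_scale wD (cabs_ge0 _) nd.
move: nN; rewrite !geq_max => /and3P[/h1{}h1 /h2{}h2 /h3{}h3].
have nn0 := ler0n R (scale (1 - cabs (phi z))).+1.
have {h1}:= iffLR (mul_nu_norm_leP _ _ _ (ln_nat_ge0 R _)) h1 z zD.
have {h2}:= iffLR (mul_nu_norm_leP _ _ _ nn0) h2 z zD.
have {h3}:= iffLR (mul_nu_norm_leP _ _ _ (sqr_ge0 _)) h3 z zD.
rewrite (wabs_pow _ (coefU u)) (wabs_pow _ (coefV u phi)) (wabs_pow _ (coefW u phi)).
have := wabs_ge0 beta (coefU u) z; have := wabs_ge0 beta (coefV u phi) z.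
have := wabs_ge0 beta (coefW u phi) z.
move: (U z) (V z) (W z) => X Y Z.
(* With d = 1 - |phi z|, n >= 1 / (4 d) gives n^2 >= 1 / (16 d^2), which is at least 1 / d since d
   <= 1/64. *)
have lnn : - ln (1 - cabs (phi z)) <= 2 * ln (scale (1 - cabs (phi z)))%:R.
  have p0 : 0 < (4 * (1 - cabs (phi z)))^-1 by rewrite invr_gt0 mulr_gt0.
  have n0 : 0 < (scale (1 - cabs (phi z)))%:R :> R by exact: lt_le_trans n4.
  rewrite mulr_natl -lnXn// -lnV ?posrE// ler_ln ?posrE ?invr_gt0 ?exprn_gt0//.
  apply: (@le_trans _ _ ((4 * (1 - cabs (phi z)))^-1 ^+ 2)); last first.
    by rewrite lerXn2r ?nnegrE ?(ltW p0) ?(ltW n0).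
  move: d0 d64; move: (1 - cabs (phi z)) => d d0 d64.
  rewrite (_ : (4 * d)^-1 ^+ 2 = d^-1 * (16 * d)^-1); last by field; exact: lt0r_neq0.
  rewrite ler_peMr ?invr_ge0 ?(ltW d0)//.
  by rewrite invf_ge1 ?mulr_gt0//; lra.
move: (scale (1 - cabs (phi z))) nd n4 n2 wn lnn nn0 => n nd n4 n2 wn lnn nn0.
move: (cabs (phi z)) d0 nd n4 n2 wn lnn => {zs zl d4 d64 wD} w d0 nd n4 n2 wn lnn Z0 Y0 X0.
move: (w ^+ n) wn => x wn hW hV hU.
have n2' : 2^-1 <= n.+1%:R * (1 - w).
  have : (2 * (1 - w))^-1 * (1 - w) <= n.+1%:R * (1 - w) by rewrite ler_pM2r.
  by rewrite (_ : (2 * (1 - w))^-1 * (1 - w) = 2^-1)//; field; exact: lt0r_neq0.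
split.
- have : X * 2^-1 <= X * x by rewrite ler_wpM2l.
  have l0 := ln_nat_ge0 R n.
  move=> h; have : ln n%:R * (X * 2^-1) <= m by apply: le_trans hU; rewrite ler_wpM2l.
  have : X * - ln (1 - w) <= X * (2 * ln n%:R) by rewrite ler_wpM2l.
  by lra.
- have : Y * 2^-1 <= Y * x by rewrite ler_wpM2l.
  move=> h; have h5 : n.+1%:R * (Y * 2^-1) <= m by apply: le_trans hV; rewrite ler_wpM2l.
  have h6 : n.+1%:R * (Y * 2^-1) * (1 - w) <= m * (1 - w) by rewrite ler_pM2r.
  have h7 : Y * 2^-1 <= Y * (n.+1%:R * (1 - w)) by rewrite ler_wpM2l.
  have : 0 <= m * (1 - w) by rewrite mulr_ge0 ?(ltW m0) ?(ltW d0).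
  have E : n.+1%:R * (Y * 2^-1) * (1 - w) = Y * (n.+1%:R * (1 - w)) * 2^-1 by ring.
  by rewrite E in h6; lra.
- have : Z * 2^-1 <= Z * x by rewrite ler_wpM2l.
  have q0 : 0 <= n.+1%:R ^+ 2 :> R by rewrite sqr_ge0.
  move=> h; have h5 : n.+1%:R ^+ 2 * (Z * 2^-1) <= m by apply: le_trans hW; rewrite ler_wpM2l.
  have d2 : 0 < (1 - w) ^+ 2 by rewrite exprn_gt0.
  have h6 : n.+1%:R ^+ 2 * (Z * 2^-1) * (1 - w) ^+ 2 <= m * (1 - w) ^+ 2 by rewrite ler_pM2r.
  have h8 : 4^-1 <= (n.+1%:R * (1 - w)) ^+ 2.
    by rewrite (_ : 4^-1 = 2^-1 ^+ 2 :> R); [rewrite lerXn2r ?nnegrE//; lra|field].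
  have h7 : Z * 4^-1 <= Z * (n.+1%:R * (1 - w)) ^+ 2 by rewrite ler_wpM2l.
  have E : n.+1%:R ^+ 2 * (Z * 2^-1) * (1 - w) ^+ 2 = Z * (n.+1%:R * (1 - w)) ^+ 2 * 2^-1 by ring.
  by rewrite E in h6; lra.
Qed.

(** Near the circle the weights are absorbed by [log_weight], [geometric_weight] and
    [geometric_weight2]; the last gives the factor 4. Elsewhere they tend to 0 uniformly against
    bounded coefficients. *)
Lemma limsup_le (A s0 : R) : 0 < A -> s0 < 1 ->
  (forall z, disk z -> s0 < cabs (phi z) ->
    [/\ U z * - ln (1 - cabs (phi z)) <= A,
        V z <= A * (1 - cabs (phi z)) &
        W z <= A * (1 - cabs (phi z)) ^+ 2]) ->
  [/\ (limsupU <= (4 * A)%:E)%E, (limsupV <= (4 * A)%:E)%E & (limsupW <= (4 * A)%:E)%E].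
Proof.
move=> A0 s01 hA; have [B B0 hB] := coef_bounded hu hphi hb.
(* Beyond 1 - 1/e the logarithm is at least 1, so it absorbs the summand 1 of [log_weight]. *)
pose s : R := Num.max (Num.max 0 s0) (1 - expR (-1)).
have s1 : s < 1 by rewrite !gt_max ltr01 s01 /= ltrBlDr ltrDl expR_gt0.
have sp : 0 <= s by rewrite !le_max lexx.
have [||N hN] := @weight_vanishes R s (A / (B + 1)); [by rewrite sp|by apply: divr_gt0 => //; lra|].
have small n z : (N <= n)%N -> disk z -> cabs (phi z) <= s -> forall X k : R, 0 <= X -> X <= B ->
    0 <= k -> k <= n.+1%:R ^+ 2 -> k * (X * cabs (phi z) ^+ n) <= 4 * A.
  move=> Nn zD zs X k X0 XB k0 kn.
  have h1 := hN n Nn; have x0 : 0 <= cabs (phi z) ^+ n by rewrite exprn_ge0 ?cabs_ge0.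
  have h2 : cabs (phi z) ^+ n <= s ^+ n by rewrite lerXn2r ?nnegrE ?cabs_ge0.
  have h3 : k * cabs (phi z) ^+ n <= A / (B + 1).
    by apply: le_trans h1; apply: ler_pM.
  have h4 : (k * cabs (phi z) ^+ n) * X <= A / (B + 1) * (B + 1).
    by apply: ler_pM => //; [rewrite mulr_ge0|lra].
  have h5 : A / (B + 1) * (B + 1) = A by rewrite divfK//; apply/eqP; lra.
  by rewrite h5 in h4; rewrite mulrCA mulrC; lra.
have near z : disk z -> s < cabs (phi z) -> [/\ U z * - ln (1 - cabs (phi z)) <= A,
        V z <= A * (1 - cabs (phi z)), W z <= A * (1 - cabs (phi z)) ^+ 2,
        1 <= - ln (1 - cabs (phi z)) & 0 <= cabs (phi z) < 1].
  move=> zD; rewrite !gt_max => /andP[/andP[z0 zs] ze]; have wD := hphi.2 _ zD.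
  have [a b c] := hA z zD zs; split => //; last by rewrite (ltW z0).
  have d0 : 0 < 1 - cabs (phi z) by rewrite subr_gt0.
  rewrite -[leLHS]opprK lerN2 -[leRHS]expRK ler_ln ?posrE ?expR_gt0//; lra.
split.
- apply: (@limn_esup_le _ _ _ N) => n Nn.
  apply/(mul_nu_norm_leP _ _ _ (ln_nat_ge0 R n)) => z zD; rewrite wabs_pow.
  have U0 := wabs_ge0 beta (coefU u) z; have l0 := ln_nat_ge0 R n.
  have [zs|zs] := leP (cabs (phi z)) s.
    by apply: small => //; [have [] := hB z zD|exact: ln_nat_le].
  have [a _ _ l1 z01] := near z zD zs; have := log_weight n z01.
  have -> : ln n%:R * (U z * cabs (phi z) ^+ n) = U z * (ln n%:R * cabs (phi z) ^+ n) by ring.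
  move: a U0 l1; move: (U z) (ln n%:R * cabs (phi z) ^+ n) (ln (1 - _)) => X y l a X0 l1 h.
  have h1 : X * y <= X * (- l + 1) by rewrite ler_wpM2l.
  have h2 : X * 1 <= X * - l by rewrite ler_wpM2l.
  by lra.
- apply: (@limn_esup_le _ _ _ N) => n Nn.
  apply/(mul_nu_norm_leP _ _ _ (ler0n R n.+1)) => z zD; rewrite wabs_pow.
  have V0 := wabs_ge0 beta (coefV u phi) z.
  have [zs|zs] := leP (cabs (phi z)) s.
    apply: small => //; first by have [] := hB z zD.
    by rewrite -natrX ler_nat; nia.
  have [_ a _ _ /andP[z0 z1]] := near z zD zs.
  have := @geometric_weight R (cabs (phi z)) n; rewrite z0 (ltW z1) => /(_ isT) h.
  have p : 0 <= n.+1%:R * cabs (phi z) ^+ n by rewrite mulr_ge0 ?exprn_ge0.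
  have -> : n.+1%:R * (V z * cabs (phi z) ^+ n) = V z * (n.+1%:R * cabs (phi z) ^+ n) by ring.
  apply: le_trans (ler_wpM2r p a) _; move: p h.
  by move: (n.+1%:R * cabs (phi z) ^+ n) (cabs (phi z)) => y x y0 h; nra.
- apply: (@limn_esup_le _ _ _ N) => n Nn.
  apply/(mul_nu_norm_leP _ _ _ (sqr_ge0 _)) => z zD; rewrite wabs_pow.
  have W0 := wabs_ge0 beta (coefW u phi) z.
  have [zs|zs] := leP (cabs (phi z)) s.
    by apply: small => //; have [] := hB z zD.
  have [_ _ a _ /andP[z0 z1]] := near z zD zs.
  have := @geometric_weight2 R (cabs (phi z)) n; rewrite z0 (ltW z1) => /(_ isT) h.
  have p : 0 <= n.+1%:R ^+ 2 * cabs (phi z) ^+ n by rewrite mulr_ge0 ?exprn_ge0 ?sqr_ge0.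
  have -> : n.+1%:R ^+ 2 * (W z * cabs (phi z) ^+ n) = W z * (n.+1%:R ^+ 2 * cabs (phi z) ^+ n) by ring.
  apply: le_trans (ler_wpM2r p a) _; rewrite -mulrA mulrC ler_pM2r//.
  by rewrite mulrC.
Qed.

Lemma nu_norm_ge0 (g : C -> C) : (0 <= nu_norm beta g)%E.
Proof. by apply: ereal_sup_disk_ge0; rewrite mulr_ge0 ?wgt_ge0 ?cabs_ge0. Qed.

Lemma limn_esup_ge0 (v : nat -> \bar R) : (forall n, (0 <= v n)%E) -> (0 <= limn_esup v)%E.
Proof.
move=> v0; apply: le_ereal_inf_tmp => _ [X [N _ NX] <-].
apply: le_trans (v0 N) _; apply: ereal_sup_ubound; exists N => //; apply: NX; exact: leqnn.
Qed.

Lemma limsupV_ge0 : (0 <= limsupV)%E.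
Proof. by apply: limn_esup_ge0 => n; rewrite mule_ge0 ?lee_fin ?nu_norm_ge0. Qed.

(** The factor 4 of [limsup_le] times the largest factor in [essnorm_lower], that of U; it exceeds
    112, so it serves both inequalities. *)
Definition ess_const : R := 4 * (64 * (1 + 128 * (1 + 4 * 512) + 4 * 512)).

Lemma essnorm_equiv : let M := maxe limsupV (maxe limsupW limsupU) in
  ((ess_const^-1)%:E * M <= essnorm beta (wcomp u phi))%E /\
  (essnorm beta (wcomp u phi) <= ess_const%:E * M)%E.
Proof.
move=> M; have c0 : 0 < ess_const by rewrite /ess_const; lra.
have M0 : (0 <= M)%E by rewrite le_max limsupV_ge0.
split.
- apply: le_ereal_inf_tmp => _ [K cK <-].
  rewrite lee_pdivrMl//.
  set T := opnorm _ _; have T0 : (0 <= T)%E.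
    apply: (@le_trans _ _ (zyg_norm beta (fun z => wcomp u phi (fun=> 0) z - K (fun=> 0) z))).
      exact: zyg_norm_ge0.
    apply: ereal_sup_ubound; exists (fun=> 0) => //; split; first exact: in_bloch0.
    apply/bloch_normP => z _.
    by rewrite (cdiff_dC (cdiff_cst 0 z)) cabs0 mulr0 addr0.
  have hT : (opnorm beta (fun f z => wcomp u phi f z - K f z)%R <= T)%E by rewrite /T lexx.
  clearbody T; case: T T0 hT => [t||]//; last by move=> _ _; rewrite gt0_muley ?lte_fin// leey.
  rewrite lee_fin => t0 hT; apply/lee_addgt0Pr => e e0.
  (* The slack passed to [essnorm_lower] is multiplied by [ess_const] in the end. *)
  have e1 : 0 < e / ess_const by rewrite divr_gt0.
  have [s s1 hs] := essnorm_lower hu hphi hb cK hT t0 e1.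
  set A := 64 * (1 + 128 * (1 + 4 * 512) + 4 * 512) * (t + e / ess_const).
  have tp : 0 < t + e / ess_const by lra.
  have A0 : 0 < A by rewrite mulr_gt0//; lra.
  have [|hU hV hW] := @limsup_le A s A0 s1.
    move=> z zD zs; have [a b c] := hs z zD zs; have d0 : 0 < 1 - cabs (phi z).
      by rewrite subr_gt0; exact: hphi.2.
    split => //.
      by apply: le_trans b _; rewrite ler_pM2r// ler_pM2r//; lra.
    by apply: le_trans c _; rewrite ler_pM2r ?exprn_gt0// ler_pM2r//; lra.
  have AE : 4 * A = ess_const * t + e.
    by rewrite /A mulrA -/ess_const mulrDr mulrCA divff ?mulr1// lt0r_neq0.
  by rewrite -EFinM -EFinD -AE !ge_max hU hV hW.
- have cM : (112 <= ess_const)%R by rewrite /ess_const; lra.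
  have hM : (maxe limsupV (maxe limsupW limsupU) <= M)%E by rewrite /M lexx.
  clearbody M; case: M M0 hM => [x||]//; last by move=> _ _; rewrite gt0_muley ?lte_fin// leey.
  rewrite lee_fin => x0; rewrite !ge_max => /and3P[hV hW hU].
  (* The excess e / 112 makes m positive even when the maximum is 0, and provides the strict
     inequalities for the limits superior. *)
  apply/lee_addgt0Pr => e e0; pose m := x + e / 112.
  have m0 : 0 < m by rewrite /m; lra.
  have xm : (x%:E < m%:E)%E by rewrite lte_fin /m ltrDl divr_gt0.
  have := essnorm_le_limsup m0 (le_lt_trans hU xm) (le_lt_trans hV xm) (le_lt_trans hW xm).
  move=> /le_trans; apply; rewrite -EFinM -EFinD lee_fin /m mulrDr.
  have -> : 112 * (e / 112) = e by field.
  by rewrite lerD2r ler_wpM2r.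
Qed.

End MainTheorem.

Theorem theorem4p5 (R : realType) (beta : R) : 0 < beta ->
  exists c : R, 0 < c /\
  forall u phi : R[i] -> R[i],
    holo u -> selfmap phi -> bounded_op beta (wcomp u phi) ->
    let M : \bar R :=
      maxe
        (limn_esup (fun n : nat => ((n.+1)%:R)%:E *
           nu_norm beta (fun z => ((2 * cder u z * cder phi z
                                   + u z * cder (cder phi) z) * phi z ^+ n)%R)))%E
        (maxe
          (limn_esup (fun n : nat => ((n.+1)%:R ^+ 2)%R%:E *
             nu_norm beta (fun z => (u z * cder phi z ^+ 2 * phi z ^+ n)%R)))%E
          (limn_esup (fun n : nat => (ln (n%:R : R))%:E *
             nu_norm beta (fun z => (cder (cder u) z * phi z ^+ n)%R)))%E) in
    ((c^-1)%:E * M <= essnorm beta (wcomp u phi))%E /\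
    (essnorm beta (wcomp u phi) <= c%:E * M)%E.
Proof.
move=> _; exists (ess_const R); split; first by rewrite /ess_const; lra.
move=> u phi /holE hu /holmapE hphi hb; rewrite -!dCE.
exact: essnorm_equiv hu hphi hb.
Qed.
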